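(* There is an absolute constant $C>0$ such that the following holds. Fix $j\in\mathbb N$ and write $\phi=\phi_j$, $\lambda=\lambda_j$. For every $0<x\le 1$, $$\Big|\frac{\phi(x)}{x}-\tfrac12\lambda\phi(1)\widetilde B_2\!\left(\tfrac1x\right)\Big|\le C\,|\lambda|^5(\log|\lambda|)^2\,x\Big(1+\log\tfrac1x\Big).$$
   Context: Let $K:[0,1]\times[0,1]\to\mathbb R$ be defined by $K(x,y)=\frac12-\{(xy)^{-1}\}$ if $0<x,y\le 1$, and $K(x,y)=0$ if $0\le x,y\le1$ and $xy=0$, where $\{\alpha\}=\alpha-\lfloor\alpha\rfloor$. Let $L^2([0,1])$ denote the space of real-valued Lebesgue measurable square-integrable functions on $[0,1]$, with $\langle f,g\rangle=\int_0^1 f(x)g(x)\,dx$ and $\|f\|=\langle f,f\rangle^{1/2}$. A function $\phi$ is an eigenfunction of $K$ (with eigenvalue $\lambda\in\mathbb R$) if $\phi\in L^2([0,1])$, $\|\phi\|>0$, and $\phi(x)=\lambda\int_0^1 K(x,y)\phi(y)\,dy$ for every $x\in[0,1]$. Let $\phi_1,\phi_2,\ldots$ be a maximal orthonormal system in $L^2([0,1])$ of eigenfunctions of $K$, $\phi_j$ having the nonzero real eigenvalue $\lambda_j$, numbered so that $0<|\lambda_1|\le|\lambda_2|\le\cdots$ and $\lambda_j\ge\lambda_{j+1}$ whenever $|\lambda_j|=|\lambda_{j+1}|$. The periodic Bernoulli function is $\widetilde B_2(t)=\{t\}^2-\{t\}+\frac16$ for $t\in\mathbb R$. *)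

(* Defs.v *)
From HB Require Import structures.
From mathcomp Require Import all_boot all_order all_algebra.
From mathcomp Require Import all_classical all_reals all_analysis.
Set Implicit Arguments. Unset Strict Implicit. Unset Printing Implicit Defensive.
Import Order.TTheory GRing.Theory Num.Theory.
Import numFieldNormedType.Exports.
Local Open Scope classical_set_scope.
Local Open Scope ring_scope.

Section Defs.
Variable R : realType.

Local Notation mu := (@lebesgue_measure R).

Definition I01 : set R := `[(0:R), 1]%classic.

Definition fracp (a : R) : R := a - (Num.floor a)%:~R.

Definition Kker (x y : R) : R :=
  if (0 < x) && (0 < y) then 2^-1 - fracp ((x * y)^-1) else 0.

Definition B2t (t : R) : R := fracp t ^+ 2 - fracp t + 6^-1.

Definition L2_01 (f : R -> R) : Prop :=
  measurable_fun I01 f /\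
  mu.-integrable I01 (fun x => ((f x) ^+ 2)%:E).

Definition inner (f g : R -> R) : R := Rintegral mu I01 (fun x => f x * g x).

Definition l2norm (f : R -> R) : R := Num.sqrt (inner f f).

Definition is_eigenfunction (phi : R -> R) (lam : R) : Prop :=
  L2_01 phi /\ 0 < l2norm phi /\
  forall x, 0 <= x <= 1 ->
    phi x = lam * Rintegral mu I01 (fun y => Kker x y * phi y).

(* phi (index j : nat) stands for phi_{j+1}; similarly lam *)
Definition maximal_ordered_eigensystem (phi : nat -> R -> R) (lam : nat -> R)
  : Prop :=
  (forall j, is_eigenfunction (phi j) (lam j) /\ lam j != 0) /\
  (forall i j, inner (phi i) (phi j) = if i == j then 1 else 0) /\
  (forall psi mu0, is_eigenfunction psi mu0 -> mu0 != 0 ->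
     exists j, inner (phi j) psi != 0) /\
  (forall j, 0 < `|lam j| <= `|lam j.+1|) /\
  (forall j, `|lam j| = `|lam j.+1| -> lam j.+1 <= lam j).

End Defs.

(* Main.v *)
(** The eigenvalue equation reads phi(x) = - lam int_0^1 B1(1/(xy)) phi(y) dy, with
    B1(t) = {t} - 1/2 half the derivative of B2.  Integrating by parts in 1/y gives
    the main term (lam x / 2) phi(1) B2(1/x) and a remainder in which B2(1/(xy)) is
    integrated against phi and phi'; a second integration by parts gains the factor x.
    What has to be controlled is therefore the regularity of phi near 0.

    Decay: splitting phi = lam K phi at z = x and using that y^2 B1(1/(yz)) has
    variation O(1/z) in y, one gets
    |phi(x)| <= Lam^3 x + Lam^2 x int_x^1 |phi(z)|/z dz with Lam = |lam|, whence
    int |phi(z)|/z dz = O(Lam log Lam) and phi(x) = O(Lam^3 log Lam x).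

    Derivative: y^2 phi'(y) = lam D(y) almost everywhere, where
    D(y) = int_0^1 phi(z)/z dz - sum_{n > 1/y} phi(1/(ny))/n
    is the error of a Riemann sum and is at most y times the variation of z phi(z).
    On [eps, 1] that variation is O(Lam log(1/eps) int |phi(z)|/z dz) by the shape of
    the kernel, and on ]0, eps] it is bounded by the derivative again; with
    eps = 1/(2 Lam^2) the resulting inequality is contracting and gives
    y phi'(y) = O(Lam^3 (log Lam)^2).

    Remainder: in int B2(1/(xy)) D(y) dy the terms n <= 1/x are integrated by parts,
    each contributing O(x/n), and the terms n > 1/x are estimated trivially. *)
Require Import Defs.
From HB Require Import structures.
From mathcomp Require Import all_boot all_order all_algebra.
From mathcomp Require Import all_classical all_reals all_analysis.
From mathcomp Require Import measurable_realfun.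
From mathcomp Require Import zify ring lra.
Set Implicit Arguments. Unset Strict Implicit. Unset Printing Implicit Defensive.
Import Order.TTheory GRing.Theory Num.Theory.
Import numFieldNormedType.Exports.
Local Open Scope classical_set_scope.
Local Open Scope ring_scope.

(** Neither derivatives nor Stieltjes integrals of phi are formed. That p is the derivative of P is
    stated as: increments of P are integrals of p. A variation bound is stated as: increments of g
    are dominated by those of some V. Both are exploited by cutting an interval into N equal pieces
    and letting N grow. The series D is never summed either: capping the floor in the kernel at N
    leaves finite sums and an error O(1/N) on each [d, 1]; the limits N -> infinity, then d -> 0,
    are taken last. A contraction needs a finite bound to start from. On [d, 1] a crude Lipschitz
    bound exists, with a constant unbounded as d -> 0; each round halves the excess over a limit
    independent of d, and one last round with d -> 0 removes a term of order Lam^4 log Lam. The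
    length eps = 1/(2 Lam^2) serves twice: Lam^2 eps = 1/2 absorbs the integral in the decay bound,
    and Lam eps <= 1/2 makes the derivative inequality contract. Normalisation gives |phi| <= Lam/2,
    hence Lam >= 2 and log Lam >= 1/2, so absolute constants are absorbed into powers of Lam and log
    Lam. *)

Section Calculus.

(** * Measurability, and integrals over half-open intervals *)

Variable R : realType.
Implicit Types (a b c x y z : R) (f g p : R -> R).
Local Notation mu := (@lebesgue_measure R).

(** Inversion is discontinuous at 0, where 0^-1 = 0 by convention, so it is glued from exp and ln on
    the two half-lines. *)
Lemma measurable_invr : measurable_fun [set: R] (fun y : R => y^-1).
Proof.
have -> : (fun y : R => y^-1) = (fun y => if 0 < y then expR (- ln y)
    else if y < 0 then - expR (- ln (- y)) else 0).
  apply/funext => y; case: ifPn => y0; first by rewrite expRN lnK.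
  case: ifPn => y1; first by rewrite expRN lnK ?posrE ?oppr_gt0// invrN opprK.
  by have -> : y = 0; [lra | rewrite invr0].
have m0 : measurable_fun [set: R] (fun y : R => expR (- ln y)).
  apply: measurableT_comp; first exact: measurable_expR.
  by apply: measurableT_comp => //; exact: measurable_ln.
apply: measurable_fun_ifT => //; first exact: measurable_fun_ltr.
apply: measurable_fun_ifT => //; first exact: measurable_fun_ltr.
apply: (@measurableT_comp _ _ _ _ _ _ (@GRing.opp R)) => //.
exact: (@measurableT_comp _ _ _ _ _ _ (fun y : R => expR (- ln y)) _ (@GRing.opp R)).
Qed.

Lemma measurable_floorr :
  measurable_fun [set: R] (fun y : R => (Num.floor y)%:~R : R).
Proof.
apply: nondecreasing_measurable => // x y xy.
by rewrite ler_int le_floor.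
Qed.

(** Half-open, so that consecutive intervals are disjoint and split without endpoint terms, and so
    that 0 is not a point of integration when a = 0. *)
Definition Int a b f : R := Rintegral mu `]a, b]%classic f.

(** On a bounded interval this implies integrability and, unlike integrability, it is stable under
    products. *)
Definition bdd_measurable a b f : Prop :=
  measurable_fun `]a, b]%classic f /\
  exists M, forall y, a < y <= b -> `|f y| <= M.

Lemma in_itvoc a b y : `]a, b]%classic y = (a < y <= b).
Proof. by rewrite /= in_itv. Qed.

Lemma bdd_measurable_integrable a b f : bdd_measurable a b f ->
  mu.-integrable `]a, b]%classic (EFin \o f).
Proof.
move=> [mf [M hM]]; apply: measurable_bounded_integrable => //.
  rewrite /= lebesgue_measure_itv /=; case: ifP => //= _.
  by rewrite -EFinB ltry.
exists M; split; first exact: num_real.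
move=> t Mt y /=; rewrite in_itv /= => yab.
exact: le_trans (hM _ yab) (ltW Mt).
Qed.

Lemma bdd_measurableT a b f M : measurable_fun [set: R] f ->
  (forall y, a < y <= b -> `|f y| <= M) -> bdd_measurable a b f.
Proof. by move=> mf hM; split; [exact: measurable_funTS | exists M]. Qed.

Lemma bdd_measurable_cst a b c : bdd_measurable a b (fun=> c).
Proof. by split => //; exists `|c|. Qed.

Lemma bdd_measurableD a b f g : bdd_measurable a b f -> bdd_measurable a b g ->
  bdd_measurable a b (fun y => f y + g y).
Proof.
move=> [mf [M hM]] [mg [N hN]]; split; first exact: measurable_funD.
exists (M + N) => y yab; apply: le_trans (ler_normD _ _) _.
by apply: lerD; [exact: hM | exact: hN].
Qed.

Lemma bdd_measurableM a b f g : bdd_measurable a b f -> bdd_measurable a b g ->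
  bdd_measurable a b (fun y => f y * g y).
Proof.
move=> [mf [M hM]] [mg [N hN]]; split; first exact: measurable_funM.
exists (M * N) => y yab; rewrite normrM.
by apply: ler_pM => //; [exact: hM | exact: hN].
Qed.

Lemma bdd_measurableZ a b c f : bdd_measurable a b f ->
  bdd_measurable a b (fun y => c * f y).
Proof. by apply: bdd_measurableM; exact: bdd_measurable_cst. Qed.

Lemma bdd_measurableN a b f : bdd_measurable a b f ->
  bdd_measurable a b (fun y => - f y).
Proof.
move=> /(bdd_measurableZ (-1)) H.
by rewrite (_ : (fun y => - f y) = (fun y => -1 * f y))//; apply/funext => y; rewrite mulN1r.
Qed.

Lemma bdd_measurableB a b f g : bdd_measurable a b f -> bdd_measurable a b g ->
  bdd_measurable a b (fun y => f y - g y).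
Proof. by move=> hf hg; apply: bdd_measurableD => //; exact: bdd_measurableN. Qed.

Lemma bdd_measurable_norm a b f : bdd_measurable a b f ->
  bdd_measurable a b (fun y => `|f y|).
Proof.
move=> [mf [M hM]]; split; first exact: measurableT_comp.
by exists M => y yab; rewrite normr_id; exact: hM.
Qed.

Lemma bdd_measurable_sum a b n (F : nat -> R -> R) :
  (forall i, bdd_measurable a b (F i)) ->
  bdd_measurable a b (fun y => \sum_(0 <= i < n) F i y).
Proof.
move=> hF; elim: n => [|n IH].
  by under eq_fun do rewrite big_nil; exact: bdd_measurable_cst.
by under eq_fun do rewrite big_nat_recr//=; exact: bdd_measurableD.
Qed.

Lemma bdd_measurableS a b a' b' f : a <= a' -> b' <= b ->
  bdd_measurable a b f -> bdd_measurable a' b' f.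
Proof.
move=> aa' bb' [mf [M hM]]; split.
  apply: measurable_funS mf => // y; rewrite !in_itvoc; lra.
by exists M => y yab; apply: hM; lra.
Qed.

Lemma bdd_measurable_id a b : bdd_measurable a b (fun y => y).
Proof.
apply: (@bdd_measurableT _ _ _ (`|a| + `|b|)) => // y yab; rewrite ler_norml.
have := ler_norm b; have := ler_norm (- a); rewrite normrN.
by have := normr_ge0 a; have := normr_ge0 b; lra.
Qed.

Lemma bdd_measurable_inv a b : 0 < a -> bdd_measurable a b (fun y => y^-1).
Proof.
move=> a0; apply: (@bdd_measurableT _ _ _ a^-1); first exact: measurable_invr.
move=> y /andP[ay yb]; have y0 : 0 < y by lra.
by rewrite ger0_norm ?invr_ge0 ?(ltW y0)// lef_pV2 ?posrE//; lra.
Qed.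

Lemma eq_Int a b f g : (forall y, a < y <= b -> f y = g y) -> Int a b f = Int a b g.
Proof. by move=> fg; apply: eq_Rintegral => y /[!inE]/=; rewrite in_itv/=; exact: fg. Qed.

Lemma Int_nil a f : Int a a f = 0.
Proof.
by rewrite /Int set_itv_ge ?Rintegral_set0// -leNgt bnd_simp.
Qed.

Lemma Int_split a c b f : a <= c <= b -> bdd_measurable a b f ->
  Int a b f = Int a c f + Int c b f.
Proof.
move=> /andP[ac cb] hf; rewrite /Int (@itv_bndbnd_setU _ _ _ (BRight c)) ?bnd_simp//.
rewrite Rintegral_setU//.
  rewrite -itv_bndbnd_setU ?bnd_simp//; exact: bdd_measurable_integrable.
apply/disj_setPS => y [] /=; rewrite !in_itv/=; lra.
Qed.

Lemma IntD a b f g : bdd_measurable a b f -> bdd_measurable a b g ->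
  Int a b (fun y => f y + g y) = Int a b f + Int a b g.
Proof. by move=> hf hg; apply: RintegralD => //; exact: bdd_measurable_integrable. Qed.

Lemma IntB a b f g : bdd_measurable a b f -> bdd_measurable a b g ->
  Int a b (fun y => f y - g y) = Int a b f - Int a b g.
Proof. by move=> hf hg; apply: RintegralB => //; exact: bdd_measurable_integrable. Qed.

Lemma IntZ a b c f : bdd_measurable a b f ->
  Int a b (fun y => c * f y) = c * Int a b f.
Proof. by move=> hf; apply: RintegralZl => //; exact: bdd_measurable_integrable. Qed.

Lemma Int_cst a b c : a <= b -> Int a b (fun=> c) = c * (b - a).
Proof.
move=> ab; rewrite /Int Rintegral_cst//=.
rewrite lebesgue_measure_itv /= lte_fin.
by case: ltP => //= ba; have -> : b = a; lra.
Qed.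

Lemma Int_sum a b n (F : nat -> R -> R) : a <= b ->
  (forall i, bdd_measurable a b (F i)) ->
  Int a b (fun y => \sum_(0 <= i < n) F i y) = \sum_(0 <= i < n) Int a b (F i).
Proof.
move=> ab hF; elim: n => [|n IH].
  by under eq_Int do rewrite big_nil; rewrite Int_cst// mul0r big_nil.
under eq_Int do rewrite big_nat_recr//=.
by rewrite IntD ?IH ?big_nat_recr//; exact: bdd_measurable_sum.
Qed.

Lemma le_Int a b f g : bdd_measurable a b f -> bdd_measurable a b g ->
  (forall y, a < y <= b -> f y <= g y) -> Int a b f <= Int a b g.
Proof.
by move=> hf hg fg; apply: le_Rintegral => //; exact: bdd_measurable_integrable.
Qed.

Lemma le_norm_Int a b f g : bdd_measurable a b f -> bdd_measurable a b g ->
  (forall y, a < y <= b -> `|f y| <= g y) -> `|Int a b f| <= Int a b g.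
Proof.
move=> hf hg fg; apply: (@le_trans _ _ (Int a b (fun y => `|f y|))).
  by apply: le_normr_Rintegral => //; exact: bdd_measurable_integrable.
by apply: le_Int => //; exact: bdd_measurable_norm.
Qed.

Lemma Int_bound a b f M : a <= b -> bdd_measurable a b f ->
  (forall y, a < y <= b -> `|f y| <= M) -> `|Int a b f| <= M * (b - a).
Proof.
move=> ab hf hM; rewrite -Int_cst//.
by apply: le_norm_Int => //; exact: bdd_measurable_cst.
Qed.

Lemma Int_ge0 a b f : (forall y, a < y <= b -> 0 <= f y) -> 0 <= Int a b f.
Proof. by move=> f0; exact: Rintegral_ge0. Qed.

End Calculus.

(** * Monotone domination, Abel summation and primitives *)

Section ByParts.
Variable R : realType.
Implicit Types (a b c x y z : R) (f g p : R -> R).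

(** The limit N -> infinity in inequality form, from the Archimedean property alone. *)
Lemma le_add_divn (X B c : R) (N0 : nat) :
  (forall N, (N0 <= N)%N -> X <= B + c / N.+1%:R) -> X <= B.
Proof.
move=> h; rewrite leNgt; apply/negP => BX.
have XB0 : 0 < X - B by lra.
pose N := (N0 + Num.bound (`|c| / (X - B)))%N.
have := h N (leq_addr _ _).
have cN : `|c| / (X - B) < N.+1%:R.
  have /lt_le_trans := archi_boundP (divr_ge0 (normr_ge0 c) (ltW XB0)).
  by apply; rewrite ler_nat /N -addnS (leq_trans _ (leq_addl _ _)).
have N0' : (0 : R) < N.+1%:R by rewrite ltr0n.
move: cN; rewrite ltr_pdivrMr// => cN.
have : c / N.+1%:R < X - B.
  by rewrite ltr_pdivrMr// mulrC; apply: le_lt_trans cN; exact: ler_norm.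
by set t := c / _ => h1 h2; lra.
Qed.

Lemma le_add_eps (X B c : R) :
  (forall d, 0 < d -> d <= 4^-1 -> X <= B + c * d) -> X <= B.
Proof.
move=> h; apply: (@le_add_divn _ _ c 3) => N hN; apply: h.
  by rewrite invr_gt0 ltr0n.
by rewrite lef_pV2 ?posrE ?ltr0n// ler_nat.
Qed.

(* Cut [a, b] into N equal pieces and let N tend to infinity. *)
Lemma increment_bound (T V : R -> R) q C a b : a <= b ->
  (forall y z, a <= y -> y <= z -> z <= b ->
     `|T z - T y| <= (q + C * (z - y)) * (V z - V y)) ->
  `|T b - T a| <= q * (V b - V a).
Proof.
move=> ab h; apply: (@le_add_divn _ _ (C * (b - a) * (V b - V a)) 0) => N _.
have N0 : (0 : R) < N.+1%:R by rewrite ltr0n.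
set d := (b - a) / N.+1%:R.
have d0 : 0 <= d by rewrite divr_ge0 ?(ltW N0)// subr_ge0.
have dN : d * N.+1%:R = b - a by rewrite divfK// gt_eqF.
have main k : (k <= N.+1)%N ->
    `|T (a + d * k%:R) - T a| <= (q + C * d) * (V (a + d * k%:R) - V a).
  elim: k => [_|k IH kN]; first by rewrite mulr0 addr0 !subrr normr0 mulr0.
  have := IH (ltnW kN).
  have kN' : d * k.+1%:R <= b - a by rewrite -dN ler_wpM2l// ler_nat.
  have e : d * k.+1%:R = d * k%:R + d by rewrite -natr1 mulrDr mulr1.
  have dk0 : 0 <= d * k%:R by rewrite mulr_ge0.
  rewrite e in kN' *.
  have := h (a + d * k%:R) (a + (d * k%:R + d)) ltac:(lra) ltac:(lra) ltac:(lra).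
  set u := T (a + (_ + _)); set v := T (a + _).
  have -> : a + (d * k%:R + d) - (a + d * k%:R) = d by ring.
  move=> h1 h2; have -> : u - T a = (u - v) + (v - T a) by ring.
  by apply: le_trans (ler_normD _ _) _; lra.
have := main N.+1 (leqnn _); rewrite dN (_ : a + (b - a) = b); last by ring.
move=> /le_trans; apply; rewrite le_eqVlt; apply/orP; left; apply/eqP.
by rewrite /d; move: N0; set M := _%:R => N0; field; rewrite gt_eqF.
Qed.

(** V stands in for the variation of g: any function with larger increments will do, and for the
    kernel explicit ones exist. *)
Definition dominated_on a b g (V : R -> R) :=
  forall y z, a <= y -> y <= z -> z <= b -> `|g z - g y| <= V z - V y.

(** Both V and g + V are nondecreasing on [a, b], so g is a difference of monotone functions. *)
Lemma dominated_bdd_measurable a b g V : dominated_on a b g V ->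
  bdd_measurable a b g.
Proof.
move=> h; have [ba|ab] := ltP b a.
  split; last by exists 0 => y; lra.
  by rewrite set_itv_ge ?bnd_simp -?leNgt ?(ltW ba)//; exact: measurable_fun_set0.
(* Clamping to [a, b] extends the two monotone functions to the whole line, where monotonicity
   yields measurability. *)
pose cl y := Num.min b (Num.max a y).
have cl_a y : a <= cl y by rewrite /cl le_min ab le_max lexx.
have cl_b y : cl y <= b by rewrite /cl ge_min lexx.
have cl_mono y z : y <= z -> cl y <= cl z.
  by move=> yz; rewrite /cl le_min !ge_min lexx /= ge_max !le_max lexx yz !orbT.
have clE y : a < y <= b -> cl y = y.
  by move=> /andP[ay yb]; rewrite /cl max_r ?(ltW ay)// min_r.
split.
  have m1 : measurable_fun [set: R] (fun y => g (cl y) + V (cl y)).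
    apply: nondecreasing_measurable => // y z yz.
    have := h (cl y) (cl z) (cl_a _) (cl_mono _ _ yz) (cl_b _).
    by rewrite ler_norml; lra.
  have m2 : measurable_fun [set: R] (fun y => V (cl y)).
    apply: nondecreasing_measurable => // y z yz.
    have := h (cl y) (cl z) (cl_a _) (cl_mono _ _ yz) (cl_b _).
    by have := normr_ge0 (g (cl z) - g (cl y)); lra.
  have m3 := measurable_funTS (D := `]a, b]%classic) (measurable_funB m1 m2).
  apply: eq_measurable_fun m3 => y; rewrite inE in_itvoc => yab /=.
  by rewrite clE//; lra.
exists (`|g b| + (V b - V a)) => y yab.
have h1 := h y b ltac:(lra) ltac:(lra) ltac:(lra).
have h2 := h a y ltac:(lra) ltac:(lra) ltac:(lra).
have -> : g y = g b - (g b - g y) by ring.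
apply: le_trans (ler_normB _ _) _.
by have := normr_ge0 (g y - g a); lra.
Qed.

(** Integration by parts: with P the integral of p from a, the integral of p g is P(b) g(b) minus
    that of P dg, and |P| <= q. *)
Lemma abel_bound a b p g V q : a <= b -> bdd_measurable a b p ->
  dominated_on a b g V ->
  (forall y, a <= y <= b -> `|Int a y p| <= q) ->
  `|Int a b (fun y => p y * g y)| <= q * (`|g b| + (V b - V a)).
Proof.
move=> ab hp hV hq; have hg := dominated_bdd_measurable hV.
have hpg : bdd_measurable a b (fun y => p y * g y) by exact: bdd_measurableM.
have [_ [M hM]] := hp.
(* [T] plays the role of minus the integral of P dg. Over [y, z] it moves by at most q (V z - V y),
   up to the same increment times M (z - y), which [increment_bound] removes. *)
pose T y := Int a y (fun y => p y * g y) - Int a y p * g y.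
have hT : `|T b - T a| <= q * (V b - V a).
  apply: (@increment_bound T V q M) => // y z ay yz zb.
  have ez : Int a z (fun y => p y * g y) =
      Int a y (fun y => p y * g y) + Int y z (fun y => p y * g y).
    by apply: Int_split; [lra | apply: bdd_measurableS hpg].
  have ep : Int a z p = Int a y p + Int y z p.
    by apply: Int_split; [lra | apply: bdd_measurableS hp].
  have hp' : bdd_measurable y z p by exact: bdd_measurableS hp.
  have hpg' : bdd_measurable y z (fun y => p y * g y) by exact: bdd_measurableS hpg.
  have -> : T z - T y =
      Int y z (fun v => p v * g v - g z * p v) - Int a y p * (g z - g y).
    by rewrite IntB ?IntZ ?/T ?ez ?ep; [ring | | |exact: bdd_measurableZ].
  have hVyz := hV y z ay yz zb.
  have h1 : `|Int a y p * (g z - g y)| <= q * (V z - V y).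
    by rewrite normrM ler_pM// hq; lra.
  have h2 : `|Int y z (fun v => p v * g v - g z * p v)| <=
      (M * (V z - V y)) * (z - y).
    apply: Int_bound => //; first by apply: bdd_measurableB => //; exact: bdd_measurableZ.
    move=> v yvz; have -> : p v * g v - g z * p v = - (p v * (g z - g v)) by ring.
    rewrite normrN normrM ler_pM//; first by apply: hM; lra.
    have /andP[yv vz] := yvz.
    have h3 := hV v z (le_trans ay (ltW yv)) vz zb.
    have h4 := hV y v ay (ltW yv) (le_trans vz zb).
    by have := normr_ge0 (g v - g y); lra.
  by apply: le_trans (ler_normB _ _) _; lra.
have -> : Int a b (fun y => p y * g y) = Int a b p * g b + (T b - T a).
  by rewrite /T !Int_nil; ring.
apply: le_trans (ler_normD _ _) _; rewrite mulrDr lerD// normrM ler_wpM2r//.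
by apply: hq; lra.
Qed.

(** An integral relation rather than a derivative, so that p may jump and P may have kinks, as
    happens for B2(1/(xw)). *)
Definition primitive_on a b p (P : R -> R) := bdd_measurable a b p /\
  forall y z, a <= y -> y <= z -> z <= b -> P z - P y = Int y z p.

Lemma primitive_lipschitz a b p P : primitive_on a b p P ->
  exists M, (forall y, a < y <= b -> `|p y| <= M) /\
            dominated_on a b P (fun y => M * y).
Proof.
move=> [hp h]; have [_ [M hM]] := hp; exists M; split=> // y z ay yz zb.
rewrite h// -mulrBr; apply: Int_bound => //; first exact: bdd_measurableS hp.
by move=> v yvz; apply: hM; lra.
Qed.

Lemma primitive_bdd_measurable a b p P : primitive_on a b p P ->
  bdd_measurable a b P.
Proof. by move=> /primitive_lipschitz[M [_ /dominated_bdd_measurable]]. Qed.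

(** Freezing one factor at an end of [y, z] costs O((z - y)^2), which [increment_bound] with q = 0
    sends to zero. *)
Lemma primitiveM a b p P g G : primitive_on a b p P -> primitive_on a b g G ->
  primitive_on a b (fun y => p y * G y + P y * g y) (fun y => P y * G y).
Proof.
move=> hP hG.
have [M [hM dP]] := primitive_lipschitz hP.
have [N [hN dG]] := primitive_lipschitz hG.
have mP := primitive_bdd_measurable hP; have mG := primitive_bdd_measurable hG.
have [mp eP] := hP; have [mg eG] := hG.
have mI : bdd_measurable a b (fun y => p y * G y + P y * g y).
  by apply: bdd_measurableD; apply: bdd_measurableM.
split=> // y0 z0 ay0 yz0 zb0.
pose T z := P z * G z - Int y0 z (fun y => p y * G y + P y * g y).
suff : `|T z0 - T y0| <= 0 * (z0 - y0).
  by rewrite mul0r normr_le0 /T Int_nil => /eqP; lra.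
apply: (@increment_bound T id 0 (2 * (M * N))) => // y z y0y yz zz0.
have ez : Int y0 z (fun y => p y * G y + P y * g y) =
    Int y0 y (fun y => p y * G y + P y * g y) +
    Int y z (fun y => p y * G y + P y * g y).
  by apply: Int_split; [lra | apply: bdd_measurableS mI; lra].
have S f : bdd_measurable a b f -> bdd_measurable y z f.
  by apply: bdd_measurableS; lra.
have -> : T z - T y = Int y z (fun v => (G y * p v + P z * g v) -
     (p v * G v + P v * g v)).
  rewrite IntB; [|apply: S; apply: bdd_measurableD; exact: bdd_measurableZ|exact: S].
  rewrite IntD; [|apply: S; exact: bdd_measurableZ|apply: S; exact: bdd_measurableZ].
  rewrite !IntZ; [|exact: S..].
  rewrite -eP ?(le_trans ay0)// -?eG ?(le_trans ay0)//; try lra.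
  by rewrite /T ez; ring.
rewrite add0r.
have -> : 2 * (M * N) * (z - y) * (id z - id y) =
   (M * (N * (z - y)) + (M * (z - y)) * N) * (z - y) by rewrite /=; ring.
apply: Int_bound => //.
  apply: S; apply: bdd_measurableB => //.
  by apply: bdd_measurableD; exact: bdd_measurableZ.
move=> v yvz; have /andP[yv vz] := yvz.
have ay := le_trans ay0 y0y; have zb := le_trans zz0 zb0.
have -> : G y * p v + P z * g v - (p v * G v + P v * g v) =
   (P z - P v) * g v - p v * (G v - G y) by ring.
have MN : 0 <= M /\ 0 <= N.
  have hn := hN v ltac:(lra); have hm := hM v ltac:(lra).
  by split; [exact: le_trans hm | exact: le_trans hn].
case: MN => M0 N0.
apply: le_trans (ler_normB _ _) _; rewrite addrC !normrM lerD//.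
  apply: ler_pM => //; first by apply: hM; lra.
  apply: le_trans (dG y v ay (ltW yv) (le_trans vz zb)) _.
  by rewrite -mulrBr ler_wpM2l//; lra.
apply: ler_pM => //; last by apply: hN; lra.
apply: le_trans (dP v z (le_trans ay (ltW yv)) vz zb) _.
by rewrite -mulrBr ler_wpM2l//; lra.
Qed.

(** A quantitative fundamental theorem: the slope of F over [y, z] is compared with f at every point
    of ]y, z], so the errors add up to O(mesh). *)
Lemma primitive_of_slope a b f F C : bdd_measurable a b f ->
  (forall y z v, a <= y -> y < v <= z -> z <= b ->
     `|F z - F y - (z - y) * f v| <= C * (z - y) ^+ 2) ->
  primitive_on a b f F.
Proof.
move=> mf h; split=> // y0 z0 ay0 yz0 zb0.
pose T z := F z - Int y0 z f.
suff : `|T z0 - T y0| <= 0 * (z0 - y0).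
  by rewrite mul0r normr_le0 /T Int_nil => /eqP; lra.
apply: (@increment_bound T id 0 C) => // y z y0y yz zz0.
move: yz; rewrite le_eqVlt => /predU1P[->|yz].
  by rewrite !subrr normr0 mulr0.
have mf' : bdd_measurable y z f by apply: bdd_measurableS mf; lra.
have ez : Int y0 z f = Int y0 y f + Int y z f.
  by apply: Int_split; [lra | apply: bdd_measurableS mf; lra].
have zy0 : z - y != 0 by rewrite gt_eqF// subr_gt0.
have -> : T z - T y = Int y z (fun v => (F z - F y) / (z - y) - f v).
  rewrite IntB//; last exact: bdd_measurable_cst.
  by rewrite Int_cst ?(ltW yz)// divfK// /T ez; ring.
rewrite add0r; apply: Int_bound; first exact: ltW.
  by apply: bdd_measurableB => //; exact: bdd_measurable_cst.
move=> v yvz; have hh := h y z v ltac:(lra) ltac:(lra) ltac:(lra).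
have zy : 0 < z - y by lra.
rewrite -(ler_pM2r zy).
set A := _ / _; have -> : `|A - f v| * (z - y) = `|(A - f v) * (z - y)|.
  by rewrite normrM (gtr0_norm zy).
rewrite mulrBl divfK//.
by rewrite (mulrC (f v)); apply: le_trans hh _; rewrite expr2 mulrA.
Qed.

End ByParts.

(** * Periodic Bernoulli functions along 1/(xw) *)

Section Bernoulli.
Variable R : realType.
Implicit Types (a b c x y z v w : R) (f g p : R -> R).

Lemma inv_pos_le y z : 0 < y -> y <= z -> 0 < z^-1 /\ z^-1 <= y^-1.
Proof.
move=> y0 yz; have z0 : 0 < z by exact: lt_le_trans yz.
by rewrite invr_gt0 z0 lef_pV2.
Qed.

Lemma inv_sub y z : 0 < y -> 0 < z -> y^-1 - z^-1 = (z - y) * (y^-1 * z^-1).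
Proof. by move=> y0 z0; field; rewrite !gt_eqF. Qed.

Lemma primitive_invr2 a b : 0 < a ->
  primitive_on a b (fun w => w^-1 ^+ 2) (fun w => - w^-1).
Proof.
move=> a0; apply: (@primitive_of_slope _ _ _ _ _ (2 * a^-1 ^+ 3)).
  by under eq_fun do rewrite expr2; apply: bdd_measurableM; exact: bdd_measurable_inv.
move=> y z v ay /andP[yv vz] zb.
have y0 : 0 < y by lra. have v0 : 0 < v by lra. have z0 : 0 < z by lra.
have [i0 ia] := inv_pos_le a0 ay.
have [k0 ki] := inv_pos_le y0 (ltW yv); have [j0 jk] := inv_pos_le v0 vz.
have e := inv_sub y0 z0.
move: e i0 ia k0 ki j0 jk; set i := y^-1; set j := z^-1; set k := v^-1; set A := a^-1.
move=> e i0 iA k0 ki j0 jk.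
have -> : - j - - i - (z - y) * k ^+ 2 = (z - y) * (i * j - k ^+ 2).
  by rewrite addrC opprK (addrC (- j)) e; ring.
have zy : 0 < z - y by lra.
rewrite normrM (gtr0_norm zy) [X in _ <= X](_ : _ = (z - y) * (2 * A ^+ 3 * (z - y))); last by ring.
rewrite ler_pM2l//.
have h1 : `|i * j - k ^+ 2| <= (i - j) * (i + j).
  by rewrite ler_norml; apply/andP; split; nra.
have h2 : i + j <= 2 * A by lra.
have h3 : i - j <= (z - y) * A ^+ 2.
  by rewrite e ler_pM2l// expr2; apply: ler_pM; lra.
apply: le_trans h1 _.
have -> : 2 * A ^+ 3 * (z - y) = ((z - y) * A ^+ 2) * (2 * A) by ring.
by apply: ler_pM; lra.
Qed.

Lemma ln_le_subr1 y : 0 < y -> ln y <= y - 1.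
Proof.
move=> y0; have := @le_ln1Dx R (y - 1).
by rewrite (addrC 1) subrK; apply; lra.
Qed.

Lemma ln_sub_bounds y z : 0 < y -> y <= z ->
  (z - y) * z^-1 <= ln z - ln y <= (z - y) * y^-1.
Proof.
move=> y0 yz; have z0 : 0 < z by lra.
have := @ln_le_subr1 (z / y) (divr_gt0 z0 y0).
have := @ln_le_subr1 (y / z) (divr_gt0 y0 z0).
rewrite !ln_div//.
have -> : z / y - 1 = (z - y) * y^-1 by field; rewrite gt_eqF.
have -> : y / z - 1 = - ((z - y) * z^-1) by field; rewrite gt_eqF.
set u := _ * _; set t := _ * _; lra.
Qed.

Lemma primitive_ln a b : 0 < a -> primitive_on a b (fun w => w^-1) (@ln R).
Proof.
move=> a0; apply: (@primitive_of_slope _ _ _ _ _ (a^-1 ^+ 2)).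
  exact: bdd_measurable_inv.
move=> y z v ay /andP[yv vz] zb.
have y0 : 0 < y by lra. have v0 : 0 < v by lra. have z0 : 0 < z by lra.
have [i0 ia] := inv_pos_le a0 ay.
have [k0 ki] := inv_pos_le y0 (ltW yv); have [j0 jk] := inv_pos_le v0 vz.
have e := inv_sub y0 z0.
have /andP[l1 l2] := @ln_sub_bounds y z y0 ltac:(lra).
have zy : 0 < z - y by lra.
have h3 : y^-1 - z^-1 <= (z - y) * a^-1 ^+ 2.
  by rewrite e ler_pM2l// expr2; apply: ler_pM; lra.
have h4 : (z - y) * (y^-1 - z^-1) <= (z - y) * ((z - y) * a^-1 ^+ 2) by rewrite ler_pM2l.
have h5 : (z - y) * v^-1 <= (z - y) * y^-1 by rewrite ler_pM2l.
have h6 : (z - y) * z^-1 <= (z - y) * v^-1 by rewrite ler_pM2l.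
rewrite ler_norml; have -> : a^-1 ^+ 2 * (z - y) ^+ 2 = (z - y) * ((z - y) * a^-1 ^+ 2) by ring.
move: h4; rewrite mulrBr => h4; apply/andP; split; lra.
Qed.

Lemma Int_invr2 a b : 0 < a -> a <= b ->
  Int a b (fun w => w^-1 ^+ 2) = a^-1 - b^-1.
Proof. by move=> a0 ab; have [_ <-] := primitive_invr2 b a0; rewrite ?lexx//; ring. Qed.

Lemma Int_invr a b : 0 < a -> a <= b -> Int a b (fun w => w^-1) = ln b - ln a.
Proof. by move=> a0 ab; have [_ <-] := primitive_ln b a0; rewrite ?lexx. Qed.

Lemma bdd_measurable_invX a b n : 0 < a -> bdd_measurable a b (fun w => w^-1 ^+ n).
Proof.
move=> a0; elim: n => [|n IH].
  by under eq_fun do rewrite expr0; exact: bdd_measurable_cst.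
by under eq_fun do rewrite exprS; apply: bdd_measurableM => //; exact: bdd_measurable_inv.
Qed.

Lemma Int_invr3 a b : 0 < a -> a <= b ->
  Int a b (fun w => w^-1 ^+ 3) = (a^-1 ^+ 2 - b^-1 ^+ 2) / 2.
Proof.
move=> a0 ab; have hp := primitive_invr2 b a0.
have [_ /(_ a b)] := primitiveM hp hp; rewrite ab !lexx => /(_ isT isT isT) e.
have : Int a b (fun w => -2 * w^-1 ^+ 3) = - b^-1 * - b^-1 - - a^-1 * - a^-1.
  by rewrite e; apply: eq_Int => y _; ring.
by rewrite IntZ; [lra | exact: bdd_measurable_invX].
Qed.

Lemma primitive_invr3 a b : 0 < a ->
  primitive_on a b (fun w => w^-1 ^+ 3) (fun w => - (w^-1 ^+ 2 / 2)).
Proof.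
move=> a0; split; first exact: bdd_measurable_invX.
by move=> y z ay yz zb; rewrite Int_invr3//; [ring | exact: lt_le_trans ay].
Qed.

Lemma Int_invr4 a b : 0 < a -> a <= b ->
  Int a b (fun w => w^-1 ^+ 4) = (a^-1 ^+ 3 - b^-1 ^+ 3) / 3.
Proof.
move=> a0 ab.
have [_ /(_ a b)] := primitiveM (primitive_invr2 b a0) (primitive_invr3 b a0).
rewrite ab !lexx => /(_ isT isT isT) e.
have : Int a b (fun w => (- 3 / 2) * w^-1 ^+ 4) =
   - b^-1 * - (b^-1 ^+ 2 / 2) - - a^-1 * - (a^-1 ^+ 2 / 2).
  by rewrite e; apply: eq_Int => y _; move: (y^-1) => u; field.
by rewrite IntZ; [lra | exact: bdd_measurable_invX].
Qed.

(** With [B2t], the periodic Bernoulli functions of degrees 1 to 3: off the integers B2' = 2 B1 and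
    B3' = 3 B2. *)
Definition B1t (v : R) : R := fracp v - 2^-1.
Definition B3t (v : R) : R := fracp v ^+ 3 - 3 / 2 * fracp v ^+ 2 + fracp v / 2.

Lemma fracp_itv v : 0 <= fracp v < 1.
Proof.
have := floor_le v; have := floorD1_gt v; rewrite /fracp intrD /=; set t := _%:~R.
by rewrite mulr1z => h1 h2; lra.
Qed.

Lemma norm_B1t v : `|B1t v| <= 2^-1.
Proof. by have := fracp_itv v; rewrite /B1t ler_norml; lra. Qed.

Lemma norm_B2t v : `|B2t v| <= 6^-1.
Proof. have := fracp_itv v; rewrite /B2t ler_norml => ?; apply/andP; split; nra. Qed.

Lemma norm_B3t v : `|B3t v| <= 2^-1.
Proof.
have := fracp_itv v; rewrite /B3t; set f := fracp v => hf.
have -> : f ^+ 3 - 3 / 2 * f ^+ 2 + f / 2 = f * (1 - f) * (2^-1 - f) by field.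
have h : 0 <= f * (1 - f) <= 1 by apply/andP; split; nra.
by rewrite ler_norml; apply/andP; split; nra.
Qed.

Lemma fracpE (n : nat) v : n%:R <= v < n.+1%:R -> fracp v = v - n%:R.
Proof.
move=> hv; rewrite /fracp (@floor_def _ _ n%:Z) ?pmulrn//.
by rewrite -pmulrn intrD -pmulrn mulr1z natr1.
Qed.

Lemma fracp_nat (n : nat) : fracp (n%:R : R) = 0.
Proof. by rewrite (@fracpE n) ?subrr// lexx ltr_nat /=. Qed.

(** The right end is included because the polynomial agrees at 0 and 1; this continuity lets
    primitives be glued across the integers. *)
Lemma B2tE (n : nat) v : n%:R <= v <= n.+1%:R ->
  B2t v = (v - n%:R) ^+ 2 - (v - n%:R) + 6^-1.
Proof.
move=> /andP[nv]; rewrite le_eqVlt /B2t => /predU1P[->|vn].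
  by rewrite fracp_nat -natr1; ring.
by rewrite (@fracpE n)// nv.
Qed.

Lemma B3tE (n : nat) v : n%:R <= v <= n.+1%:R ->
  B3t v = (v - n%:R) ^+ 3 - 3 / 2 * (v - n%:R) ^+ 2 + (v - n%:R) / 2.
Proof.
move=> /andP[nv]; rewrite le_eqVlt /B3t => /predU1P[->|vn].
  by rewrite fracp_nat -natr1; field.
by rewrite (@fracpE n)// nv.
Qed.

Lemma measurable_fracp : measurable_fun [set: R] (@fracp R).
Proof. by apply: measurable_funB => //; exact: measurable_floorr. Qed.

Lemma measurable_B1t : measurable_fun [set: R] B1t.
Proof. by apply: measurable_funB => //; exact: measurable_fracp. Qed.

Lemma measurable_B2t : measurable_fun [set: R] (@B2t R).
Proof.
apply: measurable_funD => //; apply: measurable_funB; last exact: measurable_fracp.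
by apply: measurable_funX; exact: measurable_fracp.
Qed.

Lemma measurable_comp_invM x f : measurable_fun [set: R] f ->
  measurable_fun [set: R] (fun w => f (x * w)^-1).
Proof.
move=> mf; apply: (measurableT_comp mf).
apply: (@measurableT_comp _ _ _ _ _ _ (@GRing.inv R)); first exact: measurable_invr.
exact: measurable_funM.
Qed.

Lemma bdd_measurable_B1t a b x : bdd_measurable a b (fun w => B1t (x * w)^-1).
Proof.
apply: (@bdd_measurableT _ _ _ _ 2^-1) => [|y _]; last exact: norm_B1t.
exact: measurable_comp_invM measurable_B1t.
Qed.

Lemma bdd_measurable_B2t a b x : bdd_measurable a b (fun w => B2t (x * w)^-1).
Proof.
apply: (@bdd_measurableT _ _ _ _ 6^-1) => [|y _]; last exact: norm_B2t.
exact: measurable_comp_invM measurable_B2t.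
Qed.

(* [F] is a primitive of [f] up to kinks at the integers; on each piece
   [n, n+1] the formula is checked separately. *)
Lemma Int_comp_inv_chain x f F : 0 < x ->
  (forall a b, 0 < a -> bdd_measurable a b (fun w => f (x * w)^-1 * w^-1 ^+ 2)) ->
  (forall (n : nat) a b, 0 < a -> a <= b -> n%:R <= (x * b)^-1 ->
     (x * a)^-1 <= n.+1%:R ->
     Int a b (fun w => f (x * w)^-1 * w^-1 ^+ 2) =
     x * (F (x * a)^-1 - F (x * b)^-1)) ->
  forall a b, 0 < a -> a <= b ->
     Int a b (fun w => f (x * w)^-1 * w^-1 ^+ 2) =
     x * (F (x * a)^-1 - F (x * b)^-1).
Proof.
move=> x0 mf piece.
suff main (k : nat) a b : 0 < a -> a <= b -> (x * a)^-1 <= k.+1%:R ->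
     Int a b (fun w => f (x * w)^-1 * w^-1 ^+ 2) =
     x * (F (x * a)^-1 - F (x * b)^-1).
  move=> a b a0 ab; apply: (main (Num.bound (x * a)^-1)) => //.
  have := @archi_boundP _ (x * a)^-1 ltac:(by rewrite invr_ge0 mulr_ge0// ltW).
  by move=> /ltW/le_trans; apply; rewrite ler_nat.
elim: k a b => [|k IH] a b a0 ab hk.
  have b0 : 0 < b by exact: lt_le_trans ab.
  by apply: (piece 0%N) => //; rewrite invr_ge0 mulr_ge0// ltW.
have b0 : 0 < b by exact: lt_le_trans ab.
have [h|h] := leP k.+1%:R (x * b)^-1; first exact: (piece k.+1).
have [h'|h'] := leP (x * a)^-1 k.+1%:R; first exact: IH.
pose c := (x * k.+1%:R)^-1.
have k0 : (0 : R) < k.+1%:R by rewrite ltr0n.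
have xk0 : 0 < x * k.+1%:R by exact: mulr_gt0.
have c0 : 0 < c by rewrite invr_gt0.
have ec : (x * c)^-1 = k.+1%:R.
  by rewrite /c; move: k0; set m := _%:R => m0; field; rewrite !gt_eqF.
have xa0 : 0 < x * a by exact: mulr_gt0.
have xb0 : 0 < x * b by exact: mulr_gt0.
have ac : a <= c.
  rewrite -(ler_pM2l x0) -[X in X <= _]invrK -[X in _ <= X]invrK ec.
  by rewrite lef_pV2 ?posrE// ?invr_gt0// ltW.
have cb : c <= b.
  rewrite -(ler_pM2l x0) -[X in X <= _]invrK -[X in _ <= X]invrK ec.
  by rewrite lef_pV2 ?posrE// ?invr_gt0// ltW.
rewrite (@Int_split _ a c b) ?ac ?cb//; last exact: mf.
rewrite (piece k.+1 a c) ?ec// (IH c b) ?ec//; ring.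
Qed.

Lemma piece_fracp (n : nat) x a b w : 0 < x -> 0 < a -> n%:R <= (x * b)^-1 ->
  (x * a)^-1 <= n.+1%:R -> a < w <= b -> fracp (x * w)^-1 = x^-1 * w^-1 - n%:R.
Proof.
move=> x0 a0 hb ha /andP[aw wb]; have w0 : 0 < w by exact: lt_trans aw.
have b0 : 0 < b by exact: lt_le_trans wb.
rewrite -invfM; apply: fracpE; apply/andP; split.
  by apply: le_trans hb _; rewrite lef_pV2 ?posrE ?mulr_gt0// ler_pM2l.
by apply: lt_le_trans ha; rewrite ltf_pV2 ?posrE ?mulr_gt0// ltr_pM2l.
Qed.

Lemma piece_ends (n : nat) x a b : 0 < x -> 0 < a -> a <= b -> n%:R <= (x * b)^-1 ->
  (x * a)^-1 <= n.+1%:R ->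
  n%:R <= (x * a)^-1 <= n.+1%:R /\ n%:R <= (x * b)^-1 <= n.+1%:R.
Proof.
move=> x0 a0 ab hb ha.
have ab' : (x * b)^-1 <= (x * a)^-1.
  by rewrite lef_pV2 ?posrE ?mulr_gt0 ?ler_pM2l//; exact: lt_le_trans ab.
by split; apply/andP; split=> //; [exact: le_trans hb _ | exact: le_trans ha].
Qed.

(** Substitute v = 1/(xw): dv = - dw/(x w^2), so the weight w^-2 is the Jacobian and a factor x
    comes out. This factor is the gain of the integrations by parts below. *)
Lemma Int_B1t x a b : 0 < x -> 0 < a -> a <= b ->
  Int a b (fun w => B1t (x * w)^-1 * w^-1 ^+ 2) =
  x * (B2t (x * a)^-1 / 2 - B2t (x * b)^-1 / 2).
Proof.
move=> x0; apply: (@Int_comp_inv_chain x B1t (fun v => B2t v / 2)) => //.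
  move=> {}a {}b a0; apply: bdd_measurableM; first exact: bdd_measurable_B1t.
  exact: bdd_measurable_invX.
move=> n {}a {}b a0 ab hb ha.
have [ea eb] := piece_ends x0 a0 ab hb ha.
rewrite (B2tE ea) (B2tE eb).
have -> : Int a b (fun w => B1t (x * w)^-1 * w^-1 ^+ 2) =
  Int a b (fun w => x^-1 * w^-1 ^+ 3 - (n%:R + 2^-1) * w^-1 ^+ 2).
  by apply: eq_Int => w hw; rewrite /B1t (piece_fracp x0 a0 hb ha hw); ring.
rewrite IntB ?IntZ ?Int_invr2 ?Int_invr3//; try exact: bdd_measurable_invX;
  try by apply: bdd_measurableZ; exact: bdd_measurable_invX.
have b0 : 0 < b by exact: lt_le_trans ab.
by field; rewrite !gt_eqF.
Qed.

Lemma Int_B2t x a b : 0 < x -> 0 < a -> a <= b ->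
  Int a b (fun w => B2t (x * w)^-1 * w^-1 ^+ 2) =
  x * (B3t (x * a)^-1 / 3 - B3t (x * b)^-1 / 3).
Proof.
move=> x0; apply: (@Int_comp_inv_chain x (@B2t R) (fun v => B3t v / 3)) => //.
  move=> {}a {}b a0; apply: bdd_measurableM; first exact: bdd_measurable_B2t.
  exact: bdd_measurable_invX.
move=> n {}a {}b a0 ab hb ha.
have [ea eb] := piece_ends x0 a0 ab hb ha.
rewrite (B3tE ea) (B3tE eb).
have -> : Int a b (fun w => B2t (x * w)^-1 * w^-1 ^+ 2) =
  Int a b (fun w => (x^-1 ^+ 2 * w^-1 ^+ 4 - (2 * n%:R + 1) * x^-1 * w^-1 ^+ 3)
            + (n%:R ^+ 2 + n%:R + 6^-1) * w^-1 ^+ 2).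
  by apply: eq_Int => w hw; rewrite /B2t (piece_fracp x0 a0 hb ha hw); ring.
have mZ c k : bdd_measurable a b (fun w => c * w^-1 ^+ k).
  by apply: bdd_measurableZ; exact: bdd_measurable_invX.
rewrite IntD ?IntB ?IntZ ?Int_invr2 ?Int_invr3 ?Int_invr4//; try exact: bdd_measurable_invX;
  try exact: bdd_measurableB.
have b0 : 0 < b by exact: lt_le_trans ab.
by field; rewrite !gt_eqF.
Qed.

Lemma Int_B1t_bound x a b : 0 < x -> 0 < a -> a <= b ->
  `|Int a b (fun w => B1t (x * w)^-1 * w^-1 ^+ 2)| <= x / 6.
Proof.
move=> x0 a0 ab; rewrite Int_B1t// normrM (gtr0_norm x0) ler_pM2l//.
have := norm_B2t (x * a)^-1; have := norm_B2t (x * b)^-1.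
by rewrite !ler_norml; lra.
Qed.

Lemma Int_B2t_bound x a b : 0 < x -> 0 < a -> a <= b ->
  `|Int a b (fun w => B2t (x * w)^-1 * w^-1 ^+ 2)| <= x / 3.
Proof.
move=> x0 a0 ab; rewrite Int_B2t// normrM (gtr0_norm x0) ler_pM2l//.
have := norm_B3t (x * a)^-1; have := norm_B3t (x * b)^-1.
by rewrite !ler_norml; lra.
Qed.

End Bernoulli.

(** * Variation of the kernel in one variable *)

Section KernelVariation.
Variable R : realType.
Implicit Types (a b c x y z v w : R).

Definition flr (v : R) : R := (Num.floor v)%:~R.

Lemma flr_le v : flr v <= v. Proof. exact: floor_le. Qed.

Lemma flr_gt v : v < flr v + 1.
Proof. by have := floorD1_gt v; rewrite intrD mulr1z. Qed.

Lemma le_flr v w : v <= w -> flr v <= flr w.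
Proof. by move=> vw; rewrite ler_int le_floor. Qed.

Lemma flr_ge1 v : 1 <= v -> 1 <= flr v.
Proof.
move=> v1; have : (1 <= Num.floor v) by rewrite floor_ge_int mulr1z.
by rewrite -(ler_int R) mulr1z.
Qed.

Lemma flr_half v : 1 <= v -> v <= 2 * flr v.
Proof. by move=> v1; have := flr_ge1 v1; have := flr_gt v; lra. Qed.

Lemma measurable_flr : measurable_fun [set: R] flr.
Proof. exact: measurable_floorr. Qed.

Lemma B1tE v : B1t v = v - flr v - 2^-1. Proof. by []. Qed.

Lemma B1t_sub v w : v <= w -> `|B1t v - B1t w| <= (w - v) + (flr w - flr v).
Proof.
by move=> vw; have := le_flr vw; rewrite !B1tE ler_norml => ?; apply/andP; split; lra.
Qed.

(* Bounds the variation in y of y^2 B1(1/(yz)) by O(1/z) on ]0, 1]. *)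
Definition var2 z y : R := y ^+ 2 / 2 + y * z^-1 + z^-1 ^+ 2 / flr (y * z)^-1.

(* Bounds the variation in y of y B1(1/(yz)) by O(log(1/y)/z) on [y, 1]. *)
Definition var1 z y : R :=
  y / 2 + z^-1 * (ln y - (ln (flr (y * z)^-1) - ln (flr z^-1))).

Lemma inv_mul_ge1 y z : 0 < y <= 1 -> 0 < z <= 1 -> 1 <= (y * z)^-1.
Proof.
move=> /andP[y0 y1] /andP[z0 z1]; rewrite invf_ge1 ?mulr_gt0//.
by rewrite -[X in _ <= X]mulr1 ler_pM// ltW.
Qed.

(** The three terms come from the growth of the weight (with |B1| <= 1/2), from the linear part of
    B1, and from its jumps, counted by the floor. *)
Lemma B1t_weight_sub (s t : R) z y y' : 0 < z <= 1 -> 0 < y -> y <= y' -> y' <= 1 ->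
  0 <= s -> s <= t ->
  `|t * B1t (y' * z)^-1 - s * B1t (y * z)^-1| <=
  (t - s) / 2 + s * ((y' - y) * (y^-1 * y'^-1) * z^-1) +
  s * (flr (y * z)^-1 - flr (y' * z)^-1).
Proof.
move=> hz y0 yy' y'1 s0 st; have /andP[z0 z1] := hz.
have y'0 : 0 < y' by exact: lt_le_trans yy'.
have le : (y' * z)^-1 <= (y * z)^-1 by rewrite lef_pV2 ?posrE ?mulr_gt0// ler_pM2r.
have -> : t * B1t (y' * z)^-1 - s * B1t (y * z)^-1 =
  (t - s) * B1t (y' * z)^-1 + s * (B1t (y' * z)^-1 - B1t (y * z)^-1) by ring.
apply: le_trans (ler_normD _ _) _; rewrite !normrM (ger0_norm s0).
rewrite (@ger0_norm _ (t - s)) ?subr_ge0// -[X in _ <= X]addrA; apply: lerD.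
  by rewrite ler_wpM2l ?subr_ge0//; exact: norm_B1t.
rewrite -mulrDr ler_wpM2l//; apply: le_trans (B1t_sub le) _.
by rewrite lerD2r -inv_sub// mulrBl -!invfM.
Qed.

(** With m = floor(1/(yz)) one has y m <= 1/z, so the jump term y^2 (m - m') is at most z^-2 (1/m' -
    1/m), which telescopes. *)
Lemma var2P z : 0 < z <= 1 -> forall a, 0 < a ->
  dominated_on a 1 (fun y => y ^+ 2 * B1t (y * z)^-1) (var2 z).
Proof.
move=> hz a a0 y y' ay yy' y'1; have /andP[z0 z1] := hz.
have y0 : 0 < y by exact: lt_le_trans ay. have y'0 : 0 < y' by exact: lt_le_trans yy'.
have zi0 : 0 < z^-1 by rewrite invr_gt0.
apply: le_trans (@B1t_weight_sub (y ^+ 2) (y' ^+ 2) z y y' _ _ _ _ _ _) _ => //.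
- exact: sqr_ge0.
- by rewrite lerXn2r ?nnegrE// ltW.
set m := flr (y * z)^-1; set m' := flr (y' * z)^-1.
have m1 : 1 <= m' by apply/flr_ge1/inv_mul_ge1 => //; rewrite y'0.
have mm' : m' <= m by apply: le_flr; rewrite lef_pV2 ?posrE ?mulr_gt0// ler_pM2r.
have m0 : 0 < m by lra. have m'0 : 0 < m' by lra.
have h1 : y ^+ 2 * ((y' - y) * (y^-1 * y'^-1) * z^-1) <= y' * z^-1 - y * z^-1.
  have -> : y ^+ 2 * ((y' - y) * (y^-1 * y'^-1) * z^-1) = (y' - y) * z^-1 * (y / y').
    by field; rewrite !gt_eqF.
  rewrite -mulrBl -[X in _ <= X]mulr1 ler_wpM2l ?ler_pdivrMr ?mul1r//.
  by rewrite mulr_ge0 ?subr_ge0 ?(ltW zi0).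
have ym : y * m <= z^-1.
  have := flr_le (y * z)^-1; rewrite -/m -(ler_pM2l y0) => /le_trans; apply.
  by rewrite invfM mulrA divff ?mul1r// gt_eqF.
have h2 : y ^+ 2 * (m - m') <= z^-1 ^+ 2 / m' - z^-1 ^+ 2 / m.
  have -> : z^-1 ^+ 2 / m' - z^-1 ^+ 2 / m = z^-1 ^+ 2 * ((m - m') / (m * m')).
    by field; rewrite !gt_eqF.
  have -> : y ^+ 2 * (m - m') = (y * m) ^+ 2 * ((m - m') / (m * m)).
    by field; rewrite !gt_eqF.
  apply: ler_pM.
  - exact: sqr_ge0.
  - by rewrite divr_ge0 ?mulr_ge0 ?(ltW m0)// subr_ge0.
  - by rewrite lerXn2r ?nnegrE ?mulr_ge0 ?(ltW y0) ?(ltW m0) ?(ltW zi0).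
  rewrite ler_wpM2l ?subr_ge0// lef_pV2 ?posrE ?mulr_gt0//.
  by rewrite ler_pM2l.
rewrite /var2 -/m -/m'; lra.
Qed.

(** As for [var2P], except that the jump term is now y (m - m') <= z^-1 (ln m - ln m'): one power of
    y less costs a logarithm. *)
Lemma var1P z : 0 < z <= 1 -> forall a, 0 < a ->
  dominated_on a 1 (fun y => y * B1t (y * z)^-1) (var1 z).
Proof.
move=> hz a a0 y y' ay yy' y'1; have /andP[z0 z1] := hz.
have y0 : 0 < y by exact: lt_le_trans ay. have y'0 : 0 < y' by exact: lt_le_trans yy'.
have zi0 : 0 < z^-1 by rewrite invr_gt0.
apply: le_trans (@B1t_weight_sub y y' z y y' _ _ _ _ _ _) _ => //; first exact: ltW.
set m := flr (y * z)^-1; set m' := flr (y' * z)^-1.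
have m1 : 1 <= m' by apply/flr_ge1/inv_mul_ge1 => //; rewrite y'0.
have mm' : m' <= m by apply: le_flr; rewrite lef_pV2 ?posrE ?mulr_gt0// ler_pM2r.
have m0 : 0 < m by lra. have m'0 : 0 < m' by lra.
have h1 : y * ((y' - y) * (y^-1 * y'^-1) * z^-1) <= z^-1 * (ln y' - ln y).
  have -> : y * ((y' - y) * (y^-1 * y'^-1) * z^-1) = z^-1 * ((y' - y) * y'^-1).
    by field; rewrite !gt_eqF.
  by rewrite ler_pM2l//; have /andP[] := ln_sub_bounds y0 yy'.
have ym : y * m <= z^-1.
  have := flr_le (y * z)^-1; rewrite -/m -(ler_pM2l y0) => /le_trans; apply.
  by rewrite invfM mulrA divff ?mul1r// gt_eqF.
have h2 : y * (m - m') <= z^-1 * (ln m - ln m').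
  have -> : y * (m - m') = (y * m) * ((m - m') * m^-1) by field; rewrite !gt_eqF.
  apply: ler_pM => //.
  - by rewrite mulr_ge0 ?ltW.
  - by rewrite mulr_ge0 ?subr_ge0 ?invr_ge0 ?(ltW m0).
  by have /andP[] := ln_sub_bounds m'0 mm'.
rewrite /var1 -/m -/m'; move: h1 h2; set A := ln y; set B := ln y'.
set C := ln m; set D := ln m'; set k := z^-1; set E := ln _.
rewrite !mulrBr => h1 h2; lra.
Qed.

Lemma var2_ge0 z y : 0 < z <= 1 -> 0 < y <= 1 -> 0 <= var2 z y.
Proof.
move=> hz hy; have /andP[z0 _] := hz; have /andP[y0 _] := hy.
have m1 := flr_ge1 (inv_mul_ge1 hy hz).
rewrite /var2 !addr_ge0// ?mulr_ge0 ?exprn_ge0 ?invr_ge0 ?(ltW z0) ?(ltW y0)//.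
by apply: le_trans m1.
Qed.

Lemma var2_le z y : 0 < z <= 1 -> 0 < y <= 1 -> var2 z y <= 2^-1 + z^-1 + z^-1 ^+ 2.
Proof.
move=> hz hy; have /andP[z0 _] := hz; have /andP[y0 y1] := hy.
have m1 := flr_ge1 (inv_mul_ge1 hy hz).
have zi : 0 < z^-1 by rewrite invr_gt0.
have h1 : y ^+ 2 <= 1 by rewrite exprn_ile1// ltW.
have h2 : y * z^-1 <= z^-1 by rewrite ger_pMl.
have h3 : z^-1 ^+ 2 / flr (y * z)^-1 <= z^-1 ^+ 2.
  rewrite ler_pdivrMr; last by apply: lt_le_trans m1.
  by rewrite ler_peMr// sqr_ge0.
rewrite /var2; lra.
Qed.

(** 7/2 = 1/2 + 1 + 2, where the 2 comes from floor(1/z) >= 1/(2z). *)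
Lemma var2_1 z : 0 < z <= 1 -> var2 z 1 <= 7 / 2 * z^-1.
Proof.
move=> hz; have /andP[z0 z1] := hz.
have zi : 1 <= z^-1 by rewrite invf_ge1.
have m1 := flr_ge1 zi; have m2 := flr_half zi.
have h3 : z^-1 ^+ 2 / flr z^-1 <= 2 * z^-1.
  rewrite ler_pdivrMr; last by apply: lt_le_trans m1.
  by rewrite expr2; nra.
by rewrite /var2 !mul1r expr1n; lra.
Qed.

(** The term [ln (flr z^-1)], constant in y, normalises [var1] at y = 1. The lower bound rests on
    floor(1/(yz)) <= (2/y) floor(1/z). *)
Lemma var1_bounds z y : 0 < z <= 1 -> 0 < y <= 1 ->
  - (z^-1 * (2 * ln y^-1 + ln 2)) <= var1 z y <= 2^-1.
Proof.
move=> hz hy; have /andP[z0 z1] := hz; have /andP[y0 y1] := hy.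
have zi : 1 <= z^-1 by rewrite invf_ge1.
have m1 := flr_ge1 zi; have m2 := flr_half zi.
have n1 := flr_ge1 (inv_mul_ge1 hy hz).
have yz : z^-1 <= (y * z)^-1.
  by rewrite lef_pV2 ?posrE ?mulr_gt0// ger_pMl.
have mn : flr z^-1 <= flr (y * z)^-1 by exact: le_flr.
have ly : ln y^-1 = - ln y by rewrite lnV.
have l1 : ln (flr z^-1) <= ln (flr (y * z)^-1).
  by rewrite ler_ln// posrE; lra.
have l2 : ln (flr (y * z)^-1) <= ln 2 + ln y^-1 + ln (flr z^-1).
  have yi : 0 < y^-1 by rewrite invr_gt0.
  rewrite -!lnM ?posrE ?mulr_gt0//; last by lra.
  rewrite ler_ln ?posrE ?mulr_gt0//; try lra.
  apply: le_trans (flr_le _) _; rewrite invfM [X in _ <= X](_ : _ = y^-1 * (2 * flr z^-1)).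
    by rewrite ler_pM2l.
  by ring.
have ly0 : ln y <= 0 by exact: ln_le0.
rewrite /var1; move: l1 l2 ly ly0; set A := ln y; set B := ln (flr _); set C := ln (flr _).
set D := ln 2; set E := ln _ => l1 l2 ly ly0.
have k0 : 0 < z^-1 by lra.
have h1 : z^-1 * (A - (C - B)) <= 0 by rewrite pmulr_rle0//; lra.
have h2 : - (z^-1 * (2 * E + D)) <= z^-1 * (A - (C - B)).
  by rewrite -mulrN ler_pM2l//; lra.
apply/andP; split; lra.
Qed.

Lemma measurable_var2 y : measurable_fun [set: R] (fun z => var2 z y).
Proof.
apply: measurable_funD.
  apply: measurable_funD => //; apply: measurable_funM => //; exact: measurable_invr.
apply: measurable_funM; first by apply: measurable_funX; exact: measurable_invr.
apply: (@measurableT_comp _ _ _ _ _ _ (@GRing.inv R)); first exact: measurable_invr.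
exact: measurable_comp_invM measurable_flr.
Qed.

Lemma measurable_var1 y : measurable_fun [set: R] (fun z => var1 z y).
Proof.
apply: measurable_funD => //; apply: measurable_funM; first exact: measurable_invr.
apply: measurable_funB => //; apply: measurable_funB.
  apply: measurableT_comp; first exact: measurable_ln.
  exact: measurable_comp_invM measurable_flr.
apply: measurableT_comp; first exact: measurable_ln.
apply: measurableT_comp; first exact: measurable_flr.
exact: measurable_invr.
Qed.

End KernelVariation.

(** * Decay of the eigenfunction at 0 *)

Section EigenDecay.
Variables (R : realType) (phi : R -> R) (lam : R).
Implicit Types (a b c x y z v w : R).
Local Notation Lam := `|lam|.
Local Notation L := (ln `|lam|).
Hypothesis mphi : measurable_fun [set: R] phi.
Hypothesis Lam2 : 2 <= Lam.
Hypothesis phi_bd : forall y, 0 < y <= 1 -> `|phi y| <= Lam / 2.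
Hypothesis phiE : forall x, 0 < x <= 1 ->
  phi x = - lam * Int 0 1 (fun y => B1t (x * y)^-1 * phi y).

Lemma Lam_gt0 : 0 < Lam. Proof. by move: Lam2; lra. Qed.

(** Lets terms without a logarithm be absorbed into terms with one. *)
Lemma ln_Lam_ge : 2^-1 <= L.
Proof.
have h : ln 2 <= L by rewrite ler_ln ?posrE//; move: Lam2; lra.
have := @ln_le_subr1 R 2^-1 ltac:(lra); rewrite lnV ?posrE//; lra.
Qed.

Lemma bdd_measurable_phi a b : 0 <= a -> b <= 1 -> bdd_measurable a b phi.
Proof. by move=> a0 b1; apply: (bdd_measurableT mphi) => y yab; apply: phi_bd; lra. Qed.

Lemma bdd_measurable_ker a b y : 0 <= a -> b <= 1 ->
  bdd_measurable a b (fun z => B1t (y * z)^-1 * phi z).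
Proof.
move=> a0 b1; apply: bdd_measurableM; first exact: bdd_measurable_B1t.
exact: bdd_measurable_phi.
Qed.

(** The part z > c of the eigenvalue equation: c = 0 returns phi, and c = x is used for the decay at
    x. *)
Definition trunc_op c y : R := - lam * Int c 1 (fun z => B1t (y * z)^-1 * phi z).

(** The function is a superposition of y -> W(y) B1(1/(yz)) with weights phi(z), so the dominating
    functions are superposed with weights |phi(z)|. *)
Lemma trunc_op_dominated (W : R -> R) (VK : R -> R -> R) c a : 0 <= c -> c <= 1 -> 0 < a ->
  (forall z, c < z <= 1 -> dominated_on a 1 (fun y => W y * B1t (y * z)^-1) (VK z)) ->
  (forall y, a <= y <= 1 -> bdd_measurable c 1 (fun z => `|phi z| * VK z y)) ->
  dominated_on a 1 (fun y => W y * trunc_op c y)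
    (fun y => Lam * Int c 1 (fun z => `|phi z| * VK z y)).
Proof.
move=> c0 c1 a0 hV mV y y' ay yy' y'1.
have mk t : bdd_measurable c 1 (fun z => W t * (B1t (t * z)^-1 * phi z)).
  by apply: bdd_measurableZ; exact: bdd_measurable_ker.
have mVy : bdd_measurable c 1 (fun z => `|phi z| * VK z y) by apply: mV; lra.
have mVy' : bdd_measurable c 1 (fun z => `|phi z| * VK z y') by apply: mV; lra.
have -> : W y' * trunc_op c y' - W y * trunc_op c y =
   - lam * Int c 1 (fun z => W y' * (B1t (y' * z)^-1 * phi z) -
                             W y * (B1t (y * z)^-1 * phi z)).
  by rewrite IntB// !IntZ; [rewrite /trunc_op; ring|exact: bdd_measurable_ker..].
rewrite normrM normrN -mulrBr ler_wpM2l// -IntB//.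
apply: le_norm_Int; [exact: bdd_measurableB | exact: bdd_measurableB |].
move=> z cz; rewrite -mulrBr.
have -> : W y' * (B1t (y' * z)^-1 * phi z) - W y * (B1t (y * z)^-1 * phi z) =
  phi z * (W y' * B1t (y' * z)^-1 - W y * B1t (y * z)^-1) by ring.
by rewrite normrM ler_wpM2l//; apply: hV.
Qed.

Definition absint x : R := Int x 1 (fun z => `|phi z| * z^-1).

Lemma bdd_measurable_absint x : 0 < x -> bdd_measurable x 1 (fun z => `|phi z| * z^-1).
Proof.
move=> x0; apply: bdd_measurableM; last exact: bdd_measurable_inv.
by apply: bdd_measurable_norm; apply: bdd_measurable_phi => //; exact: ltW.
Qed.

Lemma bdd_measurable_var2 x y : 0 < x -> 0 < y <= 1 ->
  bdd_measurable x 1 (fun z => `|phi z| * var2 z y).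
Proof.
move=> x0 y01; apply: bdd_measurableM.
  by apply: bdd_measurable_norm; apply: bdd_measurable_phi => //; exact: ltW.
apply: (@bdd_measurableT _ _ _ _ (2^-1 + x^-1 + x^-1 ^+ 2)); first exact: measurable_var2.
move=> z /andP[xz z1]; have z0 : 0 < z by lra.
rewrite ger0_norm; last by apply: var2_ge0 => //; rewrite z0.
apply: le_trans (var2_le _ y01) _; first by rewrite z0.
have [h1 h2] := inv_pos_le x0 (ltW xz).
by rewrite !lerD// lerXn2r ?nnegrE//; lra.
Qed.

(* Split phi = lam K phi at z = x: the part z < x is trivially O(x), and the part
   z > x has a variation in y that makes its integral against K(x, .) small. *)
Lemma phi_le_absint x : 0 < x <= 1 ->
  `|phi x| <= Lam ^+ 3 * x + Lam ^+ 2 * x * absint x.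
Proof.
move=> hx; have /andP[x0 x1] := hx.
have x0' := ltW x0.
pose g y := y ^+ 2 * trunc_op x y.
pose V y := Lam * Int x 1 (fun z => `|phi z| * var2 z y).
have dV : dominated_on x 1 g V.
  apply: trunc_op_dominated => //.
  - by move=> z xz; apply: var2P => //; lra.
  - by move=> y xy; apply: bdd_measurable_var2 => //; lra.
pose p w := B1t (x * w)^-1 * w^-1 ^+ 2.
have mp : bdd_measurable x 1 p.
  apply: bdd_measurableM; first exact: bdd_measurable_B1t.
  exact: bdd_measurable_invX.
have hpg := @abel_bound _ x 1 p g V (x / 6) x1 mp dV _.
have {hpg} := hpg ltac:(move=> y xy; apply: Int_B1t_bound; lra).
have J0 : 0 <= absint x.
  by apply: Int_ge0 => z xz; rewrite mulr_ge0// invr_ge0; lra.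
have V1 : V 1 <= 7 / 2 * (Lam * absint x).
  rewrite /V mulrCA ler_wpM2l// -IntZ; last exact: bdd_measurable_absint.
  apply: le_Int.
  - by apply: bdd_measurable_var2 => //; lra.
  - by apply: bdd_measurableZ; exact: bdd_measurable_absint.
  move=> z xz; rewrite mulrCA ler_wpM2l//; apply: var2_1; lra.
have Vx : 0 <= V x.
  rewrite /V mulr_ge0//; apply: Int_ge0 => z xz; rewrite mulr_ge0//.
  by apply: var2_ge0; lra.
have opb a b y : 0 <= a -> a <= b -> b <= 1 ->
    `|- lam * Int a b (fun z => B1t (y * z)^-1 * phi z)| <= Lam * (2^-1 * (Lam / 2) * (b - a)).
  move=> a0 ab b1; rewrite normrM normrN ler_wpM2l//.
  apply: Int_bound => //; first exact: bdd_measurable_ker.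
  move=> z zab; rewrite normrM ler_pM//; first exact: norm_B1t.
  by apply: phi_bd; lra.
have g1 : `|g 1| <= Lam ^+ 2 / 4.
  rewrite /g expr1n mul1r; apply: le_trans (opb x 1 1 _ _ _) _ => //.
  have := normr_ge0 lam; nra.
have mg := dominated_bdd_measurable dV.
(* [rho y] is the contribution of z <= x to phi(y), of size O(Lam^2 x); the term with [g y] is that
   of z > x. *)
pose rho y := phi y - y^-1 ^+ 2 * g y.
have mrho : bdd_measurable x 1 rho.
  apply: bdd_measurableB; first exact: bdd_measurable_phi.
  by apply: bdd_measurableM => //; exact: bdd_measurable_invX.
have rhob y : x < y <= 1 -> `|rho y| <= Lam ^+ 2 / 4 * x.
  move=> xy; have y0 : 0 < y by lra.
  have -> : rho y = - lam * Int 0 x (fun z => B1t (y * z)^-1 * phi z).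
    rewrite /rho phiE; last by lra.
    rewrite (@Int_split _ 0 x 1) ?x0'//; last exact: bdd_measurable_ker.
    rewrite /g mulrA -exprMn mulVf ?gt_eqF// expr1n mul1r /trunc_op; ring.
  apply: le_trans (opb 0 x y _ _ _) _ => //.
  by rewrite subr0 le_eqVlt; apply/orP; left; apply/eqP; field.
move=> hpg.
have e : Int x 1 (fun y => B1t (x * y)^-1 * phi y) =
    Int x 1 (fun y => p y * g y) + Int x 1 (fun y => B1t (x * y)^-1 * rho y).
  rewrite -IntD; [|exact: bdd_measurableM|apply: bdd_measurableM => //; exact: bdd_measurable_B1t].
  by apply: eq_Int => y xy; rewrite /p /rho; ring.
have h3 : `|Int x 1 (fun y => B1t (x * y)^-1 * rho y)| <=
    2^-1 * (Lam ^+ 2 / 4 * x) * (1 - x).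
  apply: Int_bound => //; first by apply: bdd_measurableM => //; exact: bdd_measurable_B1t.
  by move=> y xy; rewrite normrM ler_pM//; [exact: norm_B1t | exact: rhob].
rewrite phiE// (@Int_split _ 0 x 1) ?x0'//; last exact: bdd_measurable_ker.
rewrite mulrDr; apply: le_trans (ler_normD _ _) _.
have h1 := opb 0 x x (lexx _) x0' x1.
have h2 : `|- lam * Int x 1 (fun y => B1t (x * y)^-1 * phi y)| <=
   Lam * (x / 6 * (Lam ^+ 2 / 4 + 7 / 2 * (Lam * absint x)) + Lam ^+ 2 / 8 * x).
  rewrite normrM normrN ler_wpM2l// e; apply: le_trans (ler_normD _ _) _.
  apply: lerD.
    apply: le_trans hpg _; rewrite ler_wpM2l ?divr_ge0//; lra.
  apply: le_trans h3 _; have : 0 <= Lam ^+ 2 * x * x by rewrite !mulr_ge0// sqr_ge0.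
  lra.
apply: le_trans (lerD h1 h2) _; rewrite subr0.
have LL : 2 * Lam ^+ 2 <= Lam ^+ 3 by rewrite [X in _ <= X]exprS ler_wpM2r// sqr_ge0.
have LJ : 0 <= Lam ^+ 2 * x * absint x by rewrite !mulr_ge0// sqr_ge0.
have LL' : 2 * Lam ^+ 2 * x <= Lam ^+ 3 * x by rewrite ler_wpM2r.
have L30 : 0 <= Lam ^+ 3 * x by rewrite mulr_ge0// exprn_ge0.
have -> : Lam * (2^-1 * (Lam / 2) * x) + Lam * (x / 6 * (Lam ^+ 2 / 4 + 7 / 2 *
    (Lam * absint x)) + Lam ^+ 2 / 8 * x) = Lam ^+ 2 * x / 4 + Lam ^+ 3 * x * (6^-1)
    + 7 / 12 * (Lam ^+ 2 * x * absint x) by field.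
lra.
Qed.

Lemma ln_2Lam2 : ln (2 * Lam ^+ 2) <= 3 * L.
Proof.
have l0 := Lam_gt0.
rewrite lnM ?posrE ?exprn_gt0//.
have -> : ln (Lam ^+ 2) = L + L by rewrite lnXn.
have h : ln 2 <= L by rewrite ler_ln ?posrE.
lra.
Qed.

(** The pointwise bound feeds on itself: integrated over [y, d] with d = 1/(2 Lam^2) it returns half
    of [absint y], which is finite as y > 0 and can be absorbed. On [d, 1] the trivial bound costs
    (Lam/2) log(1/d) <= (3/2) Lam L. Hence [absint y] is at most Lam + 3 Lam L <= 5 Lam L. *)
Lemma absint_le x : 0 < x <= 1 -> absint x <= 5 * Lam * L.
Proof.
have l0 := Lam_gt0.
pose d := (2 * Lam ^+ 2)^-1.
have d0 : 0 < d by rewrite invr_gt0 mulr_gt0// exprn_gt0.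
have dL : Lam ^+ 2 * d = 2^-1 by rewrite /d; field; rewrite gt_eqF.
have d1 : d <= 1 by rewrite /d invf_le1 ?mulr_gt0 ?exprn_gt0//; have := Lam2; nra.
have main y : 0 < y <= d -> absint y <= 5 * Lam * L.
  move=> /andP[y0 yd].
  have e : absint y = Int y d (fun z => `|phi z| * z^-1) + absint d.
    by apply: Int_split; [lra | exact: bdd_measurable_absint].
  have h1 : absint d <= Lam / 2 * (3 * L).
    apply: (@le_trans _ _ (Lam / 2 * ln d^-1)).
      rewrite -[ln d^-1]subr0 -ln1.
      have -> : ln d^-1 - ln 1 = Int d 1 (fun w => w^-1).
        by rewrite Int_invr// lnV ?posrE// ln1; ring.
      rewrite -IntZ; last exact: bdd_measurable_inv.
      apply: le_Int; [exact: bdd_measurable_absint|by apply: bdd_measurableZ; exact: bdd_measurable_inv|].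
      by move=> z dz; rewrite ler_wpM2r ?invr_ge0; [|lra|apply: phi_bd; lra].
    by rewrite ler_wpM2l ?divr_ge0// /d invrK; exact: ln_2Lam2.
  have h2 : `|Int y d (fun z => `|phi z| * z^-1)| <=
      (Lam ^+ 3 + Lam ^+ 2 * absint y) * (d - y).
    apply: Int_bound => //.
      by apply: bdd_measurableS (bdd_measurable_absint y0).
    move=> z zyd; have z0 : 0 < z by lra.
    rewrite normrM normr_id ger0_norm ?invr_ge0 ?(ltW z0)// ler_pdivrMr//.
    apply: le_trans (phi_le_absint _) _; first by lra.
    have -> : (Lam ^+ 3 + Lam ^+ 2 * absint y) * z =
      Lam ^+ 3 * z + Lam ^+ 2 * z * absint y by ring.
    rewrite lerD2l ler_wpM2l ?mulr_ge0 ?sqr_ge0 ?(ltW z0)//.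
    rewrite /absint (@Int_split _ y z 1); [|lra|exact: bdd_measurable_absint].
    rewrite lerDr; apply: Int_ge0 => t ht; rewrite mulr_ge0// invr_ge0; lra.
  have J0 : 0 <= absint y.
    by apply: Int_ge0 => t ht; rewrite mulr_ge0// invr_ge0; lra.
  have h3 : (Lam ^+ 3 + Lam ^+ 2 * absint y) * (d - y) <=
      (Lam ^+ 3 + Lam ^+ 2 * absint y) * d.
    rewrite ler_wpM2l ?gerBl ?(ltW y0)// addr_ge0// ?mulr_ge0// ?sqr_ge0// exprn_ge0//.
  have h4 : (Lam ^+ 3 + Lam ^+ 2 * absint y) * d = (Lam + absint y) / 2.
    have -> : (Lam ^+ 3 + Lam ^+ 2 * absint y) * d =
      (Lam ^+ 2 * d) * (Lam + absint y) by ring.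
    by rewrite dL; field.
  have h5 := ler_norm (Int y d (fun z => `|phi z| * z^-1)).
  have hL := ln_Lam_ge.
  have h6 : Lam * 2^-1 <= Lam * L by rewrite ler_pM2l.
  lra.
move=> /andP[x0 x1]; have [xd|dx] := leP x d; first by apply: main; rewrite x0.
apply: le_trans (main d _); last by rewrite d0 lexx.
rewrite /absint (@Int_split _ d x 1); [|lra|exact: bdd_measurable_absint].
by rewrite lerDr; apply: Int_ge0 => t ht; rewrite mulr_ge0// invr_ge0; lra.
Qed.

(** 7 = 2 + 5, using 1 <= 2 L for the first term of [phi_le_absint]. *)
Lemma phi_le x : 0 < x <= 1 -> `|phi x| <= 7 * Lam ^+ 3 * L * x.
Proof.
move=> hx; have /andP[x0 x1] := hx; apply: le_trans (phi_le_absint hx) _.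
have hL := ln_Lam_ge.
have h1 : Lam ^+ 2 * x * absint x <= Lam ^+ 2 * x * (5 * Lam * L).
  by rewrite ler_wpM2l ?absint_le// mulr_ge0 ?sqr_ge0 ?ltW.
have h2 : Lam ^+ 3 * x * 1 <= Lam ^+ 3 * x * (2 * L).
  by rewrite ler_wpM2l ?mulr_ge0 ?exprn_ge0 ?(ltW x0)//; lra.
lra.
Qed.

End EigenDecay.

(** * Counting integers below a real number, and sums of inverse squares *)

Section Counting.
Variable R : realType.

Lemma sum_ltn_nat (N k : nat) :
  \sum_(0 <= n < N) ((n < k)%N%:R : R) = (minn N k)%:R.
Proof.
elim: N => [|N IH]; first by rewrite big_nil min0n.
rewrite big_nat_recr//= IH -natrD; congr _%:R.
by rewrite /minn; case: (ltngtP N k) => ?; case: ltnP => ?; lia.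
Qed.

Lemma sum_le_flr (N : nat) (v : R) : 0 <= v ->
  \sum_(0 <= n < N) ((n.+1%:R <= v)%R%:R : R) = Num.min N%:R (flr v).
Proof.
move=> v0; have [k hk] : exists k : nat, Num.floor v = k%:Z.
  by exists `|Num.floor v|%N; rewrite gez0_abs// floor_ge0.
have -> : flr v = k%:R by rewrite /flr hk.
have h : k%:R <= v < k.+1%:R.
  have := flr_le v; have := flr_gt v; rewrite /flr hk -pmulrn natr1.
  by move=> -> ->.
have -> : Num.min N%:R k%:R = (minn N k)%:R :> R.
  rewrite /minn; case: ltnP => Nk; first by rewrite min_l// ler_nat ltnW.
  by rewrite min_r// ler_nat.
rewrite -sum_ltn_nat; apply: eq_bigr => n _; congr (_%:R); congr nat_of_bool.
have /andP[h1 h2] := h; apply/idP/idP => [nv|nk].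
  by rewrite -ltnS -(ltr_nat R); exact: le_lt_trans h2.
by apply: le_trans h1; rewrite ler_nat.
Qed.

Lemma sum_invr_sqr (N : nat) : \sum_(0 <= n < N) (n.+1%:R^-1 ^+ 2 : R) <= 2.
Proof.
(* The sharper bound 2 - 1/(N+1) is the one that telescopes. *)
suff h : \sum_(0 <= n < N.+1) (n.+1%:R^-1 ^+ 2 : R) <= 2 - N.+1%:R^-1.
  apply: (@le_trans _ _ (\sum_(0 <= n < N.+1) (n.+1%:R^-1 ^+ 2 : R))).
    by rewrite big_nat_recr//= lerDl sqr_ge0.
  by apply: le_trans h _; rewrite gerBl invr_ge0.
elim: N => [|N IH]; first by rewrite big_nat1 invr1 expr1n; lra.
rewrite big_nat_recr//=.
have m0 : (0 : R) < N.+1%:R by rewrite ltr0n.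
move: IH; rewrite -(natr1 N.+1); move: m0; set m := N.+1%:R => m0 IH.
have e : m^-1 - (m + 1)^-1 = m^-1 * (m + 1)^-1.
  by field; rewrite !gt_eqF//; lra.
have [h1 h2] := @inv_pos_le R m (m + 1) m0 ltac:(lra).
have : (m + 1)^-1 ^+ 2 <= m^-1 * (m + 1)^-1 by rewrite expr2 ler_pM2r.
move: e IH; set u := m^-1; set w := (m + 1)^-1; set s := \sum_(_ <= _ < _) _.
by move=> <- ? ?; lra.
Qed.

Lemma sum_invr_sqr_tail (N0 N : nat) : (0 < N0)%N ->
  \sum_(N0 <= n < N) (n.+1%:R^-1 ^+ 2 : R) <= N0%:R^-1.
Proof.
move=> N00; have [h|h] := leqP N N0; first by rewrite big_geq// invr_ge0.
suff H : \sum_(N0 <= n < N) (n.+1%:R^-1 ^+ 2 : R) <= N0%:R^-1 - N%:R^-1.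
  by apply: le_trans H _; rewrite gerBl invr_ge0.
elim: N h => // N IH; rewrite ltnS leq_eqVlt => /predU1P[<-|h].
  rewrite big_nat1; have m0 : (0 : R) < N0%:R by rewrite ltr0n.
  rewrite -natr1; move: m0; set m := N0%:R => m0.
  have [h1 h2] := @inv_pos_le R m (m + 1) m0 ltac:(lra).
  rewrite inv_sub//; last by lra.
  have -> : m + 1 - m = 1 by ring.
  by rewrite mul1r expr2 ler_pM2r.
rewrite big_nat_recr ?(ltnW h)//=.
have m0 : (0 : R) < N%:R by rewrite ltr0n (leq_trans _ h).
have := IH h; rewrite -natr1; move: m0; set m := N%:R => m0; set s := \sum_(_ <= _ < _) _.
have [h1 h2] := @inv_pos_le R m (m + 1) m0 ltac:(lra).
have := @inv_sub R m (m + 1) m0 ltac:(lra).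
have -> : m + 1 - m = 1 by ring.
rewrite mul1r => e.
have : (m + 1)^-1 ^+ 2 <= m^-1 * (m + 1)^-1 by rewrite expr2 ler_pM2r.
rewrite -e; set u := m^-1; set t := (m + 1)^-1; lra.
Qed.

End Counting.

(** * Finite-sum approximations of the eigenfunction and their derivatives *)

Section Truncation.
Variables (R : realType) (phi : R -> R) (lam A J : R).
Implicit Types (a b c x y z v w : R) (n N : nat).
Local Notation Lam := `|lam|.
Hypothesis mphi : measurable_fun [set: R] phi.
Hypothesis phi_le : forall y, 0 < y <= 1 -> `|phi y| <= A * y.
Hypothesis phi_J : Int 0 1 (fun z => `|phi z| * z^-1) <= J.
Hypothesis phiE : forall x, 0 < x <= 1 ->
  phi x = - lam * Int 0 1 (fun y => B1t (x * y)^-1 * phi y).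

Lemma A_ge0 : 0 <= A.
Proof.
have := @phi_le 1; rewrite ltr01 lexx mulr1 => /(_ isT).
exact: le_trans.
Qed.

Lemma phi_leA y : 0 < y <= 1 -> `|phi y| <= A.
Proof.
move=> /andP[y0 y1]; apply: le_trans (phi_le _) _; first by rewrite y0.
by rewrite ler_piMr ?A_ge0.
Qed.

Lemma phi_bm a b : 0 <= a -> b <= 1 -> bdd_measurable a b phi.
Proof. by move=> a0 b1; apply: (bdd_measurableT mphi) => y yab; apply: phi_leA; lra. Qed.

Lemma phi_div_bm a b : 0 <= a -> b <= 1 ->
  bdd_measurable a b (fun z => phi z * z^-1).
Proof.
move=> a0 b1; apply: (@bdd_measurableT _ _ _ _ A).
  by apply: measurable_funM => //; exact: measurable_invr.
move=> y yab; have y0 : 0 < y by lra.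
by rewrite normrM normfV (gtr0_norm y0) ler_pdivrMr//; apply: phi_le; lra.
Qed.

Definition mean_phi : R := Int 0 1 (fun z => phi z * z^-1).

Lemma J_ge0 : 0 <= J.
Proof.
apply: le_trans phi_J; apply: Int_ge0 => z z01.
by rewrite mulr_ge0// invr_ge0; lra.
Qed.

Lemma mean_phi_le : `|mean_phi| <= J.
Proof.
apply: le_trans phi_J; apply: le_norm_Int.
- exact: phi_div_bm.
- have := bdd_measurable_norm (phi_div_bm (lexx 0) (lexx 1)) => -[m [M hM]].
  have e z : 0 < z <= 1 -> `|phi z * z^-1| = `|phi z| * z^-1.
    by move=> z01; rewrite normrM normfV (@gtr0_norm _ z)//; lra.
  split; last by exists M => z z01; rewrite -e//; exact: hM.
  by apply: eq_measurable_fun m => z /=; rewrite inE in_itvoc => /e.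
- by move=> z z01; rewrite normrM normfV (@gtr0_norm _ z)//; lra.
Qed.

(** Since floor(1/(yz)) counts the n >= 1 with z <= 1/(ny), the floor part of the kernel integrates
    to a sum of these terms; the index n stands for n + 1. *)
Definition tail_phi n y : R := Int 0 (Num.min 1 (n.+1%:R * y)^-1) phi.

(* phi with floor(1/(yz)) replaced by min(N, floor(1/(yz))) in its kernel; this keeps
   all sums over n finite. *)
Definition phi_trunc N y : R :=
  lam * (Int 0 1 phi / 2 - mean_phi * y^-1 + \sum_(0 <= n < N) tail_phi n y).

Lemma succn_gt0 n : (0 : R) < n.+1%:R. Proof. by rewrite ltr0n. Qed.

Lemma measurable_indic_le c : measurable_fun [set: R] (fun z : R => ((z <= c)%R%:R : R)).
Proof.
rewrite (_ : (fun z => _) = (fun z => if z <= c then 1 else 0)).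
  by apply: measurable_fun_ifT => //; exact: measurable_fun_ler.
by apply/funext => z; case: ifP.
Qed.

Lemma tail_phiE n y : 0 < y ->
  tail_phi n y = Int 0 1 (fun z => (z <= (n.+1%:R * y)^-1)%R%:R * phi z).
Proof.
move=> y0; rewrite /tail_phi; set c := (_ * _)^-1.
have c0 : 0 < c by rewrite invr_gt0 mulr_gt0// succn_gt0.
set m := Num.min 1 c.
have m0 : 0 < m by rewrite lt_min ltr01.
have m1 : m <= 1 by rewrite ge_min lexx.
have mc : m <= c by rewrite ge_min lexx orbT.
have mi : bdd_measurable 0 1 (fun z => (z <= c)%R%:R * phi z).
  apply: bdd_measurableM; last exact: phi_bm.
  apply: (@bdd_measurableT _ _ _ _ 1); first exact: measurable_indic_le.
  by move=> z _; case: (z <= c); rewrite ?normr1 ?normr0.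
rewrite [RHS](@Int_split _ 0 m 1); [|lra|exact: mi].
have -> : Int m 1 (fun z => (z <= c)%R%:R * phi z) = Int m 1 (fun=> 0).
  apply: eq_Int => z /andP[mz z1].
  suff -> : (z <= c) = false by rewrite mul0r.
  apply/negbTE; rewrite -ltNge; move: mz; rewrite /m; case: (leP 1 c) => // ? ?; lra.
rewrite Int_cst// mul0r addr0; apply: eq_Int => z /andP[z0 zm].
by rewrite (le_trans zm mc) mul1r.
Qed.

(** Capping the floor at N changes it only where z < 1/(Ny). There it is at most 1/(yz) and |phi(z)|
    <= A z, so the integrand is at most A/y on an interval of length 1/(Ny). *)
Lemma phi_truncP N y : 0 < y <= 1 -> 1 <= N%:R * y ->
  `|phi y - phi_trunc N y| <= Lam * (A * y^-1 ^+ 2 / N%:R).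
Proof.
move=> hy Ny; have /andP[y0 y1] := hy.
have N0 : (0 : R) < N%:R by rewrite -(pmulr_lgt0 _ y0); lra.
have yi : 0 < y^-1 by rewrite invr_gt0.
have mfl : bdd_measurable 0 1 (fun z => flr (y * z)^-1 * phi z).
  apply: (@bdd_measurableT _ _ _ _ (A * y^-1)).
    by apply: measurable_funM => //; exact: measurable_comp_invM (@measurable_flr R).
  move=> z z01; have z0 : 0 < z by lra.
  have v1 := inv_mul_ge1 hy z01; have f1 := flr_ge1 v1; have f2 := flr_le (y * z)^-1.
  rewrite normrM ger0_norm; last by lra.
  apply: (@le_trans _ _ ((y * z)^-1 * (A * z))).
    by apply: ler_pM => //; [lra | exact: phi_le].
  by rewrite le_eqVlt; apply/orP; left; apply/eqP; field; rewrite !gt_eqF.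
have e1 : phi y = lam * (Int 0 1 phi / 2 - mean_phi * y^-1 +
    Int 0 1 (fun z => flr (y * z)^-1 * phi z)).
  rewrite phiE//.
  have -> : Int 0 1 (fun z => B1t (y * z)^-1 * phi z) =
    Int 0 1 (fun z => (y^-1 * (phi z * z^-1) - flr (y * z)^-1 * phi z) - 2^-1 * phi z).
    by apply: eq_Int => z _; rewrite B1tE invfM; ring.
  rewrite !IntB ?IntZ ?/mean_phi; first by field; rewrite gt_eqF.
  all: try exact: phi_bm; try exact: phi_div_bm; try exact: mfl.
  - by apply: bdd_measurableZ; exact: phi_div_bm.
  - by apply: bdd_measurableB => //; apply: bdd_measurableZ; exact: phi_div_bm.
  - by apply: bdd_measurableZ; exact: phi_bm.
pose S z := \sum_(0 <= n < N) ((z <= (n.+1%:R * y)^-1)%R%:R * phi z).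
have mi n : bdd_measurable 0 1 (fun z => (z <= (n.+1%:R * y)^-1)%R%:R * phi z).
  apply: bdd_measurableM; last exact: phi_bm.
  apply: (@bdd_measurableT _ _ _ _ 1); first exact: measurable_indic_le.
  by move=> z _; case: (z <= (_ * _)^-1); rewrite ?normr1 ?normr0.
have mS : bdd_measurable 0 1 S by exact: bdd_measurable_sum.
have e2 : \sum_(0 <= n < N) tail_phi n y = Int 0 1 S.
  by rewrite Int_sum//; apply: eq_bigr => n _; exact: tail_phiE.
have -> : phi y - phi_trunc N y =
    lam * Int 0 1 (fun z => flr (y * z)^-1 * phi z - S z).
  by rewrite e1 /phi_trunc e2 IntB//; ring.
rewrite normrM ler_wpM2l//.
pose c := (N%:R * y)^-1.
have c0 : 0 < c by rewrite invr_gt0 mulr_gt0.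
have c1 : c <= 1 by rewrite invf_le1// mulr_gt0.
have md : bdd_measurable 0 1 (fun z => flr (y * z)^-1 * phi z - S z).
  exact: bdd_measurableB.
have eS z : 0 < z <= 1 -> S z = Num.min N%:R (flr (y * z)^-1) * phi z.
  move=> z01; have /andP[z0 z1] := z01.
  rewrite -sum_le_flr ?invr_ge0 ?mulr_ge0 ?(ltW y0) ?(ltW z0)// mulr_suml.
  apply: eq_bigr => n _; congr (_%:R * _); congr nat_of_bool.
  have n0 := succn_gt0 n; rewrite -[(_ * y)^-1]div1r -[(y * _)^-1]div1r.
  by rewrite !ler_pdivlMr ?mulr_gt0//; congr (_ <= _); ring.
rewrite (@Int_split _ 0 c 1); [|lra|exact: md].
have -> : Int c 1 (fun z => flr (y * z)^-1 * phi z - S z) = Int c 1 (fun=> 0).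
  apply: eq_Int => z /andP[cz z1]; have z0 : 0 < z by lra.
  rewrite eS ?z0// min_r ?subrr//.
  apply: le_trans (flr_le _) _; move: (ltW cz); rewrite /c -div1r -[(y * z)^-1]div1r.
  by rewrite !ler_pdivrMr ?mulr_gt0// mulrC -mulrA.
rewrite Int_cst// mul0r addr0.
have -> : A * y^-1 ^+ 2 / N%:R = A * y^-1 * (c - 0).
  by rewrite subr0 /c; field; rewrite !gt_eqF.
apply: Int_bound; [exact: ltW | exact: bdd_measurableS md |].
move=> z /andP[z0 zc]; have z01 : 0 < z <= 1 by lra.
have f1 := flr_ge1 (inv_mul_ge1 hy z01); have f2 := flr_le (y * z)^-1.
rewrite eS// -mulrBl normrM.
have h : `|flr (y * z)^-1 - Num.min N%:R (flr (y * z)^-1)| <= (y * z)^-1.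
  case: (leP N%:R _) => h; last by rewrite subrr normr0; lra.
  by rewrite ger0_norm ?subr_ge0//; lra.
apply: (@le_trans _ _ ((y * z)^-1 * (A * z))).
  by apply: ler_pM => //; exact: phi_le.
by rewrite le_eqVlt; apply/orP; left; apply/eqP; field; rewrite !gt_eqF.
Qed.

Lemma tail_phi_sub n y y' : 0 < y -> y <= y' ->
  tail_phi n y - tail_phi n y' =
    Int (Num.min 1 (n.+1%:R * y')^-1) (Num.min 1 (n.+1%:R * y)^-1) phi /\
  0 < Num.min 1 (n.+1%:R * y')^-1 <= Num.min 1 (n.+1%:R * y)^-1.
Proof.
move=> y0 yy'; have y'0 : 0 < y' by exact: lt_le_trans yy'.
have n0 := succn_gt0 n.
have h : (n.+1%:R * y')^-1 <= (n.+1%:R * y)^-1.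
  by rewrite lef_pV2 ?posrE ?mulr_gt0// ler_pM2l.
set c := Num.min 1 _; set d := Num.min 1 _.
have c0 : 0 < c by rewrite lt_min ltr01 invr_gt0 mulr_gt0.
have cd : c <= d by rewrite /c /d le_min !ge_min lexx h orbT.
have d1 : d <= 1 by rewrite ge_min lexx.
split; last by rewrite c0.
rewrite /tail_phi -/c -/d (@Int_split _ 0 c d); [ring | lra | exact: phi_bm].
Qed.

(** The two cutoffs differ by at most (1/y - 1/y')/(n+1), and |phi| is at most A/((n+1) y) between
    them: the decay of phi makes the bound summable in n. *)
Lemma tail_phi_lipschitz n y y' : 0 < y -> y <= y' ->
  `|tail_phi n y - tail_phi n y'| <= A * y^-1 * (y^-1 - y'^-1) * n.+1%:R^-1 ^+ 2.
Proof.
move=> y0 yy'; have [-> ] := tail_phi_sub n y0 yy'.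
have y'0 : 0 < y' by exact: lt_le_trans yy'.
have n0 := succn_gt0 n.
have h : (n.+1%:R * y')^-1 <= (n.+1%:R * y)^-1.
  by rewrite lef_pV2 ?posrE ?mulr_gt0// ler_pM2l.
move: h; rewrite !invfM; set k := n.+1%:R^-1; set i := y^-1; set j := y'^-1.
set c := Num.min 1 _; set d := Num.min 1 _ => h /andP[c0 cd].
have d1 : d <= 1 by rewrite ge_min lexx.
have dk : d <= k * i by rewrite ge_min lexx orbT.
have dc : d - c <= k * i - k * j.
  by rewrite /d /c; case: (leP 1 (k * i)) => ?; case: (leP 1 (k * j)) => ?; lra.
apply: (@le_trans _ _ (A * d * (d - c))).
  apply: Int_bound => //; first by apply: phi_bm; lra.
  move=> z hz; apply: le_trans (phi_le _) _; first by lra.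
  by rewrite ler_wpM2l ?A_ge0//; lra.
have -> : A * i * (i - j) * k ^+ 2 = A * (k * i) * (k * i - k * j) by ring.
have A0 := A_ge0.
by apply: ler_pM => //; [rewrite mulr_ge0//; lra | lra | rewrite ler_wpM2l].
Qed.

Lemma phi_trunc_lipschitz N y y' : 0 < y -> y <= y' ->
  `|phi_trunc N y' - phi_trunc N y| <= Lam * ((J + 2 * A * y^-1) * (y^-1 - y'^-1)).
Proof.
move=> y0 yy'; have y'0 : 0 < y' by exact: lt_le_trans yy'.
have [j0 ji] := inv_pos_le y0 yy'.
have -> : phi_trunc N y' - phi_trunc N y = lam * (mean_phi * (y^-1 - y'^-1) -
    \sum_(0 <= n < N) (tail_phi n y - tail_phi n y')).
  by rewrite /phi_trunc sumrB; ring.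
rewrite normrM ler_wpM2l//; apply: le_trans (ler_normB _ _) _.
rewrite [X in _ <= X]mulrDl lerD//.
  rewrite normrM (@ger0_norm _ (_ - _)) ?subr_ge0//.
  by apply: ler_wpM2r; rewrite ?subr_ge0//; exact: mean_phi_le.
apply: le_trans (ler_norm_sum _ _ _) _.
apply: (@le_trans _ _ (\sum_(0 <= n < N) (A * y^-1 * (y^-1 - y'^-1) * n.+1%:R^-1 ^+ 2))).
  by apply: ler_sum => n _; exact: tail_phi_lipschitz.
rewrite -mulr_sumr.
have -> : 2 * A * y^-1 * (y^-1 - y'^-1) = A * y^-1 * (y^-1 - y'^-1) * 2 by ring.
rewrite ler_wpM2l ?sum_invr_sqr// !mulr_ge0 ?A_ge0 ?subr_ge0//; lra.
Qed.

(** Only qualitative, as the constant blows up when y -> 0. It supplies the continuity behind the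
    change of variables in [tail_phi_primitive_near] and a finite starting value for the
    contraction. *)
Lemma phi_rough_lipschitz y y' : 0 < y -> y <= y' -> y' <= 1 ->
  `|phi y' - phi y| <= Lam * ((J + 2 * A * y^-1) * (y^-1 - y'^-1)).
Proof.
move=> y0 yy' y'1; have y'0 : 0 < y' by exact: lt_le_trans yy'.
have [j0 ji] := inv_pos_le y0 yy'.
apply: (@le_add_divn _ _ _ (2 * (Lam * (A * y^-1 ^+ 2))) (Num.bound y^-1)) => N hN.
have N1 t : y <= t -> 1 <= N.+1%:R * t.
  move=> yt; have t0 : 0 < t by lra.
  rewrite -ler_pdivrMr// mul1r; apply: (@le_trans _ _ y^-1).
    by rewrite lef_pV2.
  apply: ltW; apply: lt_le_trans (archi_boundP (ltW _)) _; first by rewrite invr_gt0.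
  by rewrite ler_nat ltnW.
have h1 := @phi_truncP N.+1 y ltac:(lra) (N1 _ (lexx _)).
have h2 := @phi_truncP N.+1 y' ltac:(lra) (N1 _ yy').
have h3 := @phi_trunc_lipschitz N.+1 y y' y0 yy'.
have h4 : Lam * (A * y'^-1 ^+ 2 / N.+1%:R) <= Lam * (A * y^-1 ^+ 2 / N.+1%:R).
  rewrite ler_wpM2l// ler_wpM2r// ler_wpM2l ?A_ge0//.
  by rewrite lerXn2r ?nnegrE ?(ltW j0) ?(ltW (lt_le_trans j0 ji)).
have -> : phi y' - phi y = (phi y' - phi_trunc N.+1 y') +
  (phi_trunc N.+1 y' - phi_trunc N.+1 y) - (phi y - phi_trunc N.+1 y) by ring.
apply: le_trans (ler_normB _ _) _; apply: le_trans (lerD (ler_normD _ _) (lexx _)) _.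
apply: le_trans (lerD (lerD (le_trans h2 h4) h3) h1) _.
by rewrite le_eqVlt; apply/orP; left; apply/eqP; ring.
Qed.

(** Divided by w^2, this is minus the derivative of [tail_phi n]; it vanishes while 1/((n+1) w) >=
    1, where the cutoff at 1 makes [tail_phi n] constant. *)
Definition dterm n w : R :=
  if 1 < n.+1%:R * w then phi (n.+1%:R * w)^-1 * n.+1%:R^-1 else 0.

Lemma dterm_bm n a b : 0 <= a -> bdd_measurable a b (dterm n).
Proof.
move=> a0; apply: (@bdd_measurableT _ _ _ _ A).
  apply: measurable_fun_ifT => //.
    by apply: measurable_fun_ltr => //; exact: measurable_funM.
  by apply: measurable_funM => //; exact: measurable_comp_invM.
move=> w hw; rewrite /dterm; case: ifPn => [h|_]; last by rewrite normr0 A_ge0.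
have n0 := succn_gt0 n.
rewrite normrM -[X in _ <= X]mulr1; apply: ler_pM => //.
  by apply: phi_leA; rewrite invr_gt0 invf_le1; lra.
by rewrite ger0_norm ?invr_ge0 ?(ltW n0)// invf_le1// ler1n.
Qed.

Lemma dterm_invr2_bm n a b : 0 < a -> bdd_measurable a b (fun w => dterm n w * w^-1 ^+ 2).
Proof.
move=> a0; apply: bdd_measurableM; first by apply: dterm_bm; exact: ltW.
exact: bdd_measurable_invX.
Qed.

(** The change of variables z = 1/((n+1) w). Over a short [u, v], with images [i] and [j] of the
    ends, both integrals equal phi(j) (i - j) up to O((i - j)^2) by the rough Lipschitz bound. *)
Lemma tail_phi_primitive_near n y y' : n.+1%:R^-1 <= y -> y <= y' -> y' <= 1 ->
  tail_phi n y' - tail_phi n y = - Int y y' (fun w => dterm n w * w^-1 ^+ 2).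
Proof.
have [m em] : exists m : R, m = n.+1%:R by eexists.
have m0 : 0 < m by rewrite em; exact: succn_gt0.
rewrite -em => my yy' y'1.
have mi0 : 0 < m^-1 by rewrite invr_gt0.
pose K := Lam * ((J + 2 * A * m) * m ^+ 2).
have A0 := A_ge0; have J0 := J_ge0.
have K0 : 0 <= K by rewrite !mulr_ge0// ?addr_ge0 ?mulr_ge0 ?sqr_ge0 ?(ltW m0).
have lip u v : m^-1 <= u -> u <= v -> v <= 1 -> `|phi v - phi u| <= K * (v - u).
  move=> mu' uv v1; have u0 : 0 < u by lra.
  apply: le_trans (phi_rough_lipschitz u0 uv v1) _; rewrite /K -!mulrA ler_wpM2l//.
  have [hu1 hu2] := inv_pos_le mi0 mu'; rewrite invrK in hu2.
  have [hv1 hv2] := inv_pos_le u0 uv.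
  apply: ler_pM.
  - by rewrite addr_ge0// !mulr_ge0//; lra.
  - by rewrite subr_ge0.
  - by rewrite lerD2l !ler_wpM2l.
  rewrite inv_sub//; last by lra.
  rewrite [X in _ <= X](_ : _ = (v - u) * (m * m)); last by ring.
  by rewrite ler_wpM2l ?subr_ge0//; apply: ler_pM; lra.
pose T z := tail_phi n z + Int y z (fun w => dterm n w * w^-1 ^+ 2).
suff : `|T y' - T y| <= 0 * (- (m * y')^-1 - - (m * y)^-1).
  by rewrite mul0r normr_le0 /T Int_nil => /eqP; lra.
apply: (@increment_bound _ T (fun w => - (m * w)^-1) 0 (2 * K * m)) => //.
move=> u v yu uv vy'; have u0 : 0 < u by lra. have v0 : 0 < v by lra.
have [] := tail_phi_sub n u0 uv; rewrite -em.
have mu1 : 1 <= m * u by rewrite mulrC -ler_pdivrMr// mul1r; lra.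
have mv1 : 1 <= m * v by rewrite mulrC -ler_pdivrMr// mul1r; lra.
have mu0 : 0 < m * u by lra. have mv0 : 0 < m * v by lra.
set i := (m * u)^-1; set j := (m * v)^-1.
have i1 : i <= 1 by rewrite invf_le1.
have j1 : j <= 1 by rewrite invf_le1.
have ji : j <= i by rewrite lef_pV2 ?posrE// ler_pM2l.
have jm : m^-1 <= j by rewrite lef_pV2 ?posrE// ger_pMr//; lra.
have j0 := lt_le_trans mi0 jm; have i0 := lt_le_trans j0 ji.
rewrite !min_r// => e _.
have ez : Int y v (fun w => dterm n w * w^-1 ^+ 2) =
  Int y u (fun w => dterm n w * w^-1 ^+ 2) + Int u v (fun w => dterm n w * w^-1 ^+ 2).
  by apply: Int_split; [lra | apply: dterm_invr2_bm; lra].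
have mj w : u < w <= v -> j <= (m * w)^-1 <= i.
  move=> uw; have w0 : 0 < w by lra.
  by rewrite !lef_pV2 ?posrE ?mulr_gt0// !ler_pM2l//; lra.
have mphiji : bdd_measurable j i phi := phi_bm (ltW j0) i1.
have h1 : `|Int j i (fun z => phi z - phi j)| <= K * (i - j) * (i - j).
  apply: Int_bound => //.
    by apply: bdd_measurableB => //; exact: bdd_measurable_cst.
  move=> z /andP[jz zi].
  apply: le_trans (lip j z jm (ltW jz) (le_trans zi i1)) _.
  by rewrite ler_wpM2l// lerD2r.
have eij : Int u v (fun w => m^-1 * w^-1 ^+ 2) = i - j.
  rewrite IntZ; last exact: bdd_measurable_invX.
  by rewrite Int_invr2// /i /j; field; rewrite !gt_eqF.
have h2 : `|Int u v (fun w => dterm n w * w^-1 ^+ 2 - phi j * (m^-1 * w^-1 ^+ 2))|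
    <= K * (i - j) * (i - j).
  have -> : K * (i - j) * (i - j) =
      K * (i - j) * Int u v (fun w => m^-1 * w^-1 ^+ 2) by rewrite eij.
  rewrite -IntZ; last by apply: bdd_measurableZ; exact: bdd_measurable_invX.
  apply: le_norm_Int.
  - apply: bdd_measurableB; first exact: dterm_invr2_bm.
    by do 2 apply: bdd_measurableZ; exact: bdd_measurable_invX.
  - by do 2 apply: bdd_measurableZ; exact: bdd_measurable_invX.
  move=> w uw; have w0 : 0 < w by lra.
  have hw : 1 < m * w by apply: le_lt_trans mu1 _; rewrite ltr_pM2l//; lra.
  rewrite /dterm -em hw.
  have -> : phi (m * w)^-1 * m^-1 * w^-1 ^+ 2 - phi j * (m^-1 * w^-1 ^+ 2) =
     (phi (m * w)^-1 - phi j) * (m^-1 * w^-1 ^+ 2) by ring.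
  rewrite normrM (@ger0_norm _ (_ * _)); last first.
    by rewrite !mulr_ge0 ?invr_ge0 ?(ltW w0) ?(ltW m0).
  rewrite ler_wpM2r ?mulr_ge0 ?invr_ge0 ?(ltW w0) ?(ltW m0)//.
  have /andP[hj hi] := mj w uw.
  have mw1 := le_trans hi i1; have := lip j (m * w)^-1 jm hj mw1.
  by move=> /le_trans; apply; rewrite ler_wpM2l// lerD2r.
have -> : T v - T u =
    Int u v (fun w => dterm n w * w^-1 ^+ 2 - phi j * (m^-1 * w^-1 ^+ 2)) -
    Int j i (fun z => phi z - phi j).
  have m1 : bdd_measurable u v (fun w => phi j * (m^-1 * w^-1 ^+ 2)).
    by do 2 apply: bdd_measurableZ; exact: bdd_measurable_invX.
  rewrite (@IntB _ u v _ _ (dterm_invr2_bm n v u0) m1).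
  rewrite (@IntB _ j i _ _ mphiji (bdd_measurable_cst _ _ _)) Int_cst//.
  rewrite (@IntZ _ u v); last by apply: bdd_measurableZ; exact: bdd_measurable_invX.
  by rewrite eij -e /T ez; ring.
apply: le_trans (ler_normB _ _) _; apply: le_trans (lerD h2 h1) _.
rewrite add0r.
have h3 : i - j <= m * (v - u).
  have -> : i - j = (v - u) * (m * (i * j)) by rewrite /i /j; field; rewrite !gt_eqF.
  rewrite [X in _ <= X]mulrC ler_wpM2l ?subr_ge0// -[X in _ <= X]mulr1 ler_pM2l//.
  by rewrite -[X in _ <= X]mulr1; apply: ler_pM => //; exact: ltW.
have -> : K * (i - j) * (i - j) + K * (i - j) * (i - j) = (2 * K * (i - j)) * (i - j) by ring.
have -> : - j - - i = i - j by ring.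
rewrite ler_wpM2r ?subr_ge0// -[X in _ <= X]mulrA.
by rewrite ler_wpM2l// mulr_ge0.
Qed.

Lemma tail_phi_primitive n y y' : 0 < y -> y <= y' -> y' <= 1 ->
  tail_phi n y' - tail_phi n y = - Int y y' (fun w => dterm n w * w^-1 ^+ 2).
Proof.
have n0 := succn_gt0 n.
have far u v : 0 < u -> u <= v -> v <= n.+1%:R^-1 ->
    tail_phi n v - tail_phi n u = - Int u v (fun w => dterm n w * w^-1 ^+ 2).
  move=> u0 uv vn.
  have E t : 0 < t -> t <= n.+1%:R^-1 -> tail_phi n t = Int 0 1 phi.
    move=> t0 tn; rewrite /tail_phi min_l// invf_ge1 ?mulr_gt0//.
    by rewrite mulrC -ler_pdivlMr// mul1r.
  rewrite (E v (lt_le_trans u0 uv) vn) (E u u0 (le_trans uv vn)) subrr.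
  have -> : Int u v (fun w => dterm n w * w^-1 ^+ 2) = Int u v (fun=> 0).
    apply: eq_Int => w uw; rewrite /dterm ifF ?mul0r//.
    apply/negbTE; rewrite -leNgt mulrC -ler_pdivlMr// mul1r.
    by apply: le_trans vn; have /andP[] := uw.
  by rewrite Int_cst// mul0r oppr0.
move=> y0 yy' y'1.
have [h|h] := leP y' n.+1%:R^-1; first exact: far.
have [h'|h'] := leP n.+1%:R^-1 y; first exact: tail_phi_primitive_near.
rewrite (@Int_split _ y n.+1%:R^-1 y') ?(ltW h) ?(ltW h')//; last exact: dterm_invr2_bm.
rewrite opprD -far//; last exact: ltW.
by rewrite -tail_phi_primitive_near ?lexx// ?(ltW h)// [RHS]addrC addrA subrK.
Qed.

(* (phi_trunc N)'(w) = lam * dseries N w / w^2 *)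
Definition dseries N w : R := mean_phi - \sum_(0 <= n < N) dterm n w.

Lemma dseries_bm N a b : 0 <= a -> bdd_measurable a b (dseries N).
Proof.
move=> a0; apply: bdd_measurableB; first exact: bdd_measurable_cst.
by apply: bdd_measurable_sum => n; exact: dterm_bm.
Qed.

Lemma phi_trunc_primitive N a : 0 < a ->
  primitive_on a 1 (fun w => lam * (dseries N w * w^-1 ^+ 2)) (phi_trunc N).
Proof.
move=> a0.
have md : bdd_measurable a 1 (fun w => dseries N w * w^-1 ^+ 2).
  apply: bdd_measurableM; first by apply: dseries_bm; exact: ltW.
  exact: bdd_measurable_invX.
split; first exact: bdd_measurableZ.
move=> y z ay yz z1; have y0 : 0 < y by lra.
rewrite IntZ; last by apply: bdd_measurableS md.
have -> : Int y z (fun w => dseries N w * w^-1 ^+ 2) =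
  Int y z (fun w => mean_phi * w^-1 ^+ 2 - \sum_(0 <= n < N) (dterm n w * w^-1 ^+ 2)).
  by apply: eq_Int => w _; rewrite /dseries mulrBl mulr_suml.
have mZ : bdd_measurable y z (fun w => mean_phi * w^-1 ^+ 2).
  by apply: bdd_measurableZ; exact: bdd_measurable_invX.
rewrite IntB//; last by apply: bdd_measurable_sum => n; exact: dterm_invr2_bm.
rewrite IntZ ?Int_invr2//; last exact: bdd_measurable_invX.
rewrite Int_sum//; last by move=> n; exact: dterm_invr2_bm.
have -> : \sum_(0 <= n < N) Int y z (fun w => dterm n w * w^-1 ^+ 2) =
   \sum_(0 <= n < N) (tail_phi n y - tail_phi n z).
  by apply: eq_bigr => n _; rewrite -[LHS]opprK -tail_phi_primitive//; ring.
by rewrite /phi_trunc sumrB; ring.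
Qed.

End Truncation.

(** * Dilation-invariant Lipschitz bound by contraction *)

Section Lipschitz.
Variables (R : realType) (phi : R -> R) (lam A J eps : R).
Implicit Types (a b c x y z v w d M : R) (n N : nat).
Local Notation Lam := `|lam|.
Hypothesis mphi : measurable_fun [set: R] phi.
Hypothesis phi_bd : forall y, 0 < y <= 1 -> `|phi y| <= Lam / 2.
Hypothesis phi_le : forall y, 0 < y <= 1 -> `|phi y| <= A * y.
Hypothesis phi_J : Int 0 1 (fun z => `|phi z| * z^-1) <= J.
Hypothesis phiE : forall x, 0 < x <= 1 ->
  phi x = - lam * Int 0 1 (fun y => B1t (x * y)^-1 * phi y).
Hypothesis eps01 : 0 < eps <= 1.

Let A0 := A_ge0 phi_le.
Let phibm := phi_bm mphi phi_le.
Let phidivbm := phi_div_bm mphi phi_le.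

Definition kvar y : R := Lam * Int 0 1 (fun z => `|phi z| * var1 z y).

Lemma absphi_div_bm : bdd_measurable 0 1 (fun z => `|phi z| * z^-1).
Proof.
have [m [M hM]] := bdd_measurable_norm (phidivbm (lexx 0) (lexx 1)).
have e z : 0 < z <= 1 -> `|phi z * z^-1| = `|phi z| * z^-1.
  by move=> z01; rewrite normrM normfV (@gtr0_norm _ z)//; lra.
split; last by exists M => z z01; rewrite -e//; exact: hM.
by apply: eq_measurable_fun m => z /=; rewrite inE in_itvoc => /e.
Qed.

Lemma var1_bm y : 0 < y <= 1 -> bdd_measurable 0 1 (fun z => `|phi z| * var1 z y).
Proof.
move=> hy; pose c := 2 * ln y^-1 + ln 2 : R.
have /andP[y0 y1] := hy.
have c0 : 0 <= c.
  have h1 : 0 <= ln y^-1 by rewrite ln_ge0// invf_ge1.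
  have h2 : 0 <= ln (2 : R) by rewrite ln_ge0//; lra.
  by rewrite /c; lra.
apply: (@bdd_measurableT _ _ _ _ (A * (2^-1 + c))).
  apply: measurable_funM; last exact: measurable_var1.
  exact: measurableT_comp.
move=> z z01; have /andP[z0 z1] := z01; rewrite normrM normr_id.
have zi : 0 < z^-1 by rewrite invr_gt0.
have h1 : `|var1 z y| <= 2^-1 + z^-1 * c.
  have /andP[] := var1_bounds z01 hy; rewrite -/c ler_norml => h1 h2.
  have : 0 <= z^-1 * c by rewrite mulr_ge0// ltW.
  by move=> h3; apply/andP; split; lra.
apply: le_trans (ler_pM _ _ (phi_le z01) h1) _ => //.
have -> : A * z * (2^-1 + z^-1 * c) = A * (z / 2 + c) by field; rewrite gt_eqF.
by apply: ler_wpM2l => //; lra.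
Qed.

Lemma kvarP : dominated_on eps 1 (fun y => y * phi y) kvar.
Proof.
have /andP[e0 e1] := eps01.
have h : dominated_on eps 1 (fun y => y * trunc_op phi lam 0 y) kvar.
  apply: (trunc_op_dominated mphi phi_bd (W := id)) => //.
  - by move=> z z01; exact: var1P.
  - by move=> y ey; apply: var1_bm; lra.
move=> y z ey yz z1; have := h y z ey yz z1.
by rewrite /trunc_op -!phiE//; lra.
Qed.

Definition kvar_total : R := Lam * (J * (2^-1 + 2 * ln eps^-1 + ln 2)).

Lemma kvar_le : kvar 1 - kvar eps <= kvar_total.
Proof.
have /andP[e0 e1] := eps01.
have J0 := J_ge0 phi_J.
have h1 : 0 <= ln eps^-1 by rewrite ln_ge0// invf_ge1.
have h2 : 0 <= ln (2 : R) by rewrite ln_ge0//; lra.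
rewrite /kvar -mulrBr ler_wpM2l// -IntB; [|by apply: var1_bm; lra|exact: var1_bm].
apply: (@le_trans _ _ ((2^-1 + 2 * ln eps^-1 + ln 2) * Int 0 1 (fun z => `|phi z| * z^-1))).
  rewrite -IntZ; last exact: absphi_div_bm.
  apply: le_Int.
  - by apply: bdd_measurableB; apply: var1_bm; lra.
  - by apply: bdd_measurableZ; exact: absphi_div_bm.
  move=> z z01; have /andP[z0 z1] := z01.
  rewrite -mulrBr mulrCA ler_wpM2l//.
  have one01 : 0 < (1 : R) <= 1 by rewrite ltr01 lexx.
  have /andP[_ h3] := var1_bounds z01 one01.
  have /andP[h4 _] := var1_bounds z01 eps01.
  have zi : 1 <= z^-1 by rewrite invf_ge1.
  move: h4; rewrite (mulrC z^-1); set c := _ + ln 2 => h4.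
  have -> : (2^-1 + 2 * ln eps^-1 + ln 2) * z^-1 = 2^-1 * z^-1 + c * z^-1.
    by rewrite /c; ring.
  lra.
by rewrite mulrC ler_wpM2r//; lra.
Qed.

(** The integrated form of |y phi'(y)| <= M on [d, 1]. It is invariant under dilations, which later
    makes bounds for phi(1/(nw)) uniform in n. *)
Definition lip_on M d := forall y z, d <= y -> y <= z -> z <= 1 ->
  `|phi z - phi y| <= M * ((z - y) * y^-1).

(** V is glued at eps: above it the kernel supplies the variation, below it the assumed bound gives
    slope M + A. So M enters only with the small factor eps, which makes the iteration contract. *)
Lemma kphi_dominated M d : 0 <= M -> 0 < d -> d <= 1 -> lip_on M d ->
  exists2 V, dominated_on d 1 (fun y => y * phi y) V &
    V 1 - V d <= (M + A) * eps + kvar_total.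
Proof.
move=> M0 d0 d1 hM; have /andP[e0 e1] := eps01.
have MA : 0 <= M + A by rewrite addr_ge0.
have far y z : d <= y -> y <= z -> z <= 1 ->
    `|z * phi z - y * phi y| <= (M + A) * z - (M + A) * y.
  move=> dy yz z1; have y0 : 0 < y by lra.
  have -> : z * phi z - y * phi y = y * (phi z - phi y) + (z - y) * phi z by ring.
  apply: le_trans (ler_normD _ _) _; rewrite !normrM (gtr0_norm y0).
  rewrite (@ger0_norm _ (z - y)) ?subr_ge0//.
  have h1 := hM y z dy yz z1.
  have h2 : y * `|phi z - phi y| <= M * (z - y).
    rewrite -(ler_pM2l y0) in h1; apply: le_trans h1 _.
    by rewrite le_eqVlt; apply/orP; left; apply/eqP; field; rewrite gt_eqF.
  have h3 : (z - y) * `|phi z| <= (z - y) * A.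
    by rewrite ler_wpM2l ?subr_ge0//; apply: (phi_leA phi_le); lra.
  lra.
pose V z := (M + A) * Num.min z eps + kvar (Num.max z eps).
exists V.
  move=> y z dy yz z1; rewrite /V.
  case: (leP z eps) => hz; case: (leP y eps) => hy; last 1 first.
  - by have := kvarP (ltW hy) yz z1; lra.
  - by have := far y z dy yz z1; lra.
  - by exfalso; lra.
  - have h1 := far y eps dy hy e1; have h2 := kvarP (lexx _) (ltW hz) z1.
    have -> : z * phi z - y * phi y = (z * phi z - eps * phi eps) +
      (eps * phi eps - y * phi y) by ring.
    by apply: le_trans (ler_normD _ _) _; lra.
have := kvar_le; rewrite /V (min_r e1) (max_l e1).
have h1 : 0 <= (M + A) * Num.min d eps by rewrite mulr_ge0// le_min (ltW d0) ltW.
case: (leP d eps) h1 => hd h1 h2; first lra.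
have h3 := kvarP (lexx _) (ltW hd) d1.
by have := normr_ge0 (d * phi d - eps * phi eps); lra.
Qed.

Lemma dterm_small n w : n.+1%:R * w <= 1 -> dterm phi n w = 0.
Proof. by move=> h; rewrite /dterm ifF//; apply/negbTE; rewrite -leNgt. Qed.

(* The sum over n is a Riemann sum for mean_phi on the grid 1/(nw); the error on each
   cell is controlled by the variation of y phi(y) there. *)
Lemma dseries_riemann N w d V : 0 < w <= 1 -> 0 < d ->
  dominated_on d 1 (fun y => y * phi y) V ->
  1 < N.+1%:R * w -> d <= (N.+1%:R * w)^-1 ->
  `|Int (N.+1%:R * w)^-1 1 (fun z => phi z * z^-1) -
    \sum_(0 <= n < N) dterm phi n w| <=
  w * (Lam / 2 + (V 1 - V (N.+1%:R * w)^-1)).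
Proof.
move=> /andP[w0 w1] d0 hV; elim: N => [|N IH].
  by rewrite mul1r => ?; exfalso; lra.
have [m em] : exists m : R, m = N.+1%:R by eexists.
have m0 : 0 < m by rewrite em; exact: succn_gt0.
have em1 : N.+2%:R = m + 1 by rewrite em natr1.
rewrite em1 -em in IH * => hm dm.
have mw0 : 0 < (m + 1) * w by lra.
set a := ((m + 1) * w)^-1 in dm *.
have a0 : 0 < a by rewrite invr_gt0.
have a1 : a <= 1 by rewrite invf_le1//; lra.
have ai : a^-1 = (m + 1) * w by rewrite invrK.
have da : d <= a by [].
have hV1 := hV a 1 da a1 (lexx _).
(* First case: every term of the sum vanishes, and the cell [a, 1], cut off at 1, costs at most
   (Lam/2) w. This is the source of the Lam/2 in the bound. *)
have [hs|hs] := leP (m * w) 1.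
  have -> : \sum_(0 <= n < N.+1) dterm phi n w = 0.
    rewrite big_nat_cond big1// => n /andP[/andP[_ nN] _]; apply: dterm_small.
    apply: le_trans hs; rewrite em ler_pM2r// ler_nat//.
  rewrite subr0.
  apply: (@le_trans _ _ (Lam / 2 * a^-1 * (1 - a))).
    apply: Int_bound => //; first by apply: phidivbm; lra.
    move=> z az; have z0 : 0 < z by lra.
    rewrite normrM; apply: ler_pM => //; first by apply: phi_bd; lra.
    by rewrite normfV (gtr0_norm z0) lef_pV2 ?posrE//; lra.
  have -> : Lam / 2 * a^-1 * (1 - a) = Lam / 2 * (a^-1 - 1) by field; rewrite gt_eqF.
  rewrite ai; have h1 : Lam / 2 * ((m + 1) * w - 1) <= Lam / 2 * w.
    by rewrite ler_wpM2l ?divr_ge0//; lra.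
  have h2 : 0 <= w * (V 1 - V a).
    by rewrite mulr_ge0 ?(ltW w0)//; apply: le_trans hV1.
  lra.
have mw0' : 0 < m * w by lra.
set b := (m * w)^-1 in IH.
have b0 : 0 < b by rewrite invr_gt0.
have b1 : b <= 1 by rewrite invf_le1//; lra.
have ab : a <= b by rewrite lef_pV2 ?posrE// ler_pM2r//; lra.
have bi : b^-1 = m * w by rewrite invrK.
have {}IH := IH hs (le_trans da ab).
rewrite (@Int_split _ a b 1); [|lra|by apply: phidivbm; lra].
rewrite big_nat_recr//= {2}/dterm -em hs -/b.
(* In the variable 1/z each full cell has length w, so phi(z)/z is treated as z phi(z) times z^-2
   and compared with its value at [b]. *)
have ea : Int a b (fun z => z^-1 ^+ 2) = w.
  by rewrite Int_invr2// ai bi; ring.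
have ek : phi b * m^-1 = b * phi b * w by rewrite /b; field; rewrite !gt_eqF.
have mI : bdd_measurable a b (fun z => phi z * z^-1) by apply: phidivbm; lra.
have mX : bdd_measurable a b (fun z => z^-1 ^+ 2) by exact: bdd_measurable_invX.
have mZ c : bdd_measurable a b (fun z => c * z^-1 ^+ 2) by exact: bdd_measurableZ.
have h : `|Int a b (fun z => phi z * z^-1) - phi b * m^-1| <= (V b - V a) * w.
  have eI c : c * w = Int a b (fun z => c * z^-1 ^+ 2) by rewrite IntZ// ea.
  rewrite ek !eI -IntB//.
  apply: le_norm_Int => //; first exact: bdd_measurableB.
  move=> z az; have z0 : 0 < z by lra.
  have -> : phi z * z^-1 - b * phi b * z^-1 ^+ 2 =
    - ((b * phi b - z * phi z) * z^-1 ^+ 2) by field; rewrite gt_eqF.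
  rewrite normrN normrM (@ger0_norm _ (_ ^+ 2)) ?sqr_ge0// ler_wpM2r ?sqr_ge0//.
  have h1 := hV z b ltac:(lra) ltac:(lra) b1.
  have h2 := hV a z da ltac:(lra) ltac:(lra).
  by have := normr_ge0 (z * phi z - a * phi a); lra.
set S := \sum_(0 <= n < N) _ in IH *.
have -> : Int a b (fun z => phi z * z^-1) + Int b 1 (fun z => phi z * z^-1) -
   (S + phi b * m^-1) = (Int a b (fun z => phi z * z^-1) - phi b * m^-1) +
   (Int b 1 (fun z => phi z * z^-1) - S) by ring.
apply: le_trans (ler_normD _ _) _; apply: le_trans (lerD h IH) _; lra.
Qed.

Lemma dterm_le n w : 0 < w -> `|dterm phi n w| <= A * w^-1 * n.+1%:R^-1 ^+ 2.
Proof.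
move=> w0; have n0 := @succn_gt0 R n; have wi : 0 < w^-1 by rewrite invr_gt0.
rewrite /dterm; case: ifPn => [h|_]; last first.
  by rewrite normr0 !mulr_ge0// ltW.
have h0 : 0 < n.+1%:R * w by rewrite mulr_gt0.
rewrite normrM normfV (gtr0_norm n0).
have -> : A * w^-1 * n.+1%:R^-1 ^+ 2 = A * (n.+1%:R * w)^-1 * n.+1%:R^-1.
  by rewrite invfM; ring.
rewrite ler_wpM2r ?invr_ge0 ?(ltW n0)//; apply: phi_le.
by rewrite invr_gt0 h0 invf_le1// ltW.
Qed.

(** The Riemann sum is stopped at N0 = floor(1/(dw)) - 1, so that the cut a = 1/((N0+1) w) lies in
    [d, 2d]. The integral over ]0, a] and the terms n >= N0 cost at most 2 A d each; the latter uses
    N0 w >= 1/(2d), which follows from 1/d - 2 >= 1/(2d), that is d <= 1/4. *)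
Lemma dseries_le M d w N : 0 <= M -> 0 < d -> d <= 4^-1 -> lip_on M d ->
  0 < w <= 1 -> (d * w)^-1 <= N%:R ->
  `|dseries phi N w| <=
    w * (Lam / 2 + kvar_total + (M + A) * eps) + 4 * A * d.
Proof.
move=> M0 d0 d4 hM hw hN; have /andP[w0 w1] := hw.
have dw0 : 0 < d * w by rewrite mulr_gt0.
have dwi : 0 < (d * w)^-1 by rewrite invr_gt0.
have di : 4 <= d^-1 by rewrite -[4]invrK lef_pV2 ?posrE ?invr_gt0.
have dwE : (d * w)^-1 * w = d^-1 by field; rewrite !gt_eqF.
have [q hq] : exists q : nat, q%:R <= (d * w)^-1 < q.+1%:R.
  exists `|Num.floor (d * w)^-1|%N.
  have e : (`|Num.floor (d * w)^-1|%N%:R : R) = flr (d * w)^-1.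
    by rewrite /flr pmulrn gez0_abs// floor_ge0 ltW.
  by rewrite -natr1 e flr_le flr_gt.
have /andP[q1 q2] := hq; rewrite -natr1 in q2.
have q3 : q%:R * w <= d^-1 by rewrite -dwE ler_pM2r.
have q4 : d^-1 - w < q%:R * w.
  have : (d * w)^-1 * w < (q%:R + 1) * w by rewrite ltr_pM2r.
  by rewrite dwE; lra.
case: q hq q1 q2 q3 q4 => [|N0]; first by rewrite mul0r; lra.
move=> _ q1 q2 q3 q4.
have qw1 : 1 < N0.+1%:R * w by lra.
have dq : d <= (N0.+1%:R * w)^-1.
  by rewrite -[d]invrK lef_pV2 ?posrE ?invr_gt0//; lra.
have d1 : d <= 1 by lra.
have [V hV Vt] := kphi_dominated M0 d0 d1 hM.
have h1 := dseries_riemann hw d0 hV qw1 dq.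
set a := (N0.+1%:R * w)^-1 in dq h1.
have qw0 : 0 < N0.+1%:R * w by lra.
have a1 : a <= 1 by rewrite invf_le1//; lra.
have a0 : 0 < a by rewrite invr_gt0.
have h2 : V 1 - V a <= (M + A) * eps + kvar_total.
  have := hV d a (lexx _) dq a1; have := normr_ge0 (a * phi a - d * phi d); lra.
have a2 : a <= 2 * d.
  have -> : 2 * d = (d^-1 / 2)^-1 by field; rewrite gt_eqF.
  rewrite lef_pV2 ?posrE//; [lra | lra].
have h3 : `|Int 0 a (fun z => phi z * z^-1)| <= A * (a - 0).
  apply: Int_bound; [exact: ltW | by apply: phidivbm |].
  move=> z z0a; have z0 : 0 < z by lra.
  by rewrite normrM normfV (gtr0_norm z0) ler_pdivrMr//; apply: phi_le; lra.
have N0w : d^-1 / 2 <= N0%:R * w by move: q4; rewrite -natr1; lra.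
have N00 : (0 < N0)%N.
  by rewrite -(ltr_nat R) -(pmulr_lgt0 _ w0); lra.
have N0N : (N0 <= N)%N.
  by rewrite -(ler_nat R); apply: le_trans hN; apply: le_trans q1; rewrite ler_nat.
have h4 : `|\sum_(N0 <= n < N) dterm phi n w| <= A * (2 * d).
  apply: le_trans (ler_norm_sum _ _ _) _.
  apply: (@le_trans _ _ (\sum_(N0 <= n < N) (A * w^-1 * n.+1%:R^-1 ^+ 2))).
    by apply: ler_sum => n _; exact: dterm_le.
  rewrite -mulr_sumr -mulrA ler_wpM2l//.
  have wi : 0 < w^-1 by rewrite invr_gt0.
  apply: (@le_trans _ _ (w^-1 * N0%:R^-1)).
    by rewrite ler_pM2l//; exact: sum_invr_sqr_tail.
  have -> : 2 * d = (d^-1 / 2)^-1 by field; rewrite gt_eqF.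
  by rewrite -invfM mulrC lef_pV2 ?posrE//; lra.
have -> : dseries phi N w = Int 0 a (fun z => phi z * z^-1) +
   (Int a 1 (fun z => phi z * z^-1) - \sum_(0 <= n < N0) dterm phi n w) -
   \sum_(N0 <= n < N) dterm phi n w.
  rewrite /dseries /mean_phi (@Int_split _ 0 a 1); [|lra|exact: phidivbm].
  by rewrite (big_cat_nat (n := N0))//=; ring.
apply: le_trans (ler_normB _ _) _; apply: le_trans (lerD (ler_normD _ _) (lexx _)) _.
have h5 : w * (Lam / 2 + (V 1 - V a)) <= w * (Lam / 2 + kvar_total + (M + A) * eps).
  by rewrite ler_pM2l//; lra.
have h6 : A * (a - 0) <= A * (2 * d) by rewrite ler_wpM2l//; lra.
move: h1 h3 h4 h5 h6; set t1 := `|_|; set t2 := `|_|; set t3 := `|_|.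
set t4 := w * _; set t5 := w * _; set t6 := A * _; lra.
Qed.

(** One round: integrating lam D(w)/w^2 over [y, z] turns a bound M on [d, 1] into one where M
    carries the factor Lam eps, valid for every y > 0 at the price of a term in 4 A d/y. *)
Lemma lip_improve M d y z : 0 <= M -> 0 < d -> d <= 4^-1 -> lip_on M d ->
  0 < y -> y <= z -> z <= 1 ->
  `|phi z - phi y| <=
  Lam * (Lam / 2 + kvar_total + (M + A) * eps + 4 * A * d * y^-1) * ((z - y) * y^-1).
Proof.
move=> M0 d0 d4 hM y0 yz z1; have z0 : 0 < z by lra.
set B := Lam / 2 + kvar_total + (M + A) * eps.
have yi : 0 < y^-1 by rewrite invr_gt0.
apply: (@le_add_divn _ _ _ (2 * (Lam * (A * y^-1 ^+ 2))) (Num.bound (d * y)^-1)) => N hN.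
have dy0 : 0 < d * y by rewrite mulr_gt0.
have hN' : (d * y)^-1 <= N.+1%:R.
  apply: ltW; apply: lt_le_trans (archi_boundP (ltW _)) _; first by rewrite invr_gt0.
  by rewrite ler_nat ltnW.
have N1 t : y <= t -> 1 <= N.+1%:R * t.
  move=> yt; have t0 : 0 < t by lra.
  rewrite -ler_pdivrMr// mul1r; apply: le_trans hN'.
  rewrite lef_pV2 ?posrE//; apply: le_trans yt; rewrite ger_pMl//; lra.
have h1 := @phi_truncP _ _ _ _ mphi phi_le phiE N.+1 y ltac:(lra) (N1 _ (lexx _)).
have h2 := @phi_truncP _ _ _ _ mphi phi_le phiE N.+1 z ltac:(lra) (N1 _ yz).
have [mp ep] := phi_trunc_primitive mphi phi_le phi_J phiE N.+1 y0.
have h3 : `|phi_trunc phi lam N.+1 z - phi_trunc phi lam N.+1 y| <=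
    (Lam * (B + 4 * A * d * y^-1) * y^-1) * (z - y).
  rewrite ep//; apply: Int_bound => //; first by apply: bdd_measurableS mp.
  move=> w hw; have w0 : 0 < w by lra.
  have hb : `|dseries phi N.+1 w| <= w * B + 4 * A * d.
    apply: dseries_le hM _ _ => //; first by lra.
    by apply: le_trans hN'; rewrite lef_pV2 ?posrE ?mulr_gt0// ler_pM2l//; lra.
  have [j0 ji] : 0 < w^-1 /\ w^-1 <= y^-1.
    by apply: inv_pos_le => //; lra.
  have B0 : 0 <= B.
    have J0 := J_ge0 phi_J; have /andP[e0 e1] := eps01.
    have l1 : 0 <= ln eps^-1 by rewrite ln_ge0// invf_ge1.
    have l2 : 0 <= ln (2 : R) by rewrite ln_ge0//; lra.
    rewrite /B /kvar_total !addr_ge0 ?mulr_ge0 ?addr_ge0 ?(ltW e0)//; lra.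
  rewrite normrM -!mulrA ler_wpM2l// normrM (@ger0_norm _ (_ ^+ 2)) ?sqr_ge0//.
  apply: (@le_trans _ _ ((w * B + 4 * A * d) * w^-1 ^+ 2)).
    by rewrite ler_wpM2r ?sqr_ge0.
  have -> : (w * B + 4 * A * d) * w^-1 ^+ 2 = (B + 4 * A * d * w^-1) * w^-1.
    by field; rewrite gt_eqF.
  have Ad : 0 <= 4 * A * d by rewrite !mulr_ge0// ltW.
  have h4 : 4 * A * d * w^-1 <= 4 * A * d * y^-1 by rewrite ler_wpM2l.
  have h5 : 0 <= 4 * A * d * w^-1 by rewrite mulr_ge0// ltW.
  rewrite !mulrA; apply: ler_pM => //; [lra | lra | lra].
have h4 : Lam * (A * z^-1 ^+ 2 / N.+1%:R) <= Lam * (A * y^-1 ^+ 2 / N.+1%:R).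
  have [j0 ji] := inv_pos_le y0 yz.
  by rewrite ler_wpM2l// ler_wpM2r// ler_wpM2l// lerXn2r ?nnegrE// ltW.
have -> : phi z - phi y = (phi z - phi_trunc phi lam N.+1 z) +
  (phi_trunc phi lam N.+1 z - phi_trunc phi lam N.+1 y) -
  (phi y - phi_trunc phi lam N.+1 y) by ring.
apply: le_trans (ler_normB _ _) _; apply: le_trans (lerD (ler_normD _ _) (lexx _)) _.
apply: le_trans (lerD (lerD (le_trans h2 h4) h3) h1) _.
rewrite le_eqVlt; apply/orP; left; apply/eqP; ring.
Qed.

Hypothesis eps_small : Lam * eps <= 2^-1.

(** For y >= d one has d/y <= 1, and a round becomes the map from M to [lip_gain] + Lam eps M. *)
Definition lip_gain : R := Lam * (Lam / 2 + kvar_total + A * eps + 4 * A).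

Lemma kvar_total_ge0 : 0 <= kvar_total.
Proof.
have J0 := J_ge0 phi_J; have /andP[e0 e1] := eps01.
have l1 : 0 <= ln eps^-1 by rewrite ln_ge0// invf_ge1.
have l2 : 0 <= ln (2 : R) by rewrite ln_ge0//; lra.
by rewrite /kvar_total !mulr_ge0//; lra.
Qed.

Lemma lip_gain_ge0 : 0 <= lip_gain.
Proof.
have := kvar_total_ge0; have /andP[e0 e1] := eps01 => k0.
rewrite /lip_gain mulr_ge0//.
have h0 : 0 <= A := A0; have h1 : 0 <= A * eps by rewrite mulr_ge0// ltW.
by have := normr_ge0 lam; lra.
Qed.

(** The excess over 2 [lip_gain] is at first the rough Lipschitz constant on [d, 1]; Lam eps <= 1/2
    halves it at each round. *)
Lemma lip_iter d k : 0 < d -> d <= 4^-1 ->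
  lip_on (2 * lip_gain + Lam * (J + 2 * A * d^-1) * d^-1 * (2^-1) ^+ k) d.
Proof.
move=> d0 d4; have G0 := lip_gain_ge0; have J0 := J_ge0 phi_J.
have di : 0 < d^-1 by rewrite invr_gt0.
have M00 : 0 <= Lam * (J + 2 * A * d^-1) * d^-1.
  have h : 0 <= 2 * A * d^-1 by rewrite !mulr_ge0// ltW.
  by rewrite !mulr_ge0 ?(ltW di)//; lra.
have mono M M' : M <= M' -> lip_on M d -> lip_on M' d.
  move=> MM' h y z dy yz z1; apply: le_trans (h y z dy yz z1) _.
  by rewrite ler_wpM2r// mulr_ge0 ?subr_ge0// invr_ge0; lra.
elim: k => [|k IH].
  rewrite expr0 mulr1; apply: (mono (Lam * (J + 2 * A * d^-1) * d^-1)).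
    by lra.
  move=> y z dy yz z1; have y0 : 0 < y by lra.
  apply: le_trans (phi_rough_lipschitz mphi phi_le phi_J phiE y0 yz z1) _.
  have [i0 id] := inv_pos_le d0 dy; have [j0 ji] := inv_pos_le y0 yz.
  rewrite -!mulrA ler_wpM2l//; apply: ler_pM.
  - by rewrite addr_ge0 ?mulr_ge0// ltW.
  - by rewrite subr_ge0.
  - by rewrite lerD2l !ler_wpM2l.
  rewrite inv_sub//; last by lra.
  have -> : d^-1 * ((z - y) * y^-1) = (z - y) * (y^-1 * d^-1) by ring.
  rewrite ler_wpM2l ?subr_ge0// ler_wpM2l ?(ltW i0)//; lra.
set M := 2 * lip_gain + _ in IH.
have M0 : 0 <= M.
  by apply: addr_ge0; apply: mulr_ge0 => //; rewrite exprn_ge0// invr_ge0.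
apply: (mono (lip_gain + Lam * eps * M)).
  have h : Lam * eps * M <= 2^-1 * M by rewrite ler_wpM2r.
  apply: le_trans (lerD (lexx _) h) _; rewrite /M exprS.
  by rewrite le_eqVlt; apply/orP; left; apply/eqP; field; rewrite gt_eqF.
move=> y z dy yz z1; have y0 : 0 < y by lra.
apply: le_trans (lip_improve M0 d0 d4 IH y0 yz z1) _.
have [i0 id] := inv_pos_le d0 dy.
rewrite ler_wpM2r//; first by rewrite mulr_ge0 ?subr_ge0// ltW.
have -> : lip_gain + Lam * eps * M = Lam * (Lam / 2 + kvar_total + (M + A) * eps + 4 * A).
  by rewrite /lip_gain; ring.
rewrite ler_wpM2l// lerD2l -[X in _ <= X]mulr1 -mulrA ler_wpM2l ?mulr_ge0//.
by rewrite ler_pdivrMr// mul1r.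
Qed.

(** Letting the number of rounds grow removes the dependence of the constant on d. *)
Lemma lip_first d : 0 < d -> d <= 4^-1 -> lip_on (2 * lip_gain) d.
Proof.
move=> d0 d4 y z dy yz z1.
set M0 := Lam * (J + 2 * A * d^-1) * d^-1.
have y0 : 0 < y by lra.
have di : 0 < d^-1 by rewrite invr_gt0.
have J0 := J_ge0 phi_J.
have M00 : 0 <= M0.
  have h : 0 <= 2 * A * d^-1 by rewrite !mulr_ge0// ltW.
  by rewrite !mulr_ge0 ?(ltW di)//; lra.
have s0 : 0 <= (z - y) * y^-1 by rewrite mulr_ge0 ?subr_ge0// invr_ge0 ltW.
apply: (@le_add_divn _ _ _ (M0 * ((z - y) * y^-1)) 0) => N _.
apply: le_trans (lip_iter N d0 d4 dy yz z1) _; rewrite -/M0 mulrDl lerD2l.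
rewrite [X in _ <= X]mulrAC ler_wpM2r// ler_wpM2l//.
rewrite exprVn lef_pV2 ?posrE ?ltr0n ?exprn_gt0//.
by rewrite -natrX ler_nat; exact: ltn_expl.
Qed.

(** [lip_gain] contains 4 Lam A, which is of order Lam^4 log Lam for the A used later. In one more
    round with d -> 0 the term in A d/y disappears, and [lip_gain] itself is multiplied by Lam eps;
    this brings the constant down to Lam^3 (log Lam)^2. *)
Lemma phi_lipschitz y z : 0 < y -> y <= z -> z <= 1 ->
  `|phi z - phi y| <=
  Lam * (Lam / 2 + kvar_total + (2 * lip_gain + A) * eps) * ((z - y) * y^-1).
Proof.
move=> y0 yz z1.
have G0 := lip_gain_ge0; have G2 : 0 <= 2 * lip_gain by lra.
apply: (@le_add_eps _ _ _ (Lam * (4 * A * y^-1) * ((z - y) * y^-1))) => d d0 d4.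
apply: le_trans (lip_improve G2 d0 d4 (lip_first d0 d4) y0 yz z1) _.
rewrite le_eqVlt; apply/orP; left; apply/eqP; ring.
Qed.

End Lipschitz.

(** * Harmonic and logarithmic sums *)

Section Sums.
Variable R : realType.
Implicit Types (N K : nat).

Lemma sum_invr_le_ln K : (0 < K)%N ->
  \sum_(0 <= n < K) (n.+1%:R^-1 : R) <= 1 + ln K%:R.
Proof.
case: K => // K _; elim: K => [|K IH]; first by rewrite big_nat1 invr1 ln1 addr0.
rewrite big_nat_recr//=.
have k0 : (0 : R) < K.+1%:R by rewrite ltr0n.
have /andP[h _] := @ln_sub_bounds R K.+1%:R K.+2%:R k0 ltac:(by rewrite ler_nat).
move: h IH; rewrite (_ : K.+2%:R - K.+1%:R = 1 :> R); last by rewrite -(natr1 K.+1); ring.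
rewrite mul1r; move: (ln _) (ln _) (_^-1) (\sum_(_ <= _ < _) _) => a b i s; lra.
Qed.

(** Telescopes (2 + ln t)/t. The tail integral of ln t/t^2 from K is (1 + ln K)/K; the extra 1/K
    pays for the discretisation. *)
Lemma sum_ln_tail K N : (0 < K)%N ->
  \sum_(K <= n < N) (ln n.+1%:R * n.+1%:R^-1 ^+ 2 : R) <= (2 + ln K%:R) * K%:R^-1.
Proof.
move=> K0.
have pos n : (0 < n)%N -> 0 <= (2 + ln n%:R) * (n%:R^-1 : R).
  by move=> n0; rewrite mulr_ge0 ?invr_ge0// addr_ge0// ln_ge0// ler1n.
have [h|h] := leqP N K; first by rewrite big_geq//; exact: pos.
suff H : \sum_(K <= n < N) (ln n.+1%:R * n.+1%:R^-1 ^+ 2 : R) <=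
    (2 + ln K%:R) * K%:R^-1 - (2 + ln N%:R) * N%:R^-1.
  by apply: le_trans H _; rewrite gerBl; apply: pos; exact: leq_ltn_trans h.
have step n : (0 < n)%N -> ln n.+1%:R * n.+1%:R^-1 ^+ 2 <=
    (2 + ln n%:R) * n%:R^-1 - (2 + ln n.+1%:R) * n.+1%:R^-1 :> R.
  move=> n0; have a0 : (0 : R) < n%:R by rewrite ltr0n.
  have a1 : (1 : R) <= n%:R by rewrite ler1n.
  rewrite -natr1; move: a0 a1; set a : R := n%:R => a0 a1.
  have b0 : 0 < a + 1 by lra.
  have /andP[_ l1] := @ln_sub_bounds R a (a + 1) a0 ltac:(lra).
  have l0 : 0 <= ln (a + 1) by rewrite ln_ge0//; lra.
  have [q0 qp] := @inv_pos_le R a (a + 1) a0 ltac:(lra).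
  have e := @inv_sub R a (a + 1) a0 b0.
  have ap : a * a^-1 = 1 by rewrite divff// gt_eqF.
  have bq : (a + 1) * (a + 1)^-1 = 1 by rewrite divff// gt_eqF.
  move: l1 l0 q0 qp e ap bq; set p := a^-1; set q := (a + 1)^-1.
  set la := ln a; set lb := ln (a + 1); rewrite (_ : a + 1 - a = 1); last by ring.
  rewrite !mul1r => l1 l0 q0 qp e ap bq.
  have p0 : 0 < p by lra.
  have h1 : p * lb - p * p <= p * la by rewrite -mulrBr ler_pM2l//; lra.
  have h2 : lb * (q * q) <= lb * (p * q) by rewrite ler_wpM2l// ler_pM2r.
  have h3 : p * p <= 2 * (p * q).
    have : p <= 2 * q by nra.
    by rewrite -(ler_pM2l p0); lra.
  rewrite expr2.
  have -> : (2 + la) * p - (2 + lb) * q = 2 * (p - q) + p * la - p * lb + lb * (p - q) by ring.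
  rewrite e; lra.
elim: N h => // N IH; rewrite ltnS leq_eqVlt => /predU1P[<-|h].
  by rewrite big_nat1; exact: step.
rewrite big_nat_recr ?(ltnW h)//=.
apply: le_trans (lerD (IH h) (step N (leq_ltn_trans (leq0n _) h))) _.
by rewrite addrA subrK.
Qed.

End Sums.

(** * Expansion of phi at x by two integrations by parts *)

Section Expansion.
Variables (R : realType) (phi : R -> R) (lam A J A' : R).
Implicit Types (a b c x y z v w d : R) (n N K : nat).
Local Notation Lam := `|lam|.
Hypothesis mphi : measurable_fun [set: R] phi.
Hypothesis phi_le : forall y, 0 < y <= 1 -> `|phi y| <= A * y.
Hypothesis phi_J : Int 0 1 (fun z => `|phi z| * z^-1) <= J.
Hypothesis phiE : forall x, 0 < x <= 1 ->
  phi x = - lam * Int 0 1 (fun y => B1t (x * y)^-1 * phi y).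
Hypothesis A'0 : 0 <= A'.
Hypothesis phi_lip : forall y z, 0 < y -> y <= z -> z <= 1 ->
  `|phi z - phi y| <= A' * ((z - y) * y^-1).

Let A0 := A_ge0 phi_le.
Let phibm := phi_bm mphi phi_le.

(** The weight w^-2 is split off because B2(1/(xw)) w^-2 has integrals of size x/3; in each use g
    carries a compensating factor w^2. *)
Lemma B2t_abel x d g V : 0 < x -> 0 < d -> d <= 1 -> dominated_on d 1 g V ->
  `|Int d 1 (fun w => B2t (x * w)^-1 * (w^-1 ^+ 2 * g w))| <=
  x / 3 * (`|g 1| + (V 1 - V d)).
Proof.
move=> x0 d0 d1 hV.
have -> : Int d 1 (fun w => B2t (x * w)^-1 * (w^-1 ^+ 2 * g w)) =
   Int d 1 (fun w => (B2t (x * w)^-1 * w^-1 ^+ 2) * g w).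
  by apply: eq_Int => w _; rewrite mulrA.
apply: (@abel_bound _ d 1 _ g V) => //.
  by apply: bdd_measurableM; [exact: bdd_measurable_B2t | exact: bdd_measurable_invX].
by move=> y /andP[dy y1]; exact: Int_B2t_bound.
Qed.

Lemma Int_B2t_wphi x d : 0 < x -> 0 < d -> d <= 1 ->
  `|Int d 1 (fun w => B2t (x * w)^-1 * (w * phi w))| <= x / 3 * (A' + 4 * A).
Proof.
move=> x0 d0 d1; have hA : 0 <= A := A0; have hA' := A'0.
pose g w := w ^+ 3 * phi w; pose V w := (A' + 3 * A) * w.
have hV : dominated_on d 1 g V.
  move=> y z dy yz z1; have y0 : 0 < y by lra.
  rewrite /g /V.
  have -> : z ^+ 3 * phi z - y ^+ 3 * phi y =
    y ^+ 3 * (phi z - phi y) + (z ^+ 3 - y ^+ 3) * phi z by ring.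
  have h1 : `|y ^+ 3 * (phi z - phi y)| <= A' * (z - y).
    rewrite normrM (@ger0_norm _ (y ^+ 3)); last by rewrite exprn_ge0// ltW.
    apply: (@le_trans _ _ (y ^+ 3 * (A' * ((z - y) * y^-1)))).
      by rewrite ler_wpM2l ?exprn_ge0 ?(ltW y0)//; exact: phi_lip.
    have -> : y ^+ 3 * (A' * ((z - y) * y^-1)) = A' * (z - y) * y ^+ 2.
      by field; rewrite gt_eqF.
    rewrite -[X in _ <= X]mulr1 ler_wpM2l ?mulr_ge0 ?subr_ge0//.
    by apply: exprn_ile1; lra.
  have h2 : `|(z ^+ 3 - y ^+ 3) * phi z| <= 3 * (z - y) * A.
    rewrite normrM; apply: ler_pM => //; last by apply: (phi_leA phi_le); lra.
    have -> : z ^+ 3 - y ^+ 3 = (z - y) * (z ^+ 2 + z * y + y ^+ 2) by ring.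
    have z2 : z ^+ 2 <= 1 by rewrite exprn_ile1//; lra.
    have y2 : y ^+ 2 <= 1 by rewrite exprn_ile1//; lra.
    have zy1 : z * y <= 1 by nra.
    have zy0 : 0 <= z * y by rewrite mulr_ge0//; lra.
    have := sqr_ge0 z; have := sqr_ge0 y => ? ?.
    rewrite ger0_norm; last by rewrite mulr_ge0 ?subr_ge0//; lra.
    by rewrite [X in _ <= X]mulrC ler_wpM2l ?subr_ge0//; lra.
  by apply: le_trans (ler_normD _ _) _; lra.
have := B2t_abel x0 d0 d1 hV.
have -> : Int d 1 (fun w => B2t (x * w)^-1 * (w^-1 ^+ 2 * g w)) =
    Int d 1 (fun w => B2t (x * w)^-1 * (w * phi w)).
  by apply: eq_Int => w dw; rewrite /g; field; rewrite !gt_eqF ?andbT; lra.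
move=> /le_trans; apply; rewrite ler_wpM2l ?divr_ge0 ?(ltW x0)//.
have h1 : `|phi 1| <= A by apply: (phi_leA phi_le); rewrite ltr01 lexx.
have h2 : 0 <= (A' + 3 * A) * d by rewrite mulr_ge0//; lra.
rewrite /g /V expr1n mul1r; lra.
Qed.

Lemma Int_B2t_cst x d : 0 < x -> 0 < d -> d <= 1 ->
  `|Int d 1 (fun w => B2t (x * w)^-1)| <= x.
Proof.
move=> x0 d0 d1.
have hV : dominated_on d 1 (fun w : R => w ^+ 2) (fun w => w ^+ 2).
  move=> y z dy yz z1; rewrite ger0_norm// subr_ge0 lerXn2r ?nnegrE//; lra.
have := B2t_abel x0 d0 d1 hV.
have -> : Int d 1 (fun w => B2t (x * w)^-1 * (w^-1 ^+ 2 * w ^+ 2)) =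
    Int d 1 (fun w => B2t (x * w)^-1).
  by apply: eq_Int => w dw; rewrite -exprMn mulVf ?expr1n ?mulr1// gt_eqF//; lra.
move=> /le_trans; apply; rewrite !expr1n normr1.
have := sqr_ge0 d; nra.
Qed.

Definition dint x d n : R := Int d 1 (fun w => B2t (x * w)^-1 * dterm phi n w).

Lemma dint_restrict x d n : 0 < d -> d <= 1 ->
  exists e, [/\ d <= e, n.+1%:R^-1 <= e, e <= 1 &
    dint x d n = n.+1%:R^-1 *
      Int e 1 (fun w => B2t (x * w)^-1 * phi (n.+1%:R * w)^-1)].
Proof.
move=> d0 d1.
have [m em] : exists m : R, m = n.+1%:R by eexists.
have m1 : 1 <= m by rewrite em ler1n.
have m0 : 0 < m by lra.
have mi1 : m^-1 <= 1 by rewrite invf_le1.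
pose e := Num.max d m^-1; exists e; rewrite -em.
have de : d <= e by rewrite le_max lexx.
have me : m^-1 <= e by rewrite le_max lexx orbT.
have e1 : e <= 1 by rewrite ge_max d1.
split=> //.
have mB : bdd_measurable d 1 (fun w => B2t (x * w)^-1 * dterm phi n w).
  apply: bdd_measurableM; first exact: bdd_measurable_B2t.
  by apply: (dterm_bm mphi phi_le); exact: ltW.
rewrite /dint (@Int_split _ d e 1) ?de//.
have -> : Int d e (fun w => B2t (x * w)^-1 * dterm phi n w) = Int d e (fun=> 0).
  apply: eq_Int => w /andP[dw we]; rewrite dterm_small ?mulr0// -em mulrC.
  rewrite -ler_pdivlMr// mul1r; move: we; rewrite /e; case: (leP d m^-1) => // _; lra.
rewrite Int_cst// mul0r add0r.
have ee w : e < w <= 1 -> dterm phi n w = m^-1 * phi (m * w)^-1.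
  move=> /andP[ew w1]; rewrite /dterm -em ifT ?(mulrC m^-1)//.
  by rewrite mulrC -ltr_pdivrMr// mul1r; exact: le_lt_trans ew.
rewrite -IntZ.
  by apply: eq_Int => w ew; rewrite ee//; ring.
apply: bdd_measurableM; first exact: bdd_measurable_B2t.
apply: (@bdd_measurableT _ _ _ _ A); first exact: measurable_comp_invM.
move=> w /andP[ew w1]; apply: (phi_leA phi_le).
have w0 : 0 < w by lra.
rewrite invr_gt0 mulr_gt0//= invf_le1 ?mulr_gt0//.
by rewrite mulrC -ler_pdivrMr// mul1r; lra.
Qed.

(** The Lipschitz constant A' + 2 A of w^2 phi(1/(mw)) does not depend on m, as the bound on phi is
    dilation invariant; the factor 1/m comes from [dterm]. *)
Lemma dint_le x d n : 0 < x -> 0 < d -> d <= 1 ->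
  `|dint x d n| <= n.+1%:R^-1 * (x / 3 * (A' + 3 * A)).
Proof.
move=> x0 d0 d1; have hA : 0 <= A := A0; have hA' := A'0.
have [e [de]] := dint_restrict x n d0 d1.
have [m em] : exists m : R, m = n.+1%:R by eexists.
have m1 : 1 <= m by rewrite em ler1n.
have m0 : 0 < m by lra.
have mi0 : 0 < m^-1 by rewrite invr_gt0.
rewrite -em => me e1 ->; have e0 : 0 < e by lra.
rewrite normrM (gtr0_norm mi0) ler_pM2l//.
pose g w := w ^+ 2 * phi (m * w)^-1; pose V w := (A' + 2 * A) * w.
have hu w : e <= w -> w <= 1 -> 0 < (m * w)^-1 <= 1.
  move=> ew w1; have w0 : 0 < w by lra.
  rewrite invr_gt0 mulr_gt0//= invf_le1 ?mulr_gt0//.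
  by rewrite mulrC -ler_pdivrMr// mul1r; lra.
have hV : dominated_on e 1 g V.
  move=> y z ey yz z1; have y0 : 0 < y by lra. have z0 : 0 < z by lra.
  rewrite /g /V.
  have -> : z ^+ 2 * phi (m * z)^-1 - y ^+ 2 * phi (m * y)^-1 =
    (z ^+ 2 - y ^+ 2) * phi (m * z)^-1 - y ^+ 2 * (phi (m * y)^-1 - phi (m * z)^-1) by ring.
  have /andP[uz0 uz1] := hu z ltac:(lra) z1.
  have /andP[uy0 uy1] := hu y ey ltac:(lra).
  have uu : (m * z)^-1 <= (m * y)^-1 by rewrite lef_pV2 ?posrE ?mulr_gt0// ler_pM2l.
  have h1 : `|y ^+ 2 * (phi (m * y)^-1 - phi (m * z)^-1)| <= A' * (z - y).
    rewrite normrM (@ger0_norm _ (y ^+ 2)) ?sqr_ge0//.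
    apply: (@le_trans _ _ (y ^+ 2 * (A' * (((m * y)^-1 - (m * z)^-1) * ((m * z)^-1)^-1)))).
      by rewrite ler_wpM2l ?sqr_ge0//; exact: phi_lip.
    have -> : y ^+ 2 * (A' * (((m * y)^-1 - (m * z)^-1) * ((m * z)^-1)^-1)) =
       A' * (z - y) * y by field; rewrite !gt_eqF.
    by rewrite -[X in _ <= X]mulr1 ler_wpM2l ?mulr_ge0 ?subr_ge0//; lra.
  have h2 : `|(z ^+ 2 - y ^+ 2) * phi (m * z)^-1| <= 2 * (z - y) * A.
    rewrite normrM; apply: ler_pM => //; last by apply: (phi_leA phi_le); rewrite uz0.
    have -> : z ^+ 2 - y ^+ 2 = (z - y) * (z + y) by ring.
    rewrite ger0_norm; last by rewrite mulr_ge0 ?subr_ge0//; lra.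
    by rewrite [X in _ <= X]mulrC ler_wpM2l ?subr_ge0//; lra.
  by apply: le_trans (ler_normB _ _) _; lra.
have := B2t_abel x0 e0 e1 hV.
have -> : Int e 1 (fun w => B2t (x * w)^-1 * (w^-1 ^+ 2 * g w)) =
    Int e 1 (fun w => B2t (x * w)^-1 * phi (m * w)^-1).
  apply: eq_Int => w ew; congr (_ * _); rewrite /g mulrA -exprMn mulVf ?expr1n ?mul1r// gt_eqF//.
  by lra.
move=> /le_trans; apply; rewrite ler_wpM2l ?divr_ge0 ?(ltW x0)//.
have h1 : `|phi (m * 1)^-1| <= A by apply: (phi_leA phi_le); exact: hu.
have h2 : 0 <= (A' + 2 * A) * e by rewrite mulr_ge0//; lra.
rewrite /g /V expr1n mul1r; lra.
Qed.

(** No cancellation is used: |B2| <= 1/6, |phi(1/(mw))| <= A/(mw), and dw/w over [1/m, 1] gives ln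
    m. No factor x is gained, but the bound is summable in n. *)
Lemma dint_le_ln x d n : 0 < d -> d <= 1 ->
  `|dint x d n| <= A / 6 * (ln n.+1%:R * n.+1%:R^-1 ^+ 2).
Proof.
move=> d0 d1; have hA : 0 <= A := A0.
have [e [de]] := dint_restrict x n d0 d1.
have [m em] : exists m : R, m = n.+1%:R by eexists.
have m1 : 1 <= m by rewrite em ler1n.
have m0 : 0 < m by lra.
have mi0 : 0 < m^-1 by rewrite invr_gt0.
rewrite -em => me e1 ->; have e0 : 0 < e by lra.
rewrite normrM (gtr0_norm mi0).
have -> : A / 6 * (ln m * m^-1 ^+ 2) = m^-1 * (A / 6 * m^-1 * ln m) by ring.
rewrite ler_pM2l//.
apply: (@le_trans _ _ (A / 6 * m^-1 * Int e 1 (fun w => w^-1))); last first.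
  rewrite Int_invr// ln1 sub0r -lnV ?posrE// ler_wpM2l//.
    by rewrite mulr_ge0 ?divr_ge0// ltW.
  by rewrite ler_ln ?posrE ?invr_gt0// -[m]invrK lef_pV2 ?posrE.
have hu w : e < w <= 1 -> 0 < (m * w)^-1 <= 1.
  move=> /andP[ew w1]; have w0 : 0 < w by lra.
  rewrite invr_gt0 mulr_gt0//= invf_le1 ?mulr_gt0//.
  by rewrite mulrC -ler_pdivrMr// mul1r; lra.
rewrite -IntZ; last exact: bdd_measurable_inv.
apply: le_norm_Int.
- apply: bdd_measurableM; first exact: bdd_measurable_B2t.
  apply: (@bdd_measurableT _ _ _ _ A); first exact: measurable_comp_invM.
  by move=> w ew; apply: (phi_leA phi_le); exact: hu.
- by apply: bdd_measurableZ; exact: bdd_measurable_inv.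
move=> w ew; have w0 : 0 < w by lra.
rewrite normrM.
have -> : A / 6 * m^-1 * w^-1 = 6^-1 * (A * (m * w)^-1) by rewrite invfM; ring.
by apply: ler_pM => //; [exact: norm_B2t | apply: phi_le; exact: hu].
Qed.

(** K = floor(1/x) balances the two estimates: the harmonic sum up to K gives x log K, the tail
    gives (log K)/K, and both are O(x (1 + log(1/x))). *)
Lemma sum_dint_le x d K N : 0 < x -> 0 < d -> d <= 1 -> (0 < K)%N -> (K <= N)%N ->
  K%:R <= x^-1 < K.+1%:R ->
  `|\sum_(0 <= n < N) dint x d n| <= x * (1 + ln x^-1) * ((A' + 5 * A) / 3).
Proof.
move=> x0 d0 d1 K0 KN /andP[Kx xK]; have hA : 0 <= A := A0; have hA' := A'0.
have k0 : (0 : R) < K%:R by rewrite ltr0n.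
have k1 : (1 : R) <= K%:R by rewrite ler1n.
have xi0 : 0 < x^-1 by rewrite invr_gt0.
have lK : ln K%:R <= ln x^-1 by rewrite ler_ln ?posrE.
have lK0 : 0 <= ln (K%:R : R) by rewrite ln_ge0.
have ki : K%:R^-1 <= 2 * x.
  have -> : 2 * x = (x^-1 / 2)^-1 by field; rewrite gt_eqF.
  rewrite lef_pV2 ?posrE//; last by lra.
  by move: xK; rewrite -natr1; lra.
rewrite (big_cat_nat (n := K))//=; apply: le_trans (ler_normD _ _) _.
have h1 : `|\sum_(0 <= n < K) dint x d n| <= (1 + ln x^-1) * (x / 3 * (A' + 3 * A)).
  apply: le_trans (ler_norm_sum _ _ _) _.
  apply: (@le_trans _ _ (\sum_(0 <= n < K) (n.+1%:R^-1 * (x / 3 * (A' + 3 * A))))).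
    by apply: ler_sum => n _; exact: dint_le.
  rewrite -mulr_suml ler_wpM2r//.
    by rewrite !mulr_ge0 ?(ltW x0)//; lra.
  by apply: le_trans (sum_invr_le_ln R K0) _; lra.
have h2 : `|\sum_(K <= n < N) dint x d n| <= A / 6 * ((2 + ln x^-1) * (2 * x)).
  apply: le_trans (ler_norm_sum _ _ _) _.
  apply: (@le_trans _ _ (\sum_(K <= n < N) (A / 6 * (ln n.+1%:R * n.+1%:R^-1 ^+ 2)))).
    by apply: ler_sum => n _; exact: dint_le_ln.
  rewrite -mulr_sumr ler_wpM2l ?divr_ge0//.
  apply: le_trans (sum_ln_tail R N K0) _.
  by apply: ler_pM => //; lra.
apply: le_trans (lerD h1 h2) _.
have h3 : 0 <= A * x * ln x^-1 by rewrite !mulr_ge0// ?(ltW x0)//; lra.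
have h4 : 0 <= A * x by rewrite mulr_ge0// ltW.
have -> : (1 + ln x^-1) * (x / 3 * (A' + 3 * A)) + A / 6 * ((2 + ln x^-1) * (2 * x)) =
  x * (1 + ln x^-1) * ((A' + 5 * A) / 3) - A * x * ln x^-1 / 3 by field.
lra.
Qed.

Lemma primitive_sqr a b : primitive_on a b (fun w : R => w + w) (fun w => w * w).
Proof.
have hid : primitive_on a b (fun=> (1 : R)) (fun w => w).
  split; first exact: bdd_measurable_cst.
  by move=> y z _ yz _; rewrite Int_cst// mul1r.
have [m e] := primitiveM hid hid.
have E : (fun w : R => 1 * w + w * 1) = (fun w => w + w).
  by apply/funext => w; rewrite mul1r mulr1.
by rewrite E in m e; split.
Qed.

Lemma primitive_B1t x a b : 0 < x -> 0 < a ->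
  primitive_on a b (fun w => B1t (x * w)^-1 * w^-1 ^+ 2)
    (fun w => - (x / 2) * B2t (x * w)^-1).
Proof.
move=> x0 a0; split.
  by apply: bdd_measurableM; [exact: bdd_measurable_B1t | exact: bdd_measurable_invX].
move=> y z ay yz zb; rewrite Int_B1t//; [by field | exact: lt_le_trans ay].
Qed.

(** B1(1/(xw)) w^-2 is integrated by parts against w^2 phi, with phi replaced by [phi_trunc], whose
    derivative is known. The end w = 1 gives the main term, the end d is O(d) up to the truncation
    error, and the derivative 2 w phi + lam D of w^2 phi gives [I2] and [I3]. *)
Lemma phi_expansion_trunc x d K N : 0 < x <= 1 -> 0 < d -> d <= 1 -> (0 < K)%N ->
  (K <= N)%N -> K%:R <= x^-1 < K.+1%:R -> 1 <= N%:R * d ->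
  `|phi x - x / 2 * lam * phi 1 * B2t x^-1| <=
  Lam * (x / 2) * (2 * (x / 3 * (A' + 4 * A)) + Lam * (J * x) +
     Lam * (x * (1 + ln x^-1) * ((A' + 5 * A) / 3))) + Lam * A * d
  + Lam * (Lam * (A * d^-1 ^+ 2 / N%:R)).
Proof.
move=> hx d0 d1 K0 KN hK Nd; have /andP[x0 x1] := hx.
have hA : 0 <= A := A0.
have N0 : (0 : R) < N%:R by rewrite ltr0n (leq_trans K0).
(* A bound for |phi - phi_trunc| uniform on [d, 1]. *)
set e := Lam * (A * d^-1 ^+ 2 / N%:R).
have e0 : 0 <= e by rewrite !mulr_ge0 ?invr_ge0 ?(ltW d0) ?(ltW N0).
have x20 : 0 <= x / 2 by lra.
have x21 : x / 2 <= 2^-1 by lra.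
have d1' : 1 - d <= 1 by lra.
have e2 : 0 <= 2^-1 * e by lra.
have e6 : 0 <= 6^-1 * e by lra.
pose pN := phi_trunc phi lam N.
have hpN w : d <= w -> w <= 1 -> `|phi w - pN w| <= e.
  move=> dw w1; have w0 : 0 < w by lra.
  apply: le_trans (phi_truncP mphi phi_le phiE _ _) _; first by lra.
    by apply: le_trans Nd _; rewrite ler_pM2l.
  have [i0 id] := inv_pos_le d0 dw.
  rewrite ler_wpM2l// ler_wpM2r ?invr_ge0// ler_wpM2l// lerXn2r ?nnegrE//; lra.
have prN := phi_trunc_primitive mphi phi_le phi_J phiE N d0.
have prQ := primitiveM (primitive_sqr d 1) prN.
have prB := primitive_B1t 1 x0 d0.
have [_ /(_ d 1)] := primitiveM prB prQ.
rewrite d1 !lexx => /(_ isT isT isT).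
have mphi1 : bdd_measurable d 1 phi by apply: phibm => //; exact: ltW.
have mpN : bdd_measurable d 1 pN by exact: primitive_bdd_measurable prN.
have mB1 : bdd_measurable d 1 (fun w => B1t (x * w)^-1) by exact: bdd_measurable_B1t.
have mB2 : bdd_measurable d 1 (fun w => B2t (x * w)^-1) by exact: bdd_measurable_B2t.
have mid : bdd_measurable d 1 (fun w => w) by exact: bdd_measurable_id.
have mD : bdd_measurable d 1 (dseries phi N).
  by apply: (dseries_bm mphi phi_le); exact: ltW.
have md n : bdd_measurable d 1 (dterm phi n).
  by apply: (dterm_bm mphi phi_le); exact: ltW.
pose I1 := Int d 1 (fun w => B1t (x * w)^-1 * pN w).
pose I2 := Int d 1 (fun w => B2t (x * w)^-1 * (w * pN w)).
pose I3 := Int d 1 (fun w => B2t (x * w)^-1 * dseries phi N w).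
have m1 : bdd_measurable d 1 (fun w => B1t (x * w)^-1 * pN w) by exact: bdd_measurableM.
have m2 : bdd_measurable d 1 (fun w => B2t (x * w)^-1 * (w * pN w)).
  by do 2 apply: bdd_measurableM => //.
have m2' : bdd_measurable d 1 (fun w => B2t (x * w)^-1 * (w * phi w)).
  by do 2 apply: bdd_measurableM => //.
have m3 : bdd_measurable d 1 (fun w => B2t (x * w)^-1 * dseries phi N w).
  exact: bdd_measurableM.
set Lhs := _ - _; set Rhs := Int _ _ _.
have -> : Rhs = I1 - x / 2 * (2 * I2 + lam * I3).
  rewrite /I1 /I2 /I3 -!IntZ//.
  rewrite -IntD; [|exact: bdd_measurableZ|exact: bdd_measurableZ].
  rewrite -IntZ; last by apply: bdd_measurableD; exact: bdd_measurableZ.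
  rewrite -IntB//; last by apply: bdd_measurableZ; apply: bdd_measurableD; exact: bdd_measurableZ.
  apply: eq_Int => w dw; have w0 : 0 < w by lra.
  by rewrite -/pN; move: (B1t _) (B2t _) (pN w) (dseries _ _ _) => b1 b2 q D;
    field; rewrite gt_eqF.
rewrite /Lhs -/pN !mulr1 !mul1r => eI1.
have e1 : phi x = - lam * (Int 0 d (fun y => B1t (x * y)^-1 * phi y) +
    (Int d 1 (fun y => B1t (x * y)^-1 * (phi y - pN y)) + I1)).
  rewrite phiE// (@Int_split _ 0 d 1) ?(ltW d0)//; last first.
    by apply: bdd_measurableM; [exact: bdd_measurable_B1t | exact: phibm].
  congr (_ * (_ + _)); rewrite /I1 -IntD//.
    by apply: eq_Int => w _; ring.
  by apply: bdd_measurableM => //; exact: bdd_measurableB.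
set E0 := Int 0 d _ in e1; set E1 := Int d 1 _ in e1.
have hE0 : `|E0| <= A / 2 * d.
  rewrite -[X in _ * X](subr0 d); apply: Int_bound; first exact: ltW.
    by apply: bdd_measurableM; [exact: bdd_measurable_B1t | exact: phibm].
  move=> y yd; rewrite normrM mulrC; apply: ler_pM => //; last exact: norm_B1t.
  by apply: (phi_leA phi_le); lra.
have hE1 : `|E1| <= 2^-1 * e.
  apply: (@le_trans _ _ (2^-1 * e * (1 - d))).
    apply: Int_bound => //; first by apply: bdd_measurableM => //; exact: bdd_measurableB.
    move=> y /andP[dy y1]; rewrite normrM ler_pM//; first exact: norm_B1t.
    exact: hpN (ltW dy) y1.
  by rewrite ler_piMr.
have hI2 : `|I2| <= x / 3 * (A' + 4 * A) + 6^-1 * e.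
  (* Back from [pN] to phi, for which the Lipschitz bound with A' is available. *)
  have -> : I2 = Int d 1 (fun w => B2t (x * w)^-1 * (w * phi w)) -
     Int d 1 (fun w => B2t (x * w)^-1 * (w * (phi w - pN w))).
    rewrite -IntB//; first by apply: eq_Int => w _; ring.
    by do 2 apply: bdd_measurableM => //; exact: bdd_measurableB.
  apply: le_trans (ler_normB _ _) _; apply: lerD; first exact: Int_B2t_wphi.
  apply: (@le_trans _ _ (6^-1 * e * (1 - d))).
    apply: Int_bound => //.
      by do 2 apply: bdd_measurableM => //; exact: bdd_measurableB.
    move=> y /andP[dy y1]; rewrite normrM ler_pM//; first exact: norm_B2t.
    rewrite normrM -[X in _ <= X]mul1r ler_pM//; last exact: hpN (ltW dy) y1.
    by rewrite gtr0_norm// (lt_trans d0).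
  by rewrite ler_piMr.
have hI3 : `|I3| <= J * x + x * (1 + ln x^-1) * ((A' + 5 * A) / 3).
  have -> : I3 = mean_phi phi * Int d 1 (fun w => B2t (x * w)^-1) -
      \sum_(0 <= n < N) dint x d n.
    rewrite /I3 -IntZ// /dint -Int_sum//; last by move=> n; exact: bdd_measurableM.
    rewrite -IntB; [|exact: bdd_measurableZ|by apply: bdd_measurable_sum => n; exact: bdd_measurableM].
    by apply: eq_Int => w _; rewrite /dseries mulrBr mulr_sumr mulrC.
  apply: le_trans (ler_normB _ _) _; apply: lerD; last exact: (sum_dint_le (K := K)).
  rewrite normrM; apply: ler_pM => //; first exact: (mean_phi_le mphi phi_le phi_J).
  exact: Int_B2t_cst.
have hQd : `|d * d * pN d| <= d * A + e.
  have h := hpN d (lexx _) d1; have h' := phi_leA phi_le (y := d) ltac:(lra).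
  have : `|pN d| <= A + e.
    have -> : pN d = phi d - (phi d - pN d) by ring.
    by apply: le_trans (ler_normB _ _) _; lra.
  rewrite (normrM (d * d)) (@ger0_norm _ (d * d)); last by rewrite mulr_ge0// ltW.
  move=> h3; apply: (@le_trans _ _ (d * d * (A + e))).
    by rewrite ler_wpM2l// mulr_ge0// ltW.
  have : d * d <= d by rewrite ler_piMr// ltW.
  nra.
have hp1 := hpN 1 d1 (lexx _).
have b1 := norm_B2t x^-1; have b2 := norm_B2t (x * d)^-1.
set B := B2t x^-1 in eI1 b1 *; set Bd := B2t _ in eI1 b2.
have key : phi x - x / 2 * lam * phi 1 * B = lam * (- E0 - E1
   - x / 2 * (Bd * (d * d * pN d)) - x / 2 * (2 * I2 + lam * I3)
   - x / 2 * (B * (phi 1 - pN 1))).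
  have eI1' : I1 = - (x / 2) * B * pN 1 - - (x / 2) * Bd * (d * d * pN d) +
     x / 2 * (2 * I2 + lam * I3) by rewrite eI1 subrK.
  by rewrite e1 eI1'; ring.
rewrite key normrM.
have t1 : `|x / 2 * (Bd * (d * d * pN d))| <= 12^-1 * (d * A + e).
  rewrite (_ : (12^-1 : R) = 2^-1 * 6^-1); last by field.
  rewrite -[X in _ <= X]mulrA normrM; apply: ler_pM => //; first by rewrite ger0_norm.
  by rewrite normrM; apply: ler_pM.
have t2 : `|x / 2 * (B * (phi 1 - pN 1))| <= 12^-1 * e.
  rewrite (_ : (12^-1 : R) = 2^-1 * 6^-1); last by field.
  rewrite -[X in _ <= X]mulrA normrM; apply: ler_pM => //; first by rewrite ger0_norm.
  by rewrite normrM; apply: ler_pM.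
have t3 : `|x / 2 * (2 * I2 + lam * I3)| <= x / 2 * (2 * (x / 3 * (A' + 4 * A)) +
    Lam * (J * x + x * (1 + ln x^-1) * ((A' + 5 * A) / 3))) + 6^-1 * e.
  rewrite normrM (ger0_norm x20).
  apply: (@le_trans _ _ (x / 2 * (2 * (x / 3 * (A' + 4 * A) + 6^-1 * e) +
    Lam * (J * x + x * (1 + ln x^-1) * ((A' + 5 * A) / 3))))).
    rewrite ler_wpM2l//.
    apply: le_trans (ler_normD _ _) _; rewrite !normrM (@ger0_norm _ 2)//.
    by apply: lerD; rewrite ler_wpM2l.
  have : x * e <= e by rewrite ler_piMl.
  lra.
pose M3 := x / 2 * (2 * (x / 3 * (A' + 4 * A)) +
    Lam * (J * x + x * (1 + ln x^-1) * ((A' + 5 * A) / 3))).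
rewrite -/M3 in t3.
have -> : Lam * (x / 2) * (2 * (x / 3 * (A' + 4 * A)) + Lam * (J * x) +
     Lam * (x * (1 + ln x^-1) * ((A' + 5 * A) / 3))) + Lam * A * d + Lam * e =
  Lam * (M3 + A * d + e) by rewrite /M3; ring.
rewrite ler_wpM2l//.
apply: le_trans (ler_normB _ _) _.
apply: le_trans (lerD (ler_normB _ _) (lexx _)) _.
apply: le_trans (lerD (lerD (ler_normB _ _) (lexx _)) (lexx _)) _.
apply: le_trans (lerD (lerD (lerD (ler_normB _ _) (lexx _)) (lexx _)) (lexx _)) _.
rewrite normrN.
have dA : 0 <= A * d by rewrite mulr_ge0// ltW.
lra.
Qed.

Lemma phi_expansion x : 0 < x <= 1 ->
  `|phi x / x - 2^-1 * lam * phi 1 * B2t x^-1| <=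
  Lam / 2 * x * (2 / 3 * (A' + 4 * A) + Lam * J +
     Lam * (1 + ln x^-1) * ((A' + 5 * A) / 3)).
Proof.
move=> hx; have /andP[x0 x1] := hx.
have xi1 : 1 <= x^-1 by rewrite invf_ge1.
have [K hK] : exists K : nat, K%:R <= x^-1 < K.+1%:R.
  exists `|Num.floor x^-1|%N.
  have e : (`|Num.floor x^-1|%N%:R : R) = flr x^-1.
    by rewrite /flr pmulrn gez0_abs// floor_ge0; lra.
  by rewrite -natr1 e flr_le flr_gt.
have K0 : (0 < K)%N.
  case: K hK => // /andP[_]; lra.
have -> : phi x / x - 2^-1 * lam * phi 1 * B2t x^-1 =
   (phi x - x / 2 * lam * phi 1 * B2t x^-1) * x^-1.
  by move: (B2t _) => b; field; rewrite gt_eqF.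
rewrite normrM normfV (gtr0_norm x0) ler_pdivrMr//.
(* For fixed d first N -> infinity, then d -> 0: the order matters because the truncation error
   contains d^-2/N. *)
apply: (@le_add_eps _ _ _ (Lam * A)) => d d0 d4.
apply: (@le_add_divn _ _ _ (Lam * (Lam * (A * d^-1 ^+ 2))) (K + Num.bound d^-1)) => N hN.
have h1 : 1 <= N.+1%:R * d.
  rewrite -ler_pdivrMr// mul1r; apply: ltW.
  apply: lt_le_trans (archi_boundP (ltW _)) _; first by rewrite invr_gt0.
  by rewrite ler_nat (leq_trans _ (leq_trans hN _))// leq_addl.
have := @phi_expansion_trunc x d K N.+1 hx d0 ltac:(lra) K0 _ hK h1.
move=> /(_ ltac:(by rewrite (leq_trans _ (leq_trans hN _))// leq_addr)) /le_trans; apply.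
rewrite le_eqVlt; apply/orP; left; apply/eqP.
by move: (ln _) N.+1%:R^-1 => l i; ring.
Qed.

End Expansion.

(** * Choice of parameters and numerical constants *)

Section EigenBound.
Variables (R : realType) (phi : R -> R) (lam : R).
Local Notation Lam := `|lam|.
Local Notation L := (ln `|lam|).
Hypothesis mphi : measurable_fun [set: R] phi.
Hypothesis Lam2 : 2 <= Lam.
Hypothesis phi_bd : forall y, 0 < y <= 1 -> `|phi y| <= Lam / 2.
Hypothesis phiE : forall x, 0 < x <= 1 ->
  phi x = - lam * Int 0 1 (fun y => B1t (x * y)^-1 * phi y).

Let A : R := 7 * Lam ^+ 3 * L.
Let J : R := 5 * Lam * L.
Let eps : R := (2 * Lam ^+ 2)^-1.

Let phi_leA : forall y, 0 < y <= 1 -> `|phi y| <= A * y := phi_le mphi Lam2 phi_bd phiE.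

(** The decay bound covers ]0, d] at cost A d, so the bound on [d, 1], uniform in d, extends to the
    whole interval. *)
Lemma Int_abs_phi_le : Int 0 1 (fun z => `|phi z| * z^-1) <= J.
Proof.
apply: (@le_add_eps _ _ _ A) => d d0 d4.
have m := absphi_div_bm mphi phi_leA.
rewrite (@Int_split _ 0 d 1); [|lra|exact: m].
rewrite addrC; apply: lerD.
  by apply: (absint_le mphi Lam2 phi_bd phiE); lra.
apply: le_trans (ler_norm _) _; rewrite -[X in _ * X]subr0.
apply: Int_bound; [exact: ltW | by apply: bdd_measurableS m => //; lra |].
move=> z zd; have z0 : 0 < z by lra.
rewrite normrM normr_id normfV (gtr0_norm z0) ler_pdivrMr//.
by apply: phi_leA; lra.
Qed.

(** The left side is the constant of [phi_lipschitz] with [lip_gain] unfolded, for u = Lam, l = log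
    Lam, k = [kvar_total], a = A, e = eps. It equals u S + S + 4 a with S <= 45 u^2 l^2, and 45 +
    45/2 + 56 <= 124. *)
Lemma lip_const_le (u l k a e : R) : 2 <= u -> 2^-1 <= l -> 0 <= k ->
  k <= 40 * u ^+ 2 * l ^+ 2 -> a = 7 * u ^+ 3 * l -> e = (2 * u ^+ 2)^-1 ->
  u * (u / 2 + k + (2 * (u * (u / 2 + k + a * e + 4 * a)) + a) * e) <=
  124 * (u ^+ 3 * l ^+ 2).
Proof.
move=> u2 l2 k0 hk aE eE; have u0 : 0 < u by lra.
have ae : a * e = 7 / 2 * (u * l) by rewrite aE eE; field; rewrite gt_eqF.
have ue : u * (u * e) = 2^-1 by rewrite eE; field; rewrite gt_eqF.
have -> : u * (u / 2 + k + (2 * (u * (u / 2 + k + a * e + 4 * a)) + a) * e) =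
   u * (u / 2 + k + a * e) + 2 * (u * (u * e)) * (u / 2 + k + a * e + 4 * a) by ring.
rewrite ue ae aE.
have ul1 : 1 <= u * l by nra.
have h1 : u * l <= u ^+ 2 * l ^+ 2.
  by rewrite -exprMn expr2 ler_peMl//; lra.
have h2 : u / 2 <= u ^+ 2 * l ^+ 2.
  have -> : u ^+ 2 * l ^+ 2 = (u * l) * (u * l) by ring.
  have : u / 2 <= u * l by rewrite ler_pM2l.
  nra.
set S := u / 2 + k + 7 / 2 * (u * l).
have hS : S <= 45 * (u ^+ 2 * l ^+ 2) by rewrite /S; lra.
have S1 : u * S <= 45 * (u ^+ 3 * l ^+ 2).
  have -> : 45 * (u ^+ 3 * l ^+ 2) = u * (45 * (u ^+ 2 * l ^+ 2)) by ring.
  by rewrite ler_pM2l.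
have h3 : 2 * (u ^+ 2 * l ^+ 2) <= u ^+ 3 * l ^+ 2.
  have -> : u ^+ 3 * l ^+ 2 = u * (u ^+ 2 * l ^+ 2) by ring.
  by rewrite ler_wpM2r// mulr_ge0 ?sqr_ge0.
have h4 : u ^+ 3 * l <= 2 * (u ^+ 3 * l ^+ 2).
  have -> : 2 * (u ^+ 3 * l ^+ 2) = u ^+ 3 * (2 * l * l) by ring.
  rewrite ler_wpM2l ?exprn_ge0 ?(ltW u0)//; nra.
lra.
Qed.

(** In units of u t r, with t = u^3 l^2, the three terms are at most 60, 5 and 65; the prefactor u
    x/2 halves the total to 65, rounded up to 100. *)
Lemma final_const_le (u l x r a a' : R) : 2 <= u -> 2^-1 <= l -> 0 < x -> 1 <= r ->
  a' <= 124 * (u ^+ 3 * l ^+ 2) -> a = 7 * u ^+ 3 * l ->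
  u / 2 * x * (2 / 3 * (a' + 4 * a) + u * (5 * u * l) + u * r * ((a' + 5 * a) / 3)) <=
  100 * u ^+ 5 * l ^+ 2 * x * r.
Proof.
move=> u2 l2 x0 r1 ha aE; have u0 : 0 < u by lra.
have ra : a <= 14 * (u ^+ 3 * l ^+ 2).
  have -> : 14 * (u ^+ 3 * l ^+ 2) = u ^+ 3 * (14 * l * l) by ring.
  rewrite aE (_ : 7 * u ^+ 3 * l = u ^+ 3 * (7 * l)); last by ring.
  by rewrite ler_wpM2l ?exprn_ge0 ?(ltW u0)//; nra.
set t := u ^+ 3 * l ^+ 2 in ha ra.
have t0 : 0 <= t by rewrite mulr_ge0 ?sqr_ge0 ?exprn_ge0// ltW.
have h1 : 2 / 3 * (a' + 4 * a) <= 60 * (u * t * r).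
  have : 2 * t <= u * t by rewrite ler_wpM2r.
  have : u * t <= u * t * r by rewrite ler_peMr// mulr_ge0// ltW.
  lra.
have h2 : u * (5 * u * l) <= 5 * (u * t * r).
  have k1 : u * t <= u * t * r by rewrite ler_peMr// mulr_ge0// ltW.
  have k2 : u * (5 * u * l) <= 5 * (u * t).
    have -> : u * (5 * u * l) = 5 * (u ^+ 2 * l) by ring.
    have -> : 5 * (u * t) = 5 * (u ^+ 2 * l * (u ^+ 2 * l)) by rewrite /t; ring.
    rewrite ler_pM2l//; have : 1 <= u ^+ 2 * l by nra.
    by move=> h; rewrite ler_peMl//; lra.
  lra.
have h3 : u * r * ((a' + 5 * a) / 3) <= 65 * (u * t * r).
  have -> : 65 * (u * t * r) = u * r * (65 * t) by ring.
  by rewrite ler_wpM2l ?mulr_ge0//; lra.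
apply: (@le_trans _ _ (u / 2 * x * (130 * (u * t * r)))).
  by rewrite ler_wpM2l ?mulr_ge0//; lra.
have -> : u / 2 * x * (130 * (u * t * r)) = 65 * (u ^+ 5 * l ^+ 2 * x * r).
  by rewrite /t; field.
have : 0 <= u ^+ 5 * l ^+ 2 * x * r.
  by rewrite !mulr_ge0 ?sqr_ge0 ?exprn_ge0 ?(ltW u0) ?(ltW x0)//; lra.
lra.
Qed.

Lemma eigen_bound x : 0 < x <= 1 ->
  `|phi x / x - 2^-1 * lam * phi 1 * B2t x^-1| <=
  100 * Lam ^+ 5 * L ^+ 2 * x * (1 + ln x^-1).
Proof.
move=> hx; have /andP[x0 x1] := hx.
have u0 := Lam_gt0 Lam2; have hL := ln_Lam_ge Lam2.
have hu := Lam2.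
have e0 : 0 < eps by rewrite invr_gt0 mulr_gt0// exprn_gt0.
have e01 : 0 < eps <= 1.
  by rewrite e0 /eps invf_le1 ?mulr_gt0 ?exprn_gt0//; nra.
have es : Lam * eps <= 2^-1.
  have -> : Lam * eps = 2^-1 * Lam^-1 by rewrite /eps; field; rewrite gt_eqF.
  by rewrite ler_piMr// invf_le1//; lra.
have hJ := Int_abs_phi_le.
have k0 := kvar_total_ge0 lam hJ e01.
(* 40 = 5 * 8, since 1/2 + 2 log(1/eps) + log 2 <= (1 + 6 + 1) L. *)
have hk : kvar_total lam J eps <= 40 * Lam ^+ 2 * L ^+ 2.
  have l2 : ln 2 <= L by rewrite ler_ln ?posrE.
  have le : ln eps^-1 <= 3 * L by rewrite /eps invrK; exact: ln_2Lam2.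
  rewrite /kvar_total /J.
  have -> : 40 * Lam ^+ 2 * L ^+ 2 = Lam * (5 * Lam * L * (8 * L)) by ring.
  rewrite ler_pM2l// ler_wpM2l//; first by rewrite !mulr_ge0//; lra.
  lra.
have lip := phi_lipschitz mphi phi_bd phi_leA hJ phiE e01 es.
set A' := Lam * _ in lip.
have A'le : A' <= 124 * (Lam ^+ 3 * L ^+ 2) by exact: lip_const_le.
have A'0 : 0 <= A'.
  have G0 := lip_gain_ge0 lam phi_leA hJ e01.
  have hA := A_ge0 phi_leA.
  have : 0 <= (2 * lip_gain lam A J eps + A) * eps by rewrite mulr_ge0 ?(ltW e0)//; lra.
  by move=> h; rewrite /A' mulr_ge0//; lra.
apply: le_trans (phi_expansion mphi phi_leA hJ phiE A'0 lip hx) _.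
apply: final_const_le => //.
by rewrite lerDl ln_ge0// invf_ge1.
Qed.

End EigenBound.

(** * From a normalised square-integrable eigenfunction to the standing hypotheses *)

Section Reduction.
Variables (R : realType) (phi : R -> R) (lam : R).
Local Notation mu := (@lebesgue_measure R).
Local Notation Lam := `|lam|.
Hypothesis phiL2 : L2_01 phi.
Hypothesis phi1 : inner phi phi = 1.
Hypothesis phi_eig : forall x, 0 <= x <= 1 ->
  phi x = lam * Rintegral mu (@I01 R) (fun y => Kker x y * phi y).

Lemma norm_Kker (x y : R) : `|Kker x y| <= 2^-1.
Proof.
rewrite /Kker; case: ifP => _; last by rewrite normr0 invr_ge0.
by rewrite distrC; exact: norm_B1t.
Qed.

Lemma measurable_Kker (x : R) : measurable_fun [set: R] (Kker x).
Proof.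
rewrite /Kker; have [x0|x0] /= := ltP 0 x; last exact: measurable_cst.
apply: measurable_fun_ifT => //; first exact: measurable_fun_ltr.
apply: measurable_funB => //.
exact: measurable_comp_invM (@measurable_fracp R).
Qed.

Let mI : measurable (@I01 R). Proof. exact: measurable_itv. Qed.

Lemma mu_I01 : mu (@I01 R) = 1%E.
Proof. by rewrite /I01 /= lebesgue_measure_itv /= lte_fin ltr01 oppr0 adde0. Qed.

Lemma integrable_cst_I01 (c : R) : mu.-integrable (@I01 R) (EFin \o (fun=> c)).
Proof.
apply: measurable_bounded_integrable => //; first by rewrite /= mu_I01 ltry.
exists `|c|; split; first exact: num_real.
by move=> t ct y _ /=; exact: ltW.
Qed.

Let isqr : mu.-integrable (@I01 R) (EFin \o (fun y => phi y ^+ 2)).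
Proof. by case: phiL2. Qed.

Let isum (c : R) : mu.-integrable (@I01 R) (EFin \o (fun y => c * (1 + phi y ^+ 2))).
Proof.
have -> : EFin \o (fun y => c * (1 + phi y ^+ 2)) =
    (fun y => c%:E * ((1%:E : \bar R) + (phi y ^+ 2)%:E))%E.
  by apply/funext => y; rewrite /= -EFinD -EFinM.
apply: integrableZl => //; apply: integrableD => //.
exact: (integrable_cst_I01 1).
Qed.

Let int_sqr : Rintegral mu (@I01 R) (fun y => phi y ^+ 2) = 1.
Proof. by rewrite -phi1; apply: eq_Rintegral => y _; rewrite expr2. Qed.

(** This is (|phi| - 1)^2 >= 0. A majorant built from phi^2 replaces Cauchy-Schwarz, and its
    integral is exactly 1/2. *)
Let Kphi_le (x y : R) : `|Kker x y * phi y| <= 4^-1 * (1 + phi y ^+ 2).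
Proof.
rewrite normrM; apply: (@le_trans _ _ (2^-1 * `|phi y|)).
  by rewrite ler_wpM2r//; exact: norm_Kker.
rewrite -(real_normK (num_real (phi y))).
have := sqr_ge0 (`|phi y| - 1); rewrite sqrrB1; lra.
Qed.

Let iK (x : R) : mu.-integrable (@I01 R) (EFin \o (fun y => Kker x y * phi y)).
Proof.
apply: (le_integrable _ _ _ (isum 4^-1)) => //.
  apply/measurable_EFinP; apply: measurable_funM; last by case: phiL2.
  by apply: measurable_funTS; exact: measurable_Kker.
move=> y _ /=; rewrite lee_fin; apply: le_trans (Kphi_le x y) _; exact: ler_norm.
Qed.

Lemma eigenfunction_bound x : 0 <= x <= 1 -> `|phi x| <= Lam / 2.
Proof.
move=> hx; rewrite phi_eig// normrM ler_wpM2l//.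
apply: le_trans (le_normr_Rintegral _ (iK x)) _ => //.
have -> : 2^-1 = Rintegral mu (@I01 R) (fun y => 4^-1 * (1 + phi y ^+ 2)).
  rewrite RintegralZl//; last first.
    by have := isum 1; under eq_fun do rewrite /= mul1r.
  rewrite RintegralD//; last exact: integrable_cst_I01.
  by rewrite int_sqr Rintegral_cst//= mu_I01/=; field.
apply: le_Rintegral => //; first exact: (integrable_norm (iK x)).
Qed.

(** The integral of phi^2 is 1 and is dominated by the square of the sup bound Lam/2. *)
Lemma eigenvalue_ge2 : 2 <= Lam.
Proof.
have h : 1 <= (Lam / 2) ^+ 2.
  rewrite -{1}int_sqr -[X in _ <= X]mulr1.
  have -> : (Lam / 2) ^+ 2 * 1 = Rintegral mu (@I01 R) (fun=> (Lam / 2) ^+ 2).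
    by rewrite Rintegral_cst//= mu_I01.
  apply: le_Rintegral => //; first exact: integrable_cst_I01.
  move=> y; rewrite /I01 /= in_itv /= => hy.
  rewrite -(real_normK (num_real (phi y))) lerXn2r ?nnegrE ?divr_ge0//.
  exact: eigenfunction_bound.
have := normr_ge0 lam; nra.
Qed.

(** phi is set to 0 outside [0, 1] to be measurable on the whole line. On ]0, 1] the kernel is
    -B1(1/(xy)), and dropping the null point y = 0 leads to the half-open interval. *)
Lemma eigen_reduction : [/\ measurable_fun [set: R] (phi \_ (@I01 R)),
  (forall y, 0 <= y <= 1 -> (phi \_ (@I01 R)) y = phi y) &
  forall x, 0 < x <= 1 -> (phi \_ (@I01 R)) x =
    - lam * Int 0 1 (fun y => B1t (x * y)^-1 * (phi \_ (@I01 R)) y)].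
Proof.
have m : measurable_fun [set: R] (phi \_ (@I01 R)).
  have [mp _] := phiL2; exact: (measurable_restrictT phi mI).1 mp.
have e y : 0 <= y <= 1 -> (phi \_ (@I01 R)) y = phi y.
  by move=> hy; rewrite patchE mem_set// /I01 /= in_itv.
split=> // x hx; have /andP[x0 x1] := hx.
rewrite e ?(ltW x0)// phi_eig ?(ltW x0)// mulNr -mulrN; congr (_ * _).
rewrite -mulN1r -IntZ; last first.
  apply: bdd_measurableM; first exact: bdd_measurable_B1t.
  apply: (bdd_measurableT m) => y y01; rewrite e; last by lra.
  by apply: eigenfunction_bound; lra.
rewrite /I01 -Rintegral_itv_obnd_cbnd; last first.
  by apply: integrableS (iK x) => // y; rewrite /I01 /= !in_itv /=; lra.
apply: eq_Int => y y01; rewrite e; last by lra.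
have /andP[y0 _] := y01.
by rewrite /Kker x0 y0 /= /B1t; ring.
Qed.

End Reduction.

Theorem theorem5p11 (R : realType) :
  exists C : R, 0 < C /\
  forall (phi : nat -> R -> R) (lam : nat -> R),
    maximal_ordered_eigensystem phi lam ->
    forall (j : nat) (x : R), 0 < x <= 1 ->
      `| phi j x / x - 2^-1 * lam j * phi j 1 * B2t (x^-1) |
        <= C * `|lam j| ^+ 5 * (ln `|lam j|) ^+ 2 * x * (1 + ln (x^-1)).
Proof.
exists 100; split=> // phi lam [heig [horth _]] j x hx.
have [[phiL2 [_ phi_eig]] _] := heig j.
have phi1 : inner (phi j) (phi j) = 1 by rewrite horth eqxx.
have [m e E] := eigen_reduction phiL2 phi1 phi_eig.
have L2 := eigenvalue_ge2 phiL2 phi1 phi_eig.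
have b y : 0 < y <= 1 -> `|(phi j \_ (@I01 R)) y| <= `|lam j| / 2.
  move=> y01; rewrite e; last by lra.
  by apply: (eigenfunction_bound phiL2 phi1 phi_eig); lra.
have := eigen_bound m L2 b E hx.
by rewrite !e// ?ler01 ?lexx//; lra.
Qed.
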